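(* Let $\mathcal{NN}$ be a function space CNN (as defined in the context) with $p=2$, a Lipschitz continuous activation function $\sigma:\mathbb{R}\to\mathbb{R}$, and $L\ge 2$ layers (i.e. at least two convolutional layers). Then for every input $\mu\in\mathcal{M}(\overline{\Omega_0})$, every $w\in\mathcal{W}^2(\Sigma)$ and every $b\in\mathbb{R}^L$ we have $\mathcal{NN}(\mu,w,b)\in C(\overline{\Omega})$. If in addition $\mu\in \mathrm{BV}(\Omega_0)$ (identified with the measure $\mu\,\mathrm{d}x$), then $\mathcal{NN}(\mu,w,b)\in C^1(\overline{\Omega})$.
   Context: A rectangular domain is a nonempty open set $(a,b)\times(c,d)\subset\mathbb{R}^2$. For rectangular $\Omega,\Sigma$ with $0\in\Sigma$ set $\Omega-\Sigma=\{x-y: x\in\Omega,y\in\Sigma\}$. $\mathcal{M}(\overline{\theta})$ is the space of finite signed Radon measures on $\overline\theta$ (dual of $C(\overline\theta)$), with total variation norm. $\mathrm{BV}(\theta)=\{u\in L^1(\theta): \mathrm{D}u\in\mathcal{M}(\theta)\}$, $\mathrm{D}u$ the distributional derivative. Valid convolution: for $w\in L^p(\Sigma)$ and $u\in L^1(\Omega-\Sigma)$, $(u*w)(x)=\int_\Sigma w(y)u(x-y)\,\mathrm{d}y$ for $x\in\Omega$; for $\mu\in\mathcal{M}(\overline{\Omega-\Sigma})$, $(\mu*w)(x)=\int \tilde w(x-z)\,\mathrm{d}\mu(z)$, $x\in\Omega$, where $\tilde w$ is the zero extension of $w$; in both cases $u*w\in L^p(\Omega)$. Extension by reflection: for $\theta=(a,b)\times(c,d)$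 and a function $u$ on $\overline\theta$, let $\bar u$ be its extension to $\mathbb{R}^2$ by repeated even reflection across the sides of the rectangle (elementary step: $\bar u(x_1,x_2)=u(x_1,|x_2-c|+c)$ extends across the side $x_2=c$; analogously across the other sides, iterated). For $\mu\in\mathcal{M}(\overline\theta)$, $\bar\mu$ is defined analogously: it agrees with $\mu$ on $\overline\theta$ and on each reflected copy of the rectangle it is the image of $\mu$ under the corresponding reflection. For a rectangular $\Omega\supseteq\theta$, $\mathfrak{R}_{\theta,\Omega}u:=\bar u|_{\Omega}$, $\mathfrak{R}_{\theta,\Omega}\mu:=\bar\mu|_{\overline\Omega}$. Function space CNN: let $L\in\mathbb{N}$, $\sigma:\mathbb{R}\to\mathbb{R}$, $p\in(1,\infty]$, rectangular domains $\Omega_0,\dots,\Omega_L=\Omega$ and $\Sigma_0,\dots,\Sigma_{L-1}$ with $0\in\Sigma_l$; set $\Omega_l'=\Omega_{l+1}-\Sigma_l$ and assume $\Omega_l\subseteq\Omega_l'$. Let $\mathcal{W}^p(\Sigma)=L^p(\Sigma_0)\times\dots\times L^p(\Sigma_{L-1})$. For $\mu\in\mathcal{M}(\overline{\Omega_0})$, $w=(w^l)_l\in\mathcal{W}^p(\Sigma)$, $b=(b^l)_l\in\mathbb{R}^L$ define $\mu^0=\mu$, $\mu^{l+1}=\sigma\big((\mathfrak{R}_{\Omega_l,\Omega_l'}\mu^l)*w^l+b^l\big)$ for $l=0,\dots,L-2$ ($\sigma$ applied pointwise), and $\mathcal{NN}(\mu,w,b)=(\mathfrak{R}_{\Omega_{L-1},\Omega_{L-1}'}\mu^{L-1})*w^{L-1}+b^{L-1}\in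 L^p(\Omega)$. *)

(* Defs.v *)
From HB Require Import structures.
From mathcomp Require Import all_boot all_order all_algebra.
From mathcomp Require Import all_classical all_reals all_analysis.
Import Order.TTheory GRing.Theory Num.Theory.
Import numFieldNormedType.Exports.

Set Implicit Arguments.
Unset Strict Implicit.
Unset Printing Implicit Defensive.

Local Open Scope classical_set_scope.
Local Open Scope ring_scope.

Section CNNDefs.
Variable R : realType.

Definition leb2 := ((@lebesgue_measure R) \x (@lebesgue_measure R))%E.

Record rect := Rect { rxa : R; rxb : R; ryc : R; ryd : R;
                      rect_ab : rxa < rxb; rect_cd : ryc < ryd }.

Definition rect_open (t : rect) : set (R * R) :=
  [set x | rxa t < x.1 < rxb t /\ ryc t < x.2 < ryd t].
Definition rect_cl (t : rect) : set (R * R) :=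
  [set x | rxa t <= x.1 <= rxb t /\ ryc t <= x.2 <= ryd t].

Definition diffset (A B : set (R * R)) : set (R * R) :=
  [set z | exists x y, A x /\ B y /\ z = x - y].

(** 1-d folding map: repeated even reflection of the real line onto [a,b]
    (triangle wave of period 2(b-a), identity on [a,b]). *)
Definition fold1 (a b t : R) : R :=
  let h := b - a in
  let s := t - a - 2 * h * (Num.floor ((t - a) / (2 * h)))%:~R in
  a + (if s <= h then s else 2 * h - s).

Definition rfold (t : rect) (x : R * R) : R * R :=
  (fold1 (rxa t) (rxb t) x.1, fold1 (ryc t) (ryd t) x.2).

Definition reflF (t : rect) (u : R * R -> R) : R * R -> R :=
  fun x => u (rfold t x).

Definition L2on (A : set (R * R)) (f : R * R -> R) : Prop :=
  measurable_fun A f /\ (\int[leb2]_(x in A) ((f x) ^+ 2)%:E < +oo)%E.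

Definition convF (u w : R * R -> R) (S : set (R * R)) (x : R * R) : R :=
  fine (\int[leb2]_(y in S) (w y * u (x - y))%:E)%E.

(** Valid convolution of the reflection extension  R_{t,Op} mu  of a finite
    signed measure mu = mp - mm on the closed rectangle t with w (zero extended
    outside S):  x |-> int  w~(x - z) d(mu-bar restricted to closure Op)(z).
    The integral against the reflected measure mu-bar is written out through
    the folding map: mu-bar agrees with mu on the closed rectangle and is the
    image of mu under the relevant reflection on every reflected closed copy,
    so  int g d(mu-bar|_{cl Op}) = int_{cl t} sum_{z' in cl Op, rfold z' = z} g(z') dmu(z). *)
Definition conv_meas (mp mm : {finite_measure set (R * R)%type -> \bar R})
  (t : rect) (Op : set (R * R)) (w : R * R -> R) (S : set (R * R)) (x : R * R) : R :=
  let G := fun z : R * R =>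
    \sum_(z' \in [set z' | rfold t z' = z /\ closure Op z']) (w \_ S) (x - z') in
  fine (\int[mp]_(z in rect_cl t) (G z)%:E)%E
  - fine (\int[mm]_(z in rect_cl t) (G z)%:E)%E.

Definition Omp (Om Sg : nat -> rect) (l : nat) : set (R * R) :=
  diffset (rect_open (Om l.+1)) (rect_open (Sg l)).

Fixpoint preact (sigma : R -> R) (Om Sg : nat -> rect) (w : nat -> R * R -> R)
  (b : nat -> R) (mp mm : {finite_measure set (R * R)%type -> \bar R}) (n : nat)
  : R * R -> R :=
  match n with
  | 0 => fun x => conv_meas mp mm (Om 0%N) (Omp Om Sg 0) (w 0%N) (rect_open (Sg 0%N)) x
                  + b 0%N
  | k.+1 => fun x =>
      convF (reflF (Om k.+1) (fun y => sigma (preact sigma Om Sg w b mp mm k y)))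
            (w k.+1) (rect_open (Sg k.+1)) x + b k.+1
  end.

Definition NN (L : nat) (sigma : R -> R) (Om Sg : nat -> rect)
  (w : nat -> R * R -> R) (b : nat -> R)
  (mp mm : {finite_measure set (R * R)%type -> \bar R}) : R * R -> R :=
  preact sigma Om Sg w b mp mm L.-1.

Definition e1 : R * R := (1, 0).
Definition e2 : R * R := (0, 1).

Definition C1_cl (t : rect) (g : R * R -> R) : Prop :=
  {within rect_cl t, continuous g} /\
  exists d1 d2 : R * R -> R,
    {within rect_cl t, continuous d1} /\ {within rect_cl t, continuous d2} /\
    forall x, rect_open t x ->
      [/\ derivable g x e1, 'D_e1 g x = d1 x, derivable g x e2 & 'D_e2 g x = d2 x].

Fixpoint dpart (s : seq bool) (f : R * R -> R) : R * R -> R :=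
  match s with
  | [::] => f
  | i :: s' => fun x => 'D_(if i then e1 else e2) (dpart s' f) x
  end.

Definition smooth (f : R * R -> R) : Prop :=
  forall s : seq bool, continuous (dpart s f) /\
    forall x, derivable (dpart s f) x e1 /\ derivable (dpart s f) x e2.

Definition Ccinf (A : set (R * R)) (f : R * R -> R) : Prop :=
  smooth f /\ exists K, compact K /\ K `<=` A /\ (forall x, ~ K x -> f x = 0).

Definition RintL (A : set (R * R)) (f : R * R -> R) : R :=
  fine (\int[leb2]_(x in A) (f x)%:E)%E.

Definition supported_on (n : {finite_measure set (R * R)%type -> \bar R})
  (A : set (R * R)) : Prop := n (~` A) = 0%E.

Definition sint (np nm : {finite_measure set (R * R)%type -> \bar R})
  (A : set (R * R)) (f : R * R -> R) : R :=
  fine (\int[np]_(x in A) (f x)%:E)%E - fine (\int[nm]_(x in A) (f x)%:E)%E.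

Definition BV (t : rect) (u : R * R -> R) : Prop :=
  measurable_fun (rect_open t) u /\
  leb2.-integrable (rect_open t) (EFin \o u) /\
  exists n1p n1m n2p n2m : {finite_measure set (R * R)%type -> \bar R},
    [/\ supported_on n1p (rect_open t), supported_on n1m (rect_open t),
        supported_on n2p (rect_open t), supported_on n2m (rect_open t) &
    forall phi, Ccinf (rect_open t) phi ->
      RintL (rect_open t) (fun x => u x * 'D_e1 phi x)
        = - sint n1p n1m (rect_open t) phi /\
      RintL (rect_open t) (fun x => u x * 'D_e2 phi x)
        = - sint n2p n2m (rect_open t) phi].

Definition meas_is_BV (t : rect) (mp mm : {finite_measure set (R * R)%type -> \bar R})
  : Prop :=
  exists u : R * R -> R, BV t u /\
    forall A : set (R * R), measurable A ->
      fine (mp A) - fine (mm A) = RintL (A `&` rect_open t) u.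

End CNNDefs.

(* Main.v *)
Require Import Defs.
From HB Require Import structures.
From mathcomp Require Import all_boot all_order all_algebra.
From mathcomp Require Import all_classical all_reals all_analysis.
From mathcomp Require Import measurable_realfun ring lra zify.
Import Order.TTheory GRing.Theory Num.Theory.
Import numFieldNormedType.Exports.
Set Implicit Arguments.
Unset Strict Implicit.
Unset Printing Implicit Defensive.
Local Open Scope classical_set_scope.
Local Open Scope ring_scope.

(* Convolving an L^2 kernel [W] with an [L2loc] function gives a continuous
   function, by Cauchy-Schwarz and the L^2-continuity of translations; so it
   suffices that the preactivation of the first layer is locally L^2, which is
   Jensen's inequality and Tonelli, and that reflection and a Lipschitz
   activation preserve this class. Hence [NN] itself is continuous.

   For the C^1 part, weak differentiability of [u] is replaced by the bound
   |u(. + h e) - u|_{L^2(box)} <= C |h| ([Pdiff]), which is manifestly stable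
   under Lipschitz activations and convolutions. If [u] satisfies it, the second
   differences of [W * u] are o(|h|) uniformly, which makes [W * u] of class C^1
   along [e]. For the first layer the bound is obtained by duality: testing an
   increment against itself leaves an integral against the BV measure of a
   function whose one-dimensional primitives are O(|h|), and such integrals are
   controlled by the variation of the derivative. *)

(** * Lebesgue measure on the plane *)

(** The two factors of a convolution [W * u] play different roles. The increment of [u] by [h e] has
    L^2 size O(|h|), and a small translation changes [W] by o(1) in L^2; a second difference of
    [W * u] pairs the two, so no derivative of [u] is ever formed.

    In the first layer the obstacle is a gap between the test functions allowed by the BV condition,
    smooth with compact support in the open rectangle, and the functions produced by duality, which
    are merely bounded and measurable and need not vanish at the boundary. Integration by parts is
    therefore used only for tensors [f(x1) g(x2)], whose bounded limits reach the others by a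
    monotone class argument, and the boundary condition is enforced by a bump correction. The
    primitives are O(|h|) because an increment integrated over an interval leaves only two end
    pieces of length comparable to |h|.

    The reflected measure enters through finitely many isometries: on a bounded set folding has
    finitely many inverse branches, so convolution with it is a finite sum of ordinary ones, each
    cut off to a product of intervals. *)

HB.instance Definition _ (R : realType) :=
  Measure.copy (@leb2 R) (@lebesgue_measure R \x @lebesgue_measure R)%E.

Section leb2_sigma_finite.
Variable R : realType.
Notation lam := (@lebesgue_measure R).

Let leb2_sigma_finite : sigma_finite setT (@leb2 R).
Proof.
have /sigma_finiteP[F [TF ndF Foo]] := sigma_finiteT lam.
exists (fun n => F n `*` F n).
  rewrite -setXTT TF predeqE => -[x y]; split.
    move=> [/= [n _ Fnx] [k _ Gky]]; exists (maxn n k) => //; split.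
    - by move: x Fnx; exact/subsetPset/ndF/leq_maxl.
    - by move: y Gky; exact/subsetPset/ndF/leq_maxr.
  by move=> [n _ []/= ? ?]; split; exists n.
move=> k; have [? ?] := Foo k.
split; first exact: measurableX.
by rewrite /leb2 product_measure1E// lte_mul_pinfty// ge0_fin_numE.
Qed.

HB.instance Definition _ :=
  Measure_isSigmaFinite.Build _ _ _ (@leb2 R) leb2_sigma_finite.

End leb2_sigma_finite.

Section affine.
Variable R : realType.
Notation lam := (@lebesgue_measure R).
Notation leb2 := (@leb2 R).
Notation plane := (R * R)%type.

(** The isometries of the line, [s] telling whether the orientation is reversed. Translations, the
    substitution [z = x - y] and the reflected copies of a rectangle are all products of two of
    them. *)
Definition aff1 (s : bool) (c t : R) : R := (if s then - t else t) + c.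

Lemma measurable_aff1 s c : measurable_fun [set: R] (aff1 s c).
Proof.
by rewrite /aff1; case: s; apply: measurable_funD => //; exact: oppr_measurable.
Qed.

(** By uniqueness of Lebesgue measure it suffices to compare lengths of half-open intervals; a
    reflection merely moves the closed endpoint to the other side. *)
Lemma pushforward_aff1 s c (A : set R) : measurable A ->
  pushforward lam (aff1 s c : _ -> measurableTypeR R) A = lam A.
Proof.
move=> mA; apply/esym; apply: (@lebesgue_measure_unique R
  (pushforward lam (aff1 s c : _ -> measurableTypeR R))) => //=.
  exact: measurable_aff1.
move=> _ _ [[a b]] _ <-.
rewrite /pushforward; case: s; rewrite /aff1.
- rewrite (_ : _ @^-1` _ = `[c - b, c - a[%classic); last first.
    by apply/seteqP; split=> x /=; rewrite !in_itv/= => /andP[? ?]; apply/andP; split; lra.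
  rewrite !lebesgue_measure_itv/= !lte_fin.
  rewrite (_ : (c - b < c - a) = (a < b)); last by apply/idP/idP => ?; lra.
  by case: ifP => // _; rewrite -!EFinB; congr (_%:E); lra.
- rewrite (_ : _ @^-1` _ = `]a - c, b - c]%classic); last first.
    by apply/seteqP; split=> x /=; rewrite !in_itv/= => /andP[? ?]; apply/andP; split; lra.
  rewrite !lebesgue_measure_itv/= !lte_fin.
  rewrite (_ : (a - c < b - c) = (a < b)); last by apply/idP/idP => ?; lra.
  by case: ifP => // _; rewrite -!EFinB; congr (_%:E); lra.
Qed.

Lemma ge0_int_aff1 s c (f : R -> \bar R) : measurable_fun [set: R] f ->
  (forall x, 0 <= f x)%E -> (\int[lam]_x f (aff1 s c x) = \int[lam]_x f x)%E.
Proof.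
move=> mf f0.
transitivity (\int[pushforward lam (aff1 s c : _ -> measurableTypeR R)]_x f x)%E.
  by rewrite ge0_integral_pushforward//; exact: measurable_aff1.
apply: eq_measure_integral; first exact: measurable_aff1.
move=> m A mA _; exact: pushforward_aff1.
Qed.

Definition aff2 (s1 : bool) (c1 : R) (s2 : bool) (c2 : R) (x : plane) : plane :=
  (aff1 s1 c1 x.1, aff1 s2 c2 x.2).

Lemma measurable_aff2 s1 c1 s2 c2 : measurable_fun [set: plane] (aff2 s1 c1 s2 c2).
Proof.
apply: measurable_fun_pair.
  by apply: measurableT_comp (measurable_fst); exact: measurable_aff1.
by apply: measurableT_comp (measurable_snd); exact: measurable_aff1.
Qed.

Lemma ge0_int_aff2 s1 c1 s2 c2 (f : plane -> \bar R) :
  measurable_fun [set: plane] f -> (forall x, 0 <= f x)%E ->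
  (\int[leb2]_x f (aff2 s1 c1 s2 c2 x) = \int[leb2]_x f x)%E.
Proof.
move=> mf f0; rewrite /Defs.leb2 !fubini_tonelli1//; last first.
  by apply: measurableT_comp mf _; exact: measurable_aff2.
rewrite /fubini_F /aff2/=.
transitivity (\int[lam]_x \int[lam]_y f (aff1 s1 c1 x, y))%E.
  apply: eq_integral => x _; apply: (@ge0_int_aff1 s2 c2 (fun y => f (aff1 s1 c1 x, y))) => //.
  by apply: measurableT_comp mf _; exact: measurable_pair1.
apply: (@ge0_int_aff1 s1 c1 (fun x => \int[lam]_y f (x, y))%E) => //.
  exact: measurable_fun_fubini_tonelli_F.
by move=> x; apply: integral_ge0.
Qed.

Lemma int_aff2 s1 c1 s2 c2 (f : plane -> \bar R) :
  measurable_fun [set: plane] f ->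
  (\int[leb2]_x f (aff2 s1 c1 s2 c2 x) = \int[leb2]_x f x)%E.
Proof.
move=> mf; rewrite integralE [RHS]integralE.
rewrite -(@ge0_int_aff2 s1 c1 s2 c2 (f^\+)%E)//; last exact: measurable_funepos.
rewrite -(@ge0_int_aff2 s1 c1 s2 c2 (f^\-)%E)//; last exact: measurable_funeneg.
congr (_ - _)%E; apply: eq_integral => x _.
  by rewrite funepos.unlock.
by rewrite funeneg.unlock.
Qed.

End affine.

(** * The Cauchy-Schwarz inequality *)

Section cauchy_schwarz.
Context d (T : measurableType d) (R : realType) (mu : {measure set T -> \bar R}).

(** The weight [s = x / A] is optimal. If [A = 0], the weight [(B + 1) / x] contradicts [0 < x]. *)
Lemma sqr_le_of_amgm (x A B : R) : 0 <= x -> 0 <= A -> 0 <= B ->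
  (forall s : R, 0 < s -> 2 * x <= s * A + s^-1 * B) -> x ^+ 2 <= A * B.
Proof.
move=> x0 A0 B0 H.
have [->|xn0] := eqVneq x 0; first by rewrite expr0n/= mulr_ge0.
have xp : 0 < x by rewrite lt_neqAle eq_sym xn0.
have [A00|An0] := eqVneq A 0.
  have B1 : 0 < B + 1 by lra.
  have := H ((B + 1) / x) (divr_gt0 B1 xp).
  rewrite A00 mulr0 add0r invf_div.
  rewrite mulrAC ler_pdivlMr//; nra.
have Ap : 0 < A by rewrite lt_neqAle eq_sym An0.
have := H (x / A) (divr_gt0 xp Ap).
rewrite divfK// invf_div mulrAC => h.
have : x <= A * B / x by lra.
by rewrite ler_pdivlMr// expr2.
Qed.

Lemma cauchy_schwarz (D : set T) (f g : T -> R) (A B : R) : measurable D ->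
  measurable_fun D f -> measurable_fun D g -> 0 <= A -> 0 <= B ->
  (\int[mu]_(x in D) (f x ^+ 2)%:E <= A%:E)%E ->
  (\int[mu]_(x in D) (g x ^+ 2)%:E <= B%:E)%E ->
  mu.-integrable D (EFin \o (fun x => f x * g x)) /\
  (fine (\int[mu]_(x in D) `|f x * g x|%:E)) ^+ 2 <= A * B.
Proof.
move=> mD mf mg A0 B0 fA gB.
have mfg : measurable_fun D (fun x => `|f x * g x|).
  by apply: measurableT_comp => //; exact: measurable_funM.
(* Weighted AM-GM, integrated: [s f^2 + g^2 / s - 2 |f g| = (s |f| - |g|)^2 / s]. The case [s = 1]
   gives integrability, all [s] together the sharp bound. *)
have H (s : R) : 0 < s ->
  (2%:E * \int[mu]_(x in D) `|f x * g x|%:E <= (s * A + s^-1 * B)%:E)%E.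
  move=> s0.
  rewrite -ge0_integralZl//; last exact/measurable_EFinP.
  apply: (@le_trans _ _ (\int[mu]_(x in D) (s%:E * (f x ^+ 2)%:E + s^-1%:E * (g x ^+ 2)%:E))%E).
    apply: ge0_le_integral => //=.
    - by under eq_fun do rewrite -EFinM; apply/measurable_EFinP; exact: measurable_funM.
    - under eq_fun do rewrite -!EFinM -EFinD; apply/measurable_EFinP.
      by apply: measurable_funD; apply: measurable_funM => //; exact: measurable_funX.
    - move=> x _; rewrite -!EFinM -EFinD lee_fin normrM.
      have -> : s * f x ^+ 2 + s^-1 * g x ^+ 2 =
        2 * (`|f x| * `|g x|) + s^-1 * (s * `|f x| - `|g x|) ^+ 2.
        rewrite -[f x ^+ 2]real_normK ?num_real// -[g x ^+ 2]real_normK ?num_real//.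
        field; exact: lt0r_neq0.
      by rewrite lerDl mulr_ge0 ?sqr_ge0// invr_ge0 ltW.
  rewrite ge0_integralD//=; first last.
  - by under eq_fun do rewrite -EFinM; apply/measurable_EFinP; apply: measurable_funM => //; exact: measurable_funX.
  - by move=> x _; rewrite -EFinM lee_fin mulr_ge0 ?sqr_ge0// invr_ge0 ltW.
  - by under eq_fun do rewrite -EFinM; apply/measurable_EFinP; apply: measurable_funM => //; exact: measurable_funX.
  - by move=> x _; rewrite -EFinM lee_fin mulr_ge0 ?sqr_ge0// ltW.
  rewrite !ge0_integralZl//=; first last.
  - by rewrite lee_fin ltW.
  - by move=> x _; rewrite lee_fin sqr_ge0.
  - by apply/measurable_EFinP; exact: measurable_funX.
  - by rewrite lee_fin invr_ge0 ltW.
  - by move=> x _; rewrite lee_fin sqr_ge0.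
  - by apply/measurable_EFinP; exact: measurable_funX.
  rewrite EFinD !EFinM; by apply: leeD; rewrite lee_pmul2l// ?lte_fin ?invr_gt0.
have X0 : (0 <= \int[mu]_(x in D) `|f x * g x|%:E)%E.
  by apply: integral_ge0 => x _; rewrite lee_fin.
have Xfin : (\int[mu]_(x in D) `|f x * g x|%:E)%E \is a fin_num.
  rewrite ge0_fin_numE//; have := H 1 ltr01.
  case: (\int[mu]_(x in D) _)%E => [r _|/=|//]; first exact: ltry.
  by rewrite gt0_muley ?lte_fin.
split.
  apply/integrableP; split; first by apply/measurable_EFinP; exact: measurable_funM.
  by move: Xfin; rewrite ge0_fin_numE.
apply: sqr_le_of_amgm => //; first exact: fine_ge0.
by move=> s /H; rewrite -(fineK Xfin) -EFinM lee_fin.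
Qed.

End cauchy_schwarz.

(** * Bounded measurable functions *)

Section bounded_measurable.
Context d (T : measurableType d) (R : realType).
Implicit Types f g : T -> R.

(** These functions are integrable for every finite measure and stable under products and bounded
    pointwise limits, so that Lebesgue measure on bounded sets and the measures of the problem are
    treated alike. *)
Definition bm f := measurable_fun [set: T] f /\ exists K : R, forall x, `|f x| <= K.

Lemma bm_cst c : bm (fun=> c).
Proof. by split=> //; exists `|c|. Qed.

Lemma bmD f g : bm f -> bm g -> bm (fun x => f x + g x).
Proof.
move=> [mf [K Kf]] [mg [L Lg]]; split; first exact: measurable_funD.
by exists (K + L) => x; rewrite (le_trans (ler_normD _ _))// lerD.
Qed.

Lemma bmM f g : bm f -> bm g -> bm (fun x => f x * g x).
Proof.
move=> [mf [K Kf]] [mg [L Lg]]; split; first exact: measurable_funM.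
by exists (K * L) => x; rewrite normrM ler_pM.
Qed.

Lemma bmZ c f : bm f -> bm (fun x => c * f x).
Proof. by move=> bf; apply: bmM => //; exact: bm_cst. Qed.

Lemma bmB f g : bm f -> bm g -> bm (fun x => f x - g x).
Proof.
move=> bf [mg [K Kg]]; apply: bmD => //; split; first exact: measurableT_comp.
by exists K => x; rewrite normrN.
Qed.

Lemma bm_indic (A : set T) : measurable A -> bm (\1_A : T -> R).
Proof.
move=> mA; split; first exact: measurable_indic.
by exists 1 => x; rewrite indicE; case: (_ \in _) => /=; rewrite ?normr1 ?normr0.
Qed.

Variable mu : {measure set T -> \bar R}.
Variables (D : set T) (mD : measurable D) (Dfin : (mu D < +oo)%E).

Lemma bm_integrable f : bm f -> mu.-integrable D (EFin \o f).
Proof.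
move=> [mf [K Kf]]; apply: measurable_bounded_integrable => //.
  exact: measurable_funS mf.
by exists K; split; rewrite ?num_real// => y Ky x _ /=; rewrite (le_trans (Kf x))// ltW.
Qed.

Lemma Rintegral_bound f K : bm f -> (forall x, D x -> `|f x| <= K) ->
  `|\int[mu]_(x in D) f x| <= K * fine (mu D).
Proof.
move=> bf fK; rewrite (le_trans (le_normr_Rintegral _ _))//; first exact: bm_integrable.
rewrite -Rintegral_cst//; apply: le_Rintegral => //.
- apply: bm_integrable; case: bf => mf [L Lf]; split; first exact: measurableT_comp.
  by exists L => x; rewrite normr_id.
- exact/bm_integrable/bm_cst.
Qed.

Lemma Rintegral_dct (f_ : nat -> T -> R) f K :
  (forall n, measurable_fun [set: T] (f_ n)) -> (forall n x, `|f_ n x| <= K) ->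
  (forall x, f_ ^~ x @ \oo --> f x) ->
  (fun n => \int[mu]_(x in D) f_ n x) @ \oo --> \int[mu]_(x in D) f x.
Proof.
move=> mf fK ff.
have mlim : measurable_fun [set: T] f.
  by apply: (measurable_fun_cvg mf) => x _; exact: ff.
have [] := @dominated_convergence _ _ _ mu D mD (fun n => EFin \o f_ n) (EFin \o f)
   (fun=> K%:E).
- by move=> n; apply/measurable_EFinP; exact: measurable_funS (mf n).
- by apply/measurable_EFinP; exact: measurable_funS mlim.
- by apply: aeW => x _ /=; apply: cvg_EFin; [exact: nearW|exact: ff].
- exact/bm_integrable/bm_cst.
- by apply: aeW => x n _ /=; rewrite lee_fin.
move=> intf _ h; apply: fine_cvg; rewrite fineK//.
exact: integrable_fin_num.
Qed.

End bounded_measurable.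

(** * A functional monotone class theorem *)

Section functional_monotone_class.
Context d (T : measurableType d) (R : realType).

Lemma bm_sum (J : Type) (r : seq J) (F : J -> T -> R) : (forall i, bm (F i)) ->
  bm (fun x => \sum_(i <- r) F i x).
Proof.
move=> bF; elim: r => [|i r IH].
  by under eq_fun do rewrite big_nil; exact: bm_cst.
by under eq_fun do rewrite big_cons; exact: bmD.
Qed.

Variables (G : set (set T)) (P : (T -> R) -> Prop).
Hypothesis GE : @measurable _ T = <<s G >>.
Hypothesis GI : setI_closed G.
Hypothesis P1 : P (fun=> 1).
Hypothesis PG : forall A, G A -> P \1_A.
Hypothesis Plin : forall (c : R) f g, bm f -> bm g -> P f -> P g ->
  P (fun x => c * f x + g x).
Hypothesis Plim : forall (f_ : nat -> T -> R) f (K : R),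
  (forall n, bm (f_ n)) -> (forall n x, `|f_ n x| <= K) ->
  (forall x, f_ ^~ x @ \oo --> f x) -> (forall n, P (f_ n)) -> P f.

Let PD f g : bm f -> bm g -> P f -> P g -> P (fun x => f x + g x).
Proof.
move=> bf bg Pf Pg; have := Plin 1 bf bg Pf Pg.
by under eq_fun do rewrite mul1r.
Qed.

Let PZ (c : R) f : bm f -> P f -> P (fun x => c * f x).
Proof.
move=> bf Pf.
have P0 : P (fun=> 0).
  have := Plin (- 1) (bm_cst _ 1) (bm_cst _ 1) P1 P1.
  by under eq_fun do rewrite mulr1 addNr.
have := Plin c bf (bm_cst _ 0) Pf P0.
by under eq_fun do rewrite addr0.
Qed.

Let Psum n (F : nat -> T -> R) : (forall i, bm (F i)) -> (forall i, P (F i)) ->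
  P (fun x => \sum_(i < n) F i x).
Proof.
move=> bF PF; elim: n => [|n IH].
  have := PZ 0 (bm_cst _ 1) P1; rewrite (_ : (fun x => _) = (fun=> 0)).
    by under [X in _ -> P X]eq_fun do rewrite big_ord0.
  by apply/funext => x; rewrite mul0r.
under eq_fun do rewrite big_ord_recr/=.
by apply: PD => //; exact: bm_sum.
Qed.

(** The sets whose indicator satisfies [P] form a Dynkin system containing the pi-system [G]. *)
Lemma bm_ind_indic A : measurable A -> P \1_A.
Proof.
rewrite GE; move: A; apply: dynkin_induction => //.
- by rewrite indicT.
- move=> A mA PA; have := Plin (- 1) (bm_indic R mA) (bm_cst _ 1) PA P1.
  rewrite (_ : (fun x => _) = \1_(~` A))//; apply/funext => x.
  by rewrite !indicE in_setC; case: (x \in A) => /=; ring.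
- move=> F mF tF PF.
  apply: (Plim (f_ := fun n x => \sum_(i < n) \1_(F i) x) (K := 1)).
  + by move=> n; apply: bm_sum => i; exact: bm_indic.
  + move=> n x.
    (* Disjointness makes each partial sum the indicator of a partial union, whence the uniform
       bound [1] required by [Plim]. *)
    have -> : \sum_(i < n) \1_(F i) x = \1_(\big[setU/set0]_(i < n) F i) x :> R.
      rewrite -(big_mkord xpredT (fun i => \1_(F i) x)) -(big_mkord xpredT F).
      elim: n => [|n IH]; first by rewrite !big_nil indic0.
      rewrite !big_nat_recr//= IH !indicE in_setU.
      have [xF|xF] := boolP (x \in F n); last by rewrite orbF addr0.
      rewrite orbT memNset ?add0r// big_mkord => xU.
      move: xU; rewrite -bigcup_mkord => -[k /= kn Fk].
      move/trivIsetP : tF => /(_ k n I I).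
      have /negP kn' : ~ k == n by move=> /eqP kn'; rewrite kn' ltnn in kn.
      move=> /(_ kn') /seteqP[/(_ x) h _]; apply: h; split => //; exact: set_mem.
    by rewrite indicE; case: (_ \in _) => /=; rewrite ?normr1 ?normr0.
  + move=> x.
    have [[k _ Fkx]|nx] := pselect ((\bigcup_k F k) x); last first.
      rewrite indicE memNset//.
      rewrite (_ : (fun n => _) = (fun=> 0)); first exact: cvg_cst.
      apply/funext => n; rewrite big1// => i _; rewrite indicE memNset// => Fix_.
      by apply: nx; exists i.
    rewrite indicE mem_set; last by exists k.
    apply: (@cvg_near_cst _ _ _ _ _ _).
    exists k.+1 => // n /= kn.
    rewrite (bigD1 (Ordinal kn))//= indicE mem_set// big1 ?addr0// => i ik.
    rewrite indicE memNset// => Fix_.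
    move/trivIsetP : tF => /(_ i k I I) => /(_ ik) /seteqP[/(_ x) h _].
    by apply: h.
  + by move=> n; apply: (@Psum n (fun i => \1_(F i))) => // i; exact: bm_indic.
Qed.

Import HBNNSimple.

(** Approximation by simple functions from below needs a nonnegative function: [f + K] is treated,
    and the constant [K] is subtracted again by linearity. *)
Lemma bm_ind f : bm f -> P f.
Proof.
move=> [mf [K Kf]].
pose g x := f x + K.
have g0 x : 0 <= g x by have := Kf x; rewrite ler_norml /g => /andP[? _]; lra.
have mg : measurable_fun setT g by exact: measurable_funD.
have meg : measurable_fun setT (EFin \o g) by exact/measurable_EFinP.
pose g_ := nnsfun_approx measurableT meg.
have cg x : (fun n => g_ n x) @ \oo --> g x.
  have : EFin \o g_ ^~ x @ \oo --> (EFin \o g) x.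
    by apply: cvg_nnsfun_approx => // y _ /=; rewrite lee_fin.
  by move=> /fine_cvg.
have leg n x : g_ n x <= g x.
  rewrite -(cvg_lim (@Rhausdorff R) (cg x)).
  apply: (@nondecreasing_cvgn_le _ (fun n => g_ n x)).
    by move=> m k mk; exact/lefP/nd_nnsfun_approx.
  by apply/cvg_ex; exists (g x); exact: cg.
have Pg n : P (g_ n).
  have -> : (g_ n : T -> R) = _ := funext (fimfunEord (g_ n)).
  set s := finmap.enum_fset _.
  have H := @Psum (size s) (fun i x => s`_i * \1_(g_ n @^-1` [set s`_i]) x).
  apply: H => i.
    by apply: bmZ; exact: bm_indic.
  by apply: PZ; [exact: bm_indic|exact: bm_ind_indic].
have bg n : bm (g_ n).
  split; first exact: measurable_funPT.
  exists (2 * K) => x; rewrite ger0_norm; last exact: fun_ge0.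
  by rewrite (le_trans (leg n x))// /g; have := Kf x; rewrite ler_norml => /andP[_ ?]; lra.
have Pgg : P g.
  apply: (Plim (f_ := fun n => g_ n) (K := 2 * K)) => //.
  move=> n x; rewrite ger0_norm; last exact: fun_ge0.
  by rewrite (le_trans (leg n x))// /g; have := Kf x; rewrite ler_norml => /andP[_ ?]; lra.
have bgg : bm g by apply: bmD; [split => //; exists K|exact: bm_cst].
have PK : P (fun=> - K).
  by have := PZ (- K) (bm_cst _ 1) P1; under eq_fun do rewrite mulr1.
have := PD bgg (bm_cst _ (- K)) Pgg PK.
by rewrite (_ : (fun x => _) = f)//; apply/funext => x; rewrite /g addrK.
Qed.

End functional_monotone_class.

Section plane_monotone_class.
Variable R : realType.
Notation plane := (R * R)%type.

Definition open_rects : set (set plane) :=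
  [set A | exists a b c d : R, A = `]a, b[%classic `*` `]c, d[%classic].

Lemma itvoo_bigcup_nat : [set: R] = \bigcup_n `]- n%:R, n%:R[%classic.
Proof.
apply/seteqP; split => // x _.
exists (Num.truncn `|x|).+1 => //=; rewrite in_itv/= -ltr_norml.
by have /andP[] := truncn_itv (normr_ge0 x).
Qed.

(** The projections are measurable for the generated sigma-algebra, since the preimage of an
    interval is a strip, a countable union of bounded open rectangles. *)
Lemma measurable_open_rects : @measurable _ plane = <<s open_rects >>.
Proof.
apply/seteqP; split; last first.
  apply: smallest_sub; first exact: sigma_algebra_measurable.
  by move=> _ [a [b [c [d ->]]]]; exact: measurableX.
pose S : measurableType _ := g_sigma_algebraType open_rects.
have m1 : measurable_fun [set: S] (fst : S -> R).
  have H := @measurability _ _ S R setT. apply: (H _ _ (RGenOpens.measurableE R)).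
  move=> _ [_ [a [b ->]] <-]; rewrite setTI.
  have -> : fst @^-1` `]a, b[%classic = \bigcup_n (`]a, b[%classic `*` `]- n%:R, n%:R[%classic) :> set S.
    apply/seteqP; split=> [[x y] /= xab|[x y] [n _ []]//].
    have : [set: R] y by []. 
    by rewrite itvoo_bigcup_nat => -[n _ yn]; exists n.
  apply: bigcupT_measurable => n; apply: sub_sigma_algebra.
  by exists a, b, (- n%:R), n%:R.
have m2 : measurable_fun [set: S] (snd : S -> R).
  have H := @measurability _ _ S R setT. apply: (H _ _ (RGenOpens.measurableE R)).
  move=> _ [_ [a [b ->]] <-]; rewrite setTI.
  have -> : snd @^-1` `]a, b[%classic = \bigcup_n (`]- n%:R, n%:R[%classic `*` `]a, b[%classic) :> set S.
    apply/seteqP; split=> [[x y] /= yab|[x y] [n _ []]//].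
    have : [set: R] x by []. 
    by rewrite itvoo_bigcup_nat => -[n _ yn]; exists n.
  apply: bigcupT_measurable => n; apply: sub_sigma_algebra.
  by exists (- n%:R), n%:R, a, b.
rewrite measurable_prod_measurableType.
apply: smallest_sub; first exact: smallest_sigma_algebra.
move=> _ [A mA [B mB <-]].
rewrite (_ : A `*` B = (fst @^-1` A) `&` (snd @^-1` B))//.
have := m1 measurableT A mA; rewrite setTI => mA'.
have := m2 measurableT B mB; rewrite setTI => mB'.
exact: (@measurableI _ S).
Qed.

(** Open rectangles serve as generators because their indicators are limits of tensor products of
    smooth bumps. The constant [1] is recovered as the limit of the indicators of centred squares of
    side [2 n]. *)
Lemma bm_plane_ind (P : (plane -> R) -> Prop) :
  (forall a b c d, P \1_(`]a, b[%classic `*` `]c, d[%classic)) ->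
  (forall (c : R) f g, bm f -> bm g -> P f -> P g -> P (fun x => c * f x + g x)) ->
  (forall (f_ : nat -> plane -> R) f (K : R),
    (forall n, bm (f_ n)) -> (forall n x, `|f_ n x| <= K) ->
    (forall x, f_ ^~ x @ \oo --> f x) -> (forall n, P (f_ n)) -> P f) ->
  forall f, bm f -> P f.
Proof.
move=> Prect Plin Plim; apply: (@bm_ind _ plane R open_rects) => //.
- exact: measurable_open_rects.
- move=> _ _ [a [b [c [e ->]]]] [a' [b' [c' [e' ->]]]].
  exists (Num.max a a'), (Num.min b b'), (Num.max c c'), (Num.min e e').
  rewrite -setXI; congr (_ `*` _); apply/seteqP; split => x /=;
  rewrite !in_itv/= gt_max lt_min.
  + by move=> [/andP[-> ->] /andP[-> ->]].
  + by move=> /andP[/andP[-> ->] /andP[-> ->]].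
  + by move=> [/andP[-> ->] /andP[-> ->]].
  + by move=> /andP[/andP[-> ->] /andP[-> ->]].
- apply: (Plim (fun n => \1_(`]- n%:R, n%:R[%classic `*` `]- n%:R, n%:R[%classic)) _ 1).
  + by move=> n; apply: bm_indic; exact: measurableX.
  + by move=> n x; rewrite indicE; case: (_ \in _) => /=; rewrite ?normr1 ?normr0.
  + move=> x; apply: (@cvg_near_cst _ _ _ _ _ _).
    exists (Num.truncn (`|x.1| + `|x.2|)).+1 => // n /= xn.
    have /andP[_ h] := truncn_itv (addr_ge0 (normr_ge0 x.1) (normr_ge0 x.2)).
    have {}h : `|x.1| + `|x.2| < n%:R by rewrite (lt_le_trans h)// ler_nat.
    rewrite indicE mem_set//; split => /=; rewrite in_itv/= -ltr_norml.
      by rewrite (le_lt_trans _ h)// lerDl.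
    by rewrite (le_lt_trans _ h)// lerDr.
  + by move=> n; exact: Prect.
- by move=> A [a [b [c [e ->]]]]; exact: Prect.
Qed.

End plane_monotone_class.

(** * A second difference criterion for differentiability *)

Section second_difference.
Variable R : realType.
Notation plane := (R * R)%type.

Definition box (M : R) : set plane := [set x | `|x.1| <= M /\ `|x.2| <= M].

Lemma increment_sum_bound (phi : R -> R) (h eps : R) (n : nat) : 0 <= h ->
  (forall k, (k < n)%N ->
    `|phi (k%:R * h + h) - phi (k%:R * h) - phi h + phi 0| <= eps * h) ->
  `|phi (n%:R * h) - phi 0 - n%:R * (phi h - phi 0)| <= n%:R * (eps * h).
Proof.
move=> h0; elim: n => [|n IH] H.
  by rewrite !mul0r !subrr normr0.
have Hn := H n (ltnSn n).
have {}IH := IH (fun k kn => H k (ltnW kn)).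
rewrite -natr1 !(mulrDl _ 1) !mul1r.
have -> : phi (n%:R * h + h) - phi 0 - (n%:R * (phi h - phi 0) + (phi h - phi 0)) =
  (phi (n%:R * h) - phi 0 - n%:R * (phi h - phi 0)) +
  (phi (n%:R * h + h) - phi (n%:R * h) - phi h + phi 0) by ring.
by rewrite (le_trans (ler_normD _ _))// lerD.
Qed.

(* Writing [h0 = n h + r] with [0 <= r < h], the [n] increments of step [h] all
   agree with the first one up to [eps h], so the quotient of step [h] is close
   to that of step [h0]. *)
Lemma quotient_comparison (phi : R -> R) (L eps h0 : R) :
  0 < h0 -> 0 < eps ->
  (forall s t, `|s| <= h0 -> `|t| <= h0 -> `|phi s - phi t| <= L * `|s - t|) ->
  (forall s h, `|s| <= h0 -> `|h| <= h0 ->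
     `|phi (s + h) - phi s - phi h + phi 0| <= eps * `|h|) ->
  exists2 eta : R, 0 < eta & forall h : R, 0 < `|h| < eta ->
    `|h^-1 * (phi h - phi 0) - h0^-1 * (phi h0 - phi 0)| <= 3 * eps.
Proof.
move=> h0p ep lip sd.
have L0 : 0 <= L.
  have := lip h0 0; rewrite normr0 subr0 gtr0_norm// => /(_ (lexx _) (ltW h0p)).
  move=> /(le_trans (normr_ge0 _)); by rewrite pmulr_lge0.
set Q := h0^-1 * _.
have pos (h : R) : 0 < h -> h <= h0 -> 2 * L * h <= eps * h0 ->
    `|h^-1 * (phi h - phi 0) - Q| <= 2 * eps.
  move=> hp hh0 hsmall.
  have /andP[nle nlt] := truncn_itv (divr_ge0 (ltW h0p) (ltW hp)).
  set n := Num.truncn _ in nle nlt.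
  rewrite ler_pdivlMr// in nle; rewrite ltr_pdivrMr// in nlt.
  have nh0 : 0 <= n%:R * h by rewrite mulr_ge0// ltW.
  have S : `|phi (n%:R * h) - phi 0 - n%:R * (phi h - phi 0)| <= n%:R * (eps * h).
    apply: increment_sum_bound; first exact: ltW.
    move=> k kn; rewrite -[X in eps * X](gtr0_norm hp); apply: sd; last by rewrite gtr0_norm.
    rewrite ger0_norm ?mulr_ge0 ?(ltW hp)// (le_trans _ nle)// ler_pM2r// ler_nat.
    exact: ltnW.
  set q := phi h - phi 0 in S *.
  have qb : `|q| <= L * h.
    have := lip h 0; rewrite normr0 subr0 (gtr0_norm hp); apply => //.
    exact: ltW.
  have rb : `|phi h0 - phi (n%:R * h)| <= L * (h0 - n%:R * h).
    rewrite -[X in L * X]ger0_norm ?subr_ge0//; apply: lip; first by rewrite gtr0_norm.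
    by rewrite ger0_norm.
  (* [(h0 - n h) (q / h)] and [phi h0 - phi (n h)] are each at most [L h], together at most [eps h0]
     since [h] is small; the [n] defects add at most [n h eps <= eps h0]. *)
  have key : `|h0 * (h^-1 * q) - (phi h0 - phi 0)| <= 2 * eps * h0.
    have -> : h0 * (h^-1 * q) - (phi h0 - phi 0) =
      (h0 - n%:R * h) * (h^-1 * q) - (phi h0 - phi (n%:R * h))
       - (phi (n%:R * h) - phi 0 - n%:R * q).
      by field; exact: lt0r_neq0.
    have hq : `|h^-1 * q| <= L.
      by rewrite normrM normfV (gtr0_norm hp) ler_pdivrMl// mulrC.
    have r0 : 0 <= h0 - n%:R * h by rewrite subr_ge0.
    have rh : h0 - n%:R * h <= h by move: nlt; rewrite -natr1 mulrDl mul1r; lra.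
    rewrite (le_trans (ler_normB _ _))//.
    rewrite (le_trans (lerD (ler_normB _ _) (lexx _)))//.
    have b1 : `|(h0 - n%:R * h) * (h^-1 * q)| <= h * L.
      by rewrite normrM (ger0_norm r0) ler_pM.
    have b2 : `|phi h0 - phi (n%:R * h)| <= h * L.
      by rewrite (le_trans rb)// mulrC; apply: ler_wpM2r.
    have b3 : n%:R * (eps * h) <= eps * h0 by rewrite mulrCA ler_pM2l.
    lra.
  have -> : h^-1 * q - Q = h0^-1 * (h0 * (h^-1 * q) - (phi h0 - phi 0)).
    by rewrite /Q; field; rewrite !lt0r_neq0.
  by rewrite normrM normfV (gtr0_norm h0p) ler_pdivrMl// (le_trans key)// mulrC.
(* [2 L + 1] keeps the quotient meaningful when [L = 0]. *)
have epos : 0 < eps * h0 / (2 * L + 1) by rewrite divr_gt0 ?mulr_gt0//; lra.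
exists (Num.min h0 (eps * h0 / (2 * L + 1))); first by rewrite lt_min h0p.
move=> h /andP[hn0]; rewrite lt_min => /andP[hh0 hs].
have small : 2 * L * `|h| <= eps * h0.
  move: hs; rewrite ltr_pdivlMr; last lra.
  by move=> /ltW; rewrite mulrDr mulr1; lra.
have [h_neg|h_pos|h0'] := ltgtP h 0; last by rewrite h0' normr0 ltxx in hn0.
(* A negative step is compared with the opposite one through the second difference at [h] with
   increment [- h], at the cost of one more [eps]. *)
- have hN : `|h| = - h by rewrite ltr0_norm.
  have := pos (- h); rewrite oppr_gt0 h_neg -hN (ltW hh0) => /(_ isT isT small).
  have := sd h (- h); rewrite normrN (ltW hh0) addrN => /(_ isT isT).
  rewrite hN => sdh.
  have -> : - h = `|h| by rewrite hN.
  move=> P1.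
  have e1 : `|h^-1 * (phi h - phi 0) - `|h|^-1 * (phi (`|h|) - phi 0)| <= eps.
    rewrite hN invrN.
    have -> : h^-1 * (phi h - phi 0) - - h^-1 * (phi (- h) - phi 0) =
       - h^-1 * (phi 0 - phi h - phi (- h) + phi 0) by ring.
    rewrite normrM normrN normfV hN mulrC ler_pdivrMr ?oppr_gt0//.
  have -> : h^-1 * (phi h - phi 0) - Q = (h^-1 * (phi h - phi 0) - `|h|^-1 * (phi (`|h|) - phi 0))
      + (`|h|^-1 * (phi (`|h|) - phi 0) - Q) by ring.
  by rewrite (le_trans (ler_normD _ _))//; lra.
- have hN : `|h| = h by rewrite gtr0_norm.
  by have := pos h h_pos; rewrite -{1}hN (ltW hh0) -hN => /(_ isT small); lra.
Qed.

(** Along the line [s -> x + s e] the second differences make the difference quotients Cauchy, hence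
    convergent. The same bound compares the quotients at [x] and [x + t] uniformly in the step, so
    it survives in the limit and gives continuity of the derivative. *)
Lemma C1_of_second_difference (g : plane -> R) (e : plane) :
  `|e.1| <= 1 -> `|e.2| <= 1 ->
  (forall M : R, exists L : R, forall (x : plane) (h : R), box M x -> `|h| <= M ->
     `|g (x + h *: e) - g x| <= L * `|h|) ->
  (forall M eps : R, 0 < eps -> exists2 delta : R, 0 < delta &
     forall (x t : plane) (h : R), box M x -> box delta t -> `|h| <= 1 ->
     `|g (x + t + h *: e) - g (x + t) - g (x + h *: e) + g x| <= eps * `|h|) ->
  (forall x, derivable g x e) /\ continuous (fun x => 'D_e g x).
Proof.
move=> e1 e2 lip sd.
have boxe (s M : R) : `|s| <= M -> box M (s *: e).
  by move=> sM; split; rewrite /= normrM; rewrite -[M]mulr1 ler_pM.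
have boxD M N x y : box M x -> box N y -> box (M + N) (x + y).
  by move=> [? ?] [? ?]; split; rewrite /= (le_trans (ler_normD _ _))// lerD.
have boxW M N x : M <= N -> box M x -> box N x.
  by move=> MN [? ?]; split; apply: le_trans MN.
pose q x h : R := h^-1 *: (g (h *: e + x) - g x).
have dg x : derivable g x e.
  have [M Mx] : exists M : R, box M x.
    by exists (Num.max `|x.1| `|x.2|); split; rewrite le_max lexx ?orbT.
  (* The base points lie in [box (M + 1)] and the steps [s - t] have size at most [2]; as [0 <= M],
     the radius [M + 3] accommodates both. *)
  have [L HL] := lip (M + 3).
  apply/cauchy_cvgP; apply: cauchy_exP => eps eps0.
  have e4 : 0 < eps / 4 by rewrite divr_gt0.
  have [delta d0 Hd] := sd M _ e4.
  pose h0 := Num.min delta 1.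
  have h0p : 0 < h0 by rewrite lt_min d0/=.
  have h01 : h0 <= 1 by rewrite ge_min lexx orbT.
  have h0d : h0 <= delta by rewrite ge_min lexx.
  have M0 : 0 <= M by case: Mx => /(le_trans (normr_ge0 _)).
  have [||eta eta0 Heta] := @quotient_comparison (fun s => g (x + s *: e)) L (eps / 4) h0 h0p e4.
  - move=> s t sh th.
    rewrite (_ : x + s *: e = x + t *: e + (s - t) *: e); last first.
      by rewrite -addrA -scalerDl [t + _]addrC subrK.
    apply: HL.
      by apply: (boxW (M + 1)); [lra|apply: boxD => //; apply: boxe; exact: le_trans h01].
    rewrite (le_trans (ler_normB _ _))//; lra.
  - move=> s h sh hh; rewrite scale0r addr0 scalerDl addrA.
    apply: Hd => //; last exact: le_trans h01.
    by apply: boxe; exact: le_trans h0d.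
  exists (h0^-1 * (g (x + h0 *: e) - g x)).
  exists eta => //= h; rewrite /ball_/= sub0r normrN => heta hn0.
  rewrite -ball_normE /ball_/= distrC.
  have := Heta h; rewrite normr_gt0 hn0 heta scale0r addr0 => /(_ isT).
  rewrite [h *: e + x]addrC => H; apply: (le_lt_trans H); lra.
split=> // x.
have [M Mx] : exists M : R, box M x.
  by exists (Num.max `|x.1| `|x.2|); split; rewrite le_max lexx ?orbT.
apply/cvgrPdist_le => eps eps0.
have [delta d0 Hd] := sd M _ eps0.
near=> y.
have yx : box delta (y - x).
  have : `|y - x| < delta.
    by rewrite distrC; near: y; exact: cvgr_dist_lt.
  by rewrite prod_normE/= gt_max => /andP[/ltW ? /ltW ?].
have cy : (fun h => q x h - q y h) @ 0^' --> 'D_e g x - 'D_e g y.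
  by apply: cvgB; exact: dg.
have cn : (fun h => `|q x h - q y h|) @ 0^' --> `|'D_e g x - 'D_e g y|.
  exact: cvg_norm.
apply: (cvgr_to_le cn).
exists 1 => //= h; rewrite /ball_/= sub0r normrN => h1 hn0.
have := Hd x (y - x) h Mx yx (ltW h1).
rewrite (addrC x) subrK => H.
rewrite /q -scalerBr normrM normfV ler_pdivrMl ?normr_gt0// mulrC (addrC _ x) (addrC _ y) distrC.
by apply: le_trans H; rewrite le_eqVlt; apply/orP; left; apply/eqP; congr `|_|; ring.
Unshelve. all: by end_near. Qed.

End second_difference.

(** * Smooth bump functions *)

Section smooth_functions.
Variable R : realType.
Notation plane := (R * R)%type.
Notation lam := (@lebesgue_measure R).

(* Infinitely differentiable: [f] lies in a class closed under differentiation. *)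
Definition smooth1 (f : R -> R) := exists2 S : set (R -> R), S f &
  forall g, S g -> exists2 g', S g' & forall x : R, is_derive x 1 g (g' x).

Lemma smooth1_derive f : smooth1 f ->
  exists2 f', smooth1 f' & forall x : R, is_derive x 1 f (f' x).
Proof.
by move=> [S Sf HS]; have [f' Sf' df] := HS f Sf; exists f' => //; exists S.
Qed.

Lemma smooth1_primitive F f : smooth1 f -> (forall x : R, is_derive x 1 F (f x)) -> smooth1 F.
Proof.
move=> [S Sf HS] dF; exists (S `|` [set F]); first by right.
move=> g [/HS[g' Sg' dg]|->]; first by exists g' => //; left.
by exists f => //; left.
Qed.

Lemma smooth1_continuous f : smooth1 f -> continuous f.
Proof.
move=> /smooth1_derive[f' _ df] x.
by apply/differentiable_continuous/derivable1_diffP; have [] := df x.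
Qed.

Section tensor.
Implicit Types f g : R -> R.

Definition tensor f g : plane -> R := fun x => f x.1 * g x.2.

Lemma is_derive_tensor1 f g (df : R) (x : plane) : is_derive x.1 1 f df ->
  is_derive x (e1 R) (tensor f g) (df * g x.2).
Proof.
move=> [fx <-].
have H : (fun h : R => h^-1 *: ((tensor f g \o shift x) (h *: e1 R) - tensor f g x)) @ 0^'
    --> 'D_1 f x.1 * g x.2.
  rewrite (_ : (fun h => _) = (fun h => (h^-1 *: ((f \o shift x.1) (h *: 1) - f x.1)) * g x.2)).
    by apply: cvgMl; exact: fx.
  apply/funext => h; rewrite /tensor /shift/=.
  by rewrite [h *: 0]mulr0 add0r -mulrBl [in LHS]/GRing.scale/= mulrA.
by split; [apply/cvg_ex; eexists; exact: H|exact/cvg_lim].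
Qed.

Lemma is_derive_tensor2 f g (dg : R) (x : plane) : is_derive x.2 1 g dg ->
  is_derive x (e2 R) (tensor f g) (f x.1 * dg).
Proof.
move=> [gx <-].
have H : (fun h : R => h^-1 *: ((tensor f g \o shift x) (h *: e2 R) - tensor f g x)) @ 0^'
    --> f x.1 * 'D_1 g x.2.
  rewrite (_ : (fun h => _) = (fun h => f x.1 * (h^-1 *: ((g \o shift x.2) (h *: 1) - g x.2)))).
    by apply: cvgMr; exact: gx.
  apply/funext => h; rewrite /tensor /shift/=.
  by rewrite [h *: 0]mulr0 add0r -mulrBr [in LHS]/GRing.scale/= mulrCA.
by split; [apply/cvg_ex; eexists; exact: H|exact/cvg_lim].
Qed.

(** Partial derivatives keep the product form, so smoothness in the plane reduces to smoothness in
    one variable. *)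
Lemma dpart_tensor s f g : smooth1 f -> smooth1 g ->
  exists f' g', [/\ smooth1 f', smooth1 g' & dpart s (tensor f g) = tensor f' g'].
Proof.
elim: s f g => [|[] s IH] f g sf sg /=; first by exists f, g.
- have [f1 [g1 [sf1 sg1 ->]]] := IH f g sf sg.
  have [f2 sf2 df] := smooth1_derive sf1.
  exists f2, g1; split => //; apply/funext => x.
  by have [_ ->] := @is_derive_tensor1 f1 g1 (f2 x.1) x (df _).
- have [f1 [g1 [sf1 sg1 ->]]] := IH f g sf sg.
  have [g2 sg2 dg] := smooth1_derive sg1.
  exists f1, g2; split => //; apply/funext => x.
  by have [_ ->] := @is_derive_tensor2 f1 g1 (g2 x.2) x (dg _).
Qed.

(** Compact support inside []a, b[], with explicit endpoints so that a tensor is visibly zero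
    outside a closed rectangle. *)
Definition supp_in (a b : R) f :=
  exists a' b' : R, [/\ a < a', b' < b & forall t, t <= a' \/ b' <= t -> f t = 0].

Lemma Ccinf_tensor (t : rect R) f g : smooth1 f -> smooth1 g ->
  supp_in (rxa t) (rxb t) f -> supp_in (ryc t) (ryd t) g ->
  Ccinf (rect_open t) (tensor f g).
Proof.
move=> sf sg [a' [b' [aa' bb' f0]]] [c' [d' [cc' dd' g0]]]; split.
  move=> s; have [f1 [g1 [sf1 sg1 ->]]] := dpart_tensor s sf sg.
  have [f2 sf2 df] := smooth1_derive sf1.
  have [g2 sg2 dg] := smooth1_derive sg1.
  split.
    move=> x; apply: cvgM.
      by apply: cvg_comp; [exact: cvg_fst|exact: smooth1_continuous].
    by apply: cvg_comp; [exact: cvg_snd|exact: smooth1_continuous].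
  move=> x; split.
    by have [] := @is_derive_tensor1 f1 g1 (f2 x.1) x (df _).
  by have [] := @is_derive_tensor2 f1 g1 (g2 x.2) x (dg _).
exists (`[a', b']%classic `*` `[c', d']%classic); split.
  by apply: compact_setX; exact: segment_compact.
split.
  move=> x [] /=; rewrite !in_itv/= => /andP[? ?] /andP[? ?].
  by split; apply/andP; split; [exact: lt_le_trans aa' _|exact: le_lt_trans bb'|exact: lt_le_trans cc' _|exact: le_lt_trans dd'].
move=> x nx; rewrite /tensor.
have [h|h] := boolP (x.1 \in `[a', b']).
- have [h'|h'] := boolP (x.2 \in `[c', d']); first by exfalso; exact: nx.
  rewrite [g _]g0 ?mulr0//; move: h'; rewrite in_itv/= negb_and -!ltNge => /orP[/ltW|/ltW]; tauto.
- rewrite f0 ?mul0r//; move: h; rewrite in_itv/= negb_and -!ltNge => /orP[/ltW|/ltW]; tauto.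
Qed.

End tensor.

(* [flat k] is [x^-k exp(-1/x)] on the positive half-line: the family is closed
   under differentiation and all its members are [O(x^2)] at [0]. *)
Definition flat (k : nat) (x : R) : R :=
  if 0 < x then x^-1 ^+ k * expR (- x^-1) else 0.

(** With [y = 1 / x], the exponential series gives [y^(k+2) / (k+2)! <= exp y], hence the constant
    [(k+2)!]. The exponent [2] is what makes the derivative at [0] exist and vanish. *)
Lemma flat_le_sqr k : exists2 C : R, 0 < C & forall x, `|flat k x| <= C * x ^+ 2.
Proof.
exists (k.+2)`!%:R; first by rewrite ltr0n fact_gt0.
move=> x; rewrite /flat; case: ifPn => [x0|_]; last by rewrite normr0 mulr_ge0 ?sqr_ge0.
set y := x^-1; have y0 : 0 < y by rewrite invr_gt0.
rewrite ger0_norm ?mulr_ge0 ?expR_ge0 ?exprn_ge0 ?(ltW y0)//.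
rewrite expRN ler_pdivrMr ?expR_gt0//.
have := expR_ge1Dxn k.+1 (ltW y0) => H.
have {}H : y ^+ k.+2 <= expR y * k.+2`!%:R.
  rewrite -ler_pdivrMr ?ltr0n ?fact_gt0//; lra.
have y2 : 0 < y ^+ 2 by rewrite exprn_gt0.
have -> : x ^+ 2 = (y ^+ 2)^-1 by rewrite /y exprVn invrK.
rewrite mulrAC ler_pdivlMr// -exprD addn2.
by rewrite (le_trans H)// mulrC.
Qed.

Lemma is_derive_flat k (x : R) :
  is_derive x 1 (flat k) (flat k.+2 x - k%:R * flat k.+1 x).
Proof.
have [x0|x0|->] := ltgtP x 0.
- have -> : flat k.+2 x - k%:R * flat k.+1 x = 0.
    by rewrite /flat ltNge (ltW x0)/= mulr0 subr0.
  apply: (@near_eq_is_derive _ _ _ (cst 0)).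
    near=> y; rewrite /flat ltNge (_ : y <= 0)//.
    by apply: ltW; near: y; exact: lt_nbhsl.
- have xn0 : x != 0 by rewrite gt_eqF.
  apply: (@near_eq_is_derive _ _ _ ((fun y => y^-1) ^+ k * (expR \o (- (fun y => y^-1))))).
    near=> y; rewrite /flat ifT; first by rewrite fctE/= exprfctE.
    by near: y; exact: lt_nbhsr.
  have dV : is_derive x 1 (fun y : R => y^-1) (- x ^- 2).
    have := @is_deriveV R id x 1 1 xn0 (is_derive_id x 1).
    by rewrite [_ *: 1]mulr1.
  apply: is_derive_eq.
  rewrite /flat x0 /GRing.scale/= exprfctE.
  rewrite [X in expR X](_ : _ = - x^-1)//.
  by case: k => [|k]; rewrite /= !exprS; set E := expR _; field.
- have -> : flat k.+2 0 - k%:R * flat k.+1 0 = 0.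
    by rewrite /flat ltxx mulr0 subr0.
  have [C C0 HC] := flat_le_sqr k.
  have H : (fun h : R => h^-1 *: ((flat k \o shift 0) (h *: 1) - flat k 0)) @ 0^' --> (0 : R).
    apply/cvgrPdist_le => eps eps0.
    exists (eps / C); first by rewrite /= divr_gt0.
    move=> h; rewrite /ball_/= sub0r normrN => hs hn0.
    rewrite sub0r normrN addr0 [h *: 1]mulr1 {2}/flat ltxx subr0.
    rewrite normrM normfV ler_pdivrMl ?normr_gt0//.
    rewrite (le_trans (HC h))// -[h ^+ 2]real_normK ?num_real// expr2 mulrCA.
    rewrite ler_wpM2l//.
    by move: hs; rewrite ltr_pdivlMr// mulrC => /ltW.
  by split; [apply/cvg_ex; eexists; exact: H|exact/cvg_lim].
Unshelve. all: by end_near. Qed.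

Lemma flat_ge0 k x : 0 <= flat k x.
Proof.
by rewrite /flat; case: ifP => // x0; rewrite mulr_ge0 ?expR_ge0// exprn_ge0// invr_ge0 ltW.
Qed.

Lemma flat0_le1 x : flat 0 x <= 1.
Proof.
rewrite /flat; case: ifP => // x0; rewrite mul1r expR_le1 oppr_le0 invr_ge0 ltW//.
Qed.

(** A class stable under derivation that contains the bumps, as [smooth1] requires: differentiating
    a product of two flat functions only shifts their indices and creates linear combinations. *)
Inductive bump_span (n a b : R) : (R -> R) -> Prop :=
| bump_span0 : bump_span n a b (fun=> 0)
| bump_spanM k l : bump_span n a b (fun t => flat k (n * (t - a)) * flat l (n * (b - t)))
| bump_spanD c f g : bump_span n a b f -> bump_span n a b g ->
    bump_span n a b (fun t => c * f t + g t).

Lemma is_derive_flat_affine k (c m t : R) :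
  is_derive t 1 (fun t => flat k (c * t + m))
    (c * (flat k.+2 (c * t + m) - k%:R * flat k.+1 (c * t + m))).
Proof.
have d : is_derive t 1 (fun t => c * t + m) c.
  have -> : (fun t : R => c * t + m) = (c *: (id : R -> R)) + cst m by apply/funext.
  by apply: is_derive_eq; rewrite addr0 [c *: 1]mulr1.
have := @is_derive1_comp R (flat k) (fun t => c * t + m) t _ _ (is_derive_flat k _) d.
by rewrite mulrC.
Qed.

Lemma bump_span_derive n a b f : bump_span n a b f ->
  exists2 f', bump_span n a b f' & forall x : R, is_derive x 1 f (f' x).
Proof.
elim => [|k l|c {}f g _ [f' bf df] _ [g' bg dg]].
- by exists (fun=> 0) => [|x]; [exact: bump_span0|exact: is_derive_cst].
- exists (fun t => n * (flat k.+2 (n * (t - a)) * flat l (n * (b - t))) +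
    (- n * k%:R * (flat k.+1 (n * (t - a)) * flat l (n * (b - t))) +
    (- n * (flat k (n * (t - a)) * flat l.+2 (n * (b - t))) +
    (n * l%:R * (flat k (n * (t - a)) * flat l.+1 (n * (b - t))) + 0)))).
    by do 4 (apply: bump_spanD; first exact: bump_spanM); exact: bump_span0.
  move=> x.
  have d1 := is_derive_flat_affine k n (- (n * a)) x.
  have d2 := is_derive_flat_affine l (- n) (n * b) x.
  have e1 y : n * y + - (n * a) = n * (y - a) by ring.
  have e2 y : - n * y + n * b = n * (b - y) by ring.
  have -> : (fun t => flat k (n * (t - a)) * flat l (n * (b - t))) =
    (fun t => flat k (n * t + - (n * a))) * (fun t => flat l (- n * t + n * b)).
    by apply/funext => y; rewrite /= -e1 -e2.
  apply: is_derive_eq; rewrite /GRing.scale/= !e1 !e2; ring.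
- exists (fun t => c * f' t + g' t); first exact: bump_spanD.
  move=> x; have dfx := df x; have dgx := dg x.
  have -> : (fun t => c * f t + g t) = (c *: f) + g by apply/funext.
  by apply: is_derive_eq.
Qed.

Definition bump (n a b t : R) : R := flat 0 (n * (t - a)) * flat 0 (n * (b - t)).

Lemma bump_smooth n a b : smooth1 (bump n a b).
Proof.
exists (bump_span n a b); first exact: bump_spanM.
exact: bump_span_derive.
Qed.

Lemma bump_ge0 n a b t : 0 <= bump n a b t.
Proof. by rewrite mulr_ge0// flat_ge0. Qed.

Lemma bump_le1 n a b t : bump n a b t <= 1.
Proof. by rewrite mulr_ile1 ?flat_ge0 ?flat0_le1. Qed.

Lemma bump_out n a b t : 0 <= n -> t <= a \/ b <= t -> bump n a b t = 0.
Proof.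
move=> n0 [ta|bt]; rewrite /bump /flat.
  by rewrite ltNge mulr_ge0_le0 ?subr_le0//= mul0r.
by rewrite [X in _ * X]ifF ?mulr0// ltNge mulr_ge0_le0 ?subr_le0.
Qed.

Lemma flat0_cvg1 (c : R) (u : nat -> R) : 0 < c -> (\forall n \near \oo, c <= u n) ->
  (fun n => flat 0 (n.+1%:R * u n)) @ \oo --> (1 : R).
Proof.
move=> c0 cu.
have H : (fun n : nat => expR (- (c^-1 * n.+1%:R^-1))) @ \oo --> (1 : R).
  have : (fun n : nat => expR (- (c^-1 * n.+1%:R^-1))) @ \oo --> expR (- (c^-1 * 0)).
    apply: continuous_cvg; first exact: continuous_expR.
    by apply: cvgN; apply: cvgMr; exact: cvg_harmonic.
  by rewrite mulr0 oppr0 expR0.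
have F : \forall n \near \oo, expR (- (c^-1 * n.+1%:R^-1)) <= flat 0 (n.+1%:R * u n) <= 1.
  near=> n; rewrite flat0_le1 andbT.
  have cun : c <= u n by near: n.
  have nu : 0 < n.+1%:R * u n by rewrite mulr_gt0// (lt_le_trans c0).
  rewrite /flat nu mul1r ler_expR lerN2 -invfM lef_pV2 ?posrE//.
    by rewrite mulrC ler_pM2l.
  by rewrite mulr_gt0.
by apply: (squeeze_cvgr F H); exact: cvg_cst.
Unshelve. all: by end_near. Qed.

(** The endpoints may move with [n], so that bumps compactly supported in an open interval can
    exhaust it; the fixed margin [c] sends both arguments of [flat 0] to infinity. *)
Lemma bump_cvg1 (c t : R) (a b : nat -> R) : 0 < c ->
  (\forall n \near \oo, a n + c <= t <= b n - c) ->
  (fun n => bump n.+1%:R (a n) (b n) t) @ \oo --> (1 : R).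
Proof.
move=> c0 H; rewrite -[X in _ --> X](mulr1 1).
apply: cvgM; apply: (@flat0_cvg1 c) => //; near=> n.
- have /andP[? ?] : a n + c <= t <= b n - c by near: n.
  lra.
- have /andP[? ?] : a n + c <= t <= b n - c by near: n.
  lra.
Unshelve. all: by end_near. Qed.

End smooth_functions.

(** * Square integrals and translations *)

Section square_integrals.
Variable R : realType.
Notation plane := (R * R)%type.
Notation leb2 := (@leb2 R).
Implicit Types (f g u : plane -> R) (D : set plane).

Lemma boxE (M : R) : box M = `[- M, M]%classic `*` `[- M, M]%classic.
Proof.
by apply/seteqP; split => x /=; rewrite /box/= !in_itv/= !ler_norml.
Qed.

Lemma measurable_box (M : R) : measurable (box M).
Proof. by rewrite boxE; exact: measurableX. Qed.

Lemma leb2_box_lty (M : R) : (leb2 (box M) < +oo)%E.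
Proof.
rewrite boxE /Defs.leb2 product_measure1E//= lte_mul_pinfty//.
  by rewrite ge0_fin_numE// lebesgue_measure_itv; case: ifP => _; rewrite ?ltry// -EFinB ltry.
by rewrite lebesgue_measure_itv; case: ifP => _; rewrite ?ltry// -EFinB ltry.
Qed.

Lemma boxD (M N : R) (x y : plane) : box M x -> box N y -> box (M + N) (x + y).
Proof. by move=> [? ?] [? ?]; split; rewrite /= (le_trans (ler_normD _ _))// lerD. Qed.

Lemma boxN (M : R) (x : plane) : box M x -> box M (- x).
Proof. by move=> [? ?]; split; rewrite /= normrN. Qed.

Lemma boxW (M N : R) (x : plane) : M <= N -> box M x -> box N x.
Proof. by move=> MN [? ?]; split; apply: le_trans MN. Qed.

Lemma box_ex (x : plane) : exists2 M : R, 0 <= M & box M x.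
Proof.
exists (`|x.1| + `|x.2|); first by rewrite addr_ge0.
by split; [rewrite lerDl|rewrite lerDr].
Qed.

Lemma measurable_shift (t : plane) : measurable_fun [set: plane] (fun x : plane => x + t).
Proof. exact: (@measurable_aff2 R false t.1 false t.2). Qed.

Lemma measurable_comp_shift d (U : measurableType d) (f : plane -> U) t :
  measurable_fun setT f -> measurable_fun [set: plane] (fun x : plane => f (x + t)).
Proof. by move=> mf; apply: measurableT_comp mf _; exact: measurable_shift. Qed.

Lemma ge0_int_shift t (f : plane -> \bar R) : measurable_fun setT f ->
  (forall x, 0 <= f x)%E -> (\int[leb2]_x f (x + t)%R = \int[leb2]_x f x)%E.
Proof. exact: (@ge0_int_aff2 R false t.1 false t.2). Qed.

Lemma ge0_int_box_shift (M N : R) t (f : plane -> \bar R) : box N t ->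
  measurable_fun setT f -> (forall x, 0 <= f x)%E ->
  (\int[leb2]_(x in box M) f (x + t)%R <= \int[leb2]_(x in box (M + N)) f x)%E.
Proof.
move=> Nt mf f0.
rewrite integral_mkcond [leRHS]integral_mkcond.
rewrite -(@ge0_int_shift t (f \_ (box (M + N)))); last 2 first.
- apply/(measurable_restrictT _ (measurable_box _)).
  exact: measurable_funTS.
- by apply: erestrict_ge0.
apply: ge0_le_integral => //.
- by move=> x _; apply: erestrict_ge0.
- apply/(measurable_restrictT _ (measurable_box _)).
  by apply: measurable_funTS; exact: measurable_comp_shift.
- apply: (@measurable_comp_shift _ _ (f \_ (box (M + N)))).
  by apply/(measurable_restrictT _ (measurable_box _)); exact: measurable_funTS.
- move=> x _; rewrite /patch; case: ifPn => [/set_mem Mx|_].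
    by rewrite mem_set//; exact: boxD.
  by case: ifP.
Qed.

(** Kept in the extended reals, so that it is meaningful before finiteness is known; estimates are
    upper bounds by real numbers, and [sqintD], with its factor [2], stands for Minkowski's
    inequality. *)
Definition sqint D f : \bar R := (\int[leb2]_(x in D) (f x ^+ 2)%:E)%E.

Lemma sqint_ge0 D f : (0 <= sqint D f)%E.
Proof. by apply: integral_ge0 => x _; rewrite lee_fin sqr_ge0. Qed.

Lemma measurable_sqr D f : measurable_fun D f -> measurable_fun D (fun x => (f x ^+ 2)%:E).
Proof. by move=> mf; apply/measurable_EFinP; exact: measurable_funX. Qed.

Lemma sqint_le D f g : measurable D -> measurable_fun D f -> measurable_fun D g ->
  (forall x, D x -> `|f x| <= `|g x|) -> (sqint D f <= sqint D g)%E.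
Proof.
move=> mD mf mg fg; apply: ge0_le_integral => //.
- by move=> x _; rewrite lee_fin sqr_ge0.
- exact: measurable_sqr.
- exact: measurable_sqr.
- move=> x Dx; rewrite lee_fin -[f x ^+ 2]real_normK ?num_real//.
  by rewrite -[g x ^+ 2]real_normK ?num_real// lerXn2r ?nnegrE// fg.
Qed.

Lemma sqintS D E f : measurable D -> measurable E -> measurable_fun E f ->
  D `<=` E -> (sqint D f <= sqint E f)%E.
Proof.
move=> mD mE mf DE; apply: ge0_subset_integral => //; first exact: measurable_sqr.
by move=> x _; rewrite lee_fin sqr_ge0.
Qed.

Lemma sqintD D f g (A B : R) : measurable D -> measurable_fun D f -> measurable_fun D g ->
  (sqint D f <= A%:E)%E -> (sqint D g <= B%:E)%E ->
  (sqint D (fun x => f x + g x)%R <= (2 * (A + B))%:E)%E.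
Proof.
move=> mD mf mg fA gB.
apply: (@le_trans _ _ (\int[leb2]_(x in D) (2%:E * ((f x ^+ 2)%:E + (g x ^+ 2)%:E)))%E).
  apply: ge0_le_integral => //.
  - by move=> x _; rewrite lee_fin sqr_ge0.
  - by apply: measurable_sqr; exact: measurable_funD.
  - under eq_fun do rewrite -EFinD -EFinM; apply/measurable_EFinP.
    by apply: measurable_funM => //; apply: measurable_funD; exact: measurable_funX.
  - by move=> x _; rewrite -EFinD -EFinM lee_fin; have := sqr_ge0 (f x - g x); nra.
rewrite ge0_integralZl//; last 2 first.
- by under eq_fun do rewrite -EFinD; apply/measurable_EFinP; apply: measurable_funD; exact: measurable_funX.
- by move=> x _; rewrite -EFinD lee_fin addr_ge0 ?sqr_ge0.
rewrite ge0_integralD//; last 4 first.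
- by move=> x _; rewrite lee_fin sqr_ge0.
- exact: measurable_sqr.
- by move=> x _; rewrite lee_fin sqr_ge0.
- exact: measurable_sqr.
by rewrite EFinM lee_pmul2l ?lte_fin// EFinD leeD.
Qed.

Lemma sqintN D f : sqint D (fun x => - f x)%R = sqint D f.
Proof. by rewrite /sqint; under eq_integral do rewrite sqrrN. Qed.

Lemma sqintB D f g (A B : R) : measurable D -> measurable_fun D f -> measurable_fun D g ->
  (sqint D f <= A%:E)%E -> (sqint D g <= B%:E)%E ->
  (sqint D (fun x => f x - g x)%R <= (2 * (A + B))%:E)%E.
Proof.
move=> mD mf mg fA gB; apply: sqintD => //; first exact: measurableT_comp.
by rewrite sqintN.
Qed.

Lemma sqintZ D (c : R) f (A : R) : measurable D -> measurable_fun D f ->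
  (sqint D f <= A%:E)%E -> (sqint D (fun x => c * f x)%R <= (c ^+ 2 * A)%:E)%E.
Proof.
move=> mD mf fA; rewrite /sqint.
under eq_integral do rewrite exprMn EFinM.
rewrite ge0_integralZl//; last 3 first.
- exact: measurable_sqr.
- by move=> x _; rewrite lee_fin sqr_ge0.
- by rewrite lee_fin sqr_ge0.
by rewrite [leRHS]EFinM lee_wpmul2l// lee_fin sqr_ge0.
Qed.

Lemma sqint_box_shift (M N : R) t f : box N t -> measurable_fun setT f ->
  (sqint (box M) (fun x => f (x + t))%R <= sqint (box (M + N)) f)%E.
Proof.
move=> Nt mf; apply: (@ge0_int_box_shift M N t (fun x => (f x ^+ 2)%:E)) => //.
  exact: measurable_sqr.
by move=> x; rewrite lee_fin sqr_ge0.
Qed.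

Lemma sqint_aff2 s1 c1 s2 c2 f : measurable_fun setT f ->
  sqint setT (fun x => f (aff2 s1 c1 s2 c2 x))%R = sqint setT f.
Proof.
move=> mf; apply: (@ge0_int_aff2 R s1 c1 s2 c2 (fun x => (f x ^+ 2)%:E)).
  exact: measurable_sqr.
by move=> x; rewrite lee_fin sqr_ge0.
Qed.

Lemma sqint_setT_box (M : R) f : measurable_fun setT f ->
  (forall x, ~ box M x -> f x = 0) -> sqint setT f = sqint (box M) f.
Proof.
move=> mf f0; rewrite [RHS]/sqint integral_mkcond; apply: eq_integral => x _.
by rewrite /patch; case: ifPn => // /negP xM; rewrite f0 ?expr0n// => /mem_set.
Qed.

Lemma bm_sqint D f : measurable D -> (leb2 D < +oo)%E -> bm f ->
  sqint D f = (\int[leb2]_(x in D) (f x ^+ 2))%:E.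
Proof.
move=> mD Dfin bf; rewrite /sqint /Rintegral fineK//.
apply: integrable_fin_num => //.
rewrite (_ : (fun x => _) = EFin \o (fun x => f x ^+ 2))//.
apply: (@bm_integrable _ _ _ leb2 D mD Dfin).
by under eq_fun do rewrite expr2; exact: bmM.
Qed.

Lemma sqint_dct D (f_ : nat -> plane -> R) (K eps : R) :
  measurable D -> (leb2 D < +oo)%E -> 0 < eps ->
  (forall n, measurable_fun setT (f_ n)) -> (forall n x, `|f_ n x| <= K) ->
  (forall x, f_ ^~ x @ \oo --> (0 : R)) ->
  \forall n \near \oo, (sqint D (f_ n) <= eps%:E)%E.
Proof.
move=> mD Dfin e0 mf fK f0.
have H : (fun n => \int[leb2]_(x in D) (f_ n x ^+ 2)) @ \oo --> \int[leb2]_(x in D) (0 : R).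
  apply: (@Rintegral_dct _ _ _ leb2 D mD Dfin (fun n x => f_ n x ^+ 2) (fun=> 0) (K ^+ 2)).
  - move=> n; have : measurable_fun [set: plane] (fun x => f_ n x ^+ 2) by exact: measurable_funX.
    exact.
  - by move=> n x; rewrite normrX lerXn2r ?nnegrE// (le_trans _ (fK n x)).
  - by move=> x; rewrite -[X in _ --> X](mulr0 (0 : R)); under eq_fun do rewrite expr2; apply: cvgM.
rewrite (_ : \int[leb2]_(x in D) (0 : R) = 0) in H; last first.
  by rewrite /Rintegral integral0.
near=> n; rewrite bm_sqint//; last by split => //; exists K.
rewrite lee_fin; near: n.
move/cvgr0Pnorm_le : H => /(_ eps e0); apply: filterS => n.
exact/le_trans/ler_norm.
Unshelve. all: by end_near. Qed.

End square_integrals.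

(** * Continuity of translations in L^2 *)

Section translation_continuity.
Variable R : realType.
Notation plane := (R * R)%type.
Notation leb2 := (@leb2 R).
Implicit Types (f g u : plane -> R).

(** Translation continuity is first proved along sequences, because dominated convergence is a
    statement about sequences. *)
Definition vanishing (t : nat -> plane) :=
  forall delta : R, 0 < delta -> \forall n \near \oo, box delta (t n).

Let tc f := forall (M : R) (t : nat -> plane), vanishing t -> forall eps : R, 0 < eps ->
  \forall n \near \oo, (sqint (box M) (fun x => f (x + t n) - f x)%R <= eps%:E)%E.

Let tc_lim (f_ : nat -> plane -> R) f (K : R) :
  (forall n, bm (f_ n)) -> (forall n x, `|f_ n x| <= K) ->
  (forall x, f_ ^~ x @ \oo --> f x) -> (forall n, tc (f_ n)) -> tc f.
Proof.
move=> bf fK ff tf M t t0 eps e0.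
have mf : measurable_fun setT f.
  by apply: (measurable_fun_cvg (fun n => (bf n).1)) => x _; exact: ff.
have fKl x : `|f x| <= K.
  by apply: (cvgr_to_le (cvg_norm (ff x))); apply: nearW => n; exact: fK.
(* Two nested uses of [sqintD] and [sqintB] on three terms of size [d] cost
   [2 (d + 2 (d + d)) = 10 d]. *)
have e10 : 0 < eps / 10 by rewrite divr_gt0.
have [m _ Hm] : \forall n \near \oo, (sqint (box (M + 1)) (fun x => f x - f_ n x)%R <= (eps / 10)%:E)%E.
  apply: (@sqint_dct _ _ (fun n x => f x - f_ n x) (2 * K)) => //.
  - exact: measurable_box.
  - exact: leb2_box_lty.
  - by move=> n; apply: measurable_funB => //; exact: (bf n).1.
  - move=> n x; rewrite (le_trans (ler_normB _ _))//; have := fKl x; have := fK n x; lra.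
  - by move=> x; rewrite -[X in _ --> X](subrr (f x)); apply: cvgB => //; exact: cvg_cst.
have {}Hm := Hm m (leqnn m).
have Hm' : (sqint (box M) (fun x => f x - f_ m x)%R <= (eps / 10)%:E)%E.
  apply: le_trans Hm; apply: sqintS; try exact: measurable_box.
    by apply: measurable_funTS; apply: measurable_funB => //; exact: (bf m).1.
  by move=> x; apply: boxW; rewrite lerDl.
near=> n.
have t1 : box 1 (t n) by near: n; exact: t0.
have mfm : measurable_fun setT (f_ m) := (bf m).1.
have mfB : measurable_fun setT (fun x => f x - f_ m x) by exact: measurable_funB.
have H1 : (sqint (box M) (fun x => f (x + t n) - f_ m (x + t n))%R <= (eps / 10)%:E)%E.
  apply: le_trans Hm.
  exact: (@sqint_box_shift _ M 1 (t n) (fun x => f x - f_ m x)).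
have H2 : (sqint (box M) (fun x => f_ m (x + t n) - f_ m x)%R <= (eps / 10)%:E)%E.
  by near: n; exact: tf.
have mD := @measurable_box R M.
have msf := @measurable_comp_shift R _ _ f (t n) mf.
have msfm := @measurable_comp_shift R _ _ (f_ m) (t n) mfm.
have HBC : (sqint (box M) (fun x => (f_ m (x + t n) - f_ m x) - (f x - f_ m x))%R <= (2 * (eps / 10 + eps / 10))%:E)%E.
  by apply: sqintB => //; apply: measurable_funTS => //; exact: measurable_funB.
have := @sqintD R (box M) (fun x => f (x + t n) - f_ m (x + t n))
  (fun x => (f_ m (x + t n) - f_ m x) - (f x - f_ m x)) (eps / 10) (2 * (eps / 10 + eps / 10)) mD.
move=> /(_ _ _ H1 HBC) H.
rewrite (_ : (fun x => f (x + t n) - f x) = (fun x : plane => f (x + t n) - f_ m (x + t n) + (f_ m (x + t n) - f_ m x - (f x - f_ m x)))); last first.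
  by apply/funext => x; ring.
apply: (le_trans (H _ _)).
- by apply: measurable_funTS; exact: measurable_funB.
- by apply: measurable_funTS; apply: measurable_funB => //; exact: measurable_funB.
- by rewrite lee_fin; lra.
Unshelve. all: by end_near. Qed.

Lemma indicX (A B : set R) (x : plane) : \1_(A `*` B) x = \1_A x.1 * \1_B x.2 :> R.
Proof.
rewrite !indicE; have -> : (x \in A `*` B) = (x.1 \in A) && (x.2 \in B).
  by apply/idP/idP => [/set_mem[/= ? ?]|/andP[/set_mem ? /set_mem ?]];
    [rewrite !mem_set|rewrite mem_set//].
by case: (_ \in A); case: (_ \in B); rewrite /= ?mulr1 ?mulr0.
Qed.

Lemma bump_cvg_indic (a b t : R) :
  (fun n => bump n.+1%:R a b t) @ \oo --> (\1_(`]a, b[%classic) t : R).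
Proof.
rewrite indicE; have [/set_mem/=|/negP nt] := boolP (t \in `]a, b[%classic).
  rewrite in_itv/= => /andP[at_ tb].
  apply: (@bump_cvg1 R (Num.min (t - a) (b - t)) t (fun=> a) (fun=> b)).
    by rewrite lt_min !subr_gt0 at_.
  have h1 : Num.min (t - a) (b - t) <= t - a by rewrite ge_min lexx.
  have h2 : Num.min (t - a) (b - t) <= b - t by rewrite ge_min lexx orbT.
  by apply: nearW => n; lra.
rewrite (_ : (fun n => _) = (fun=> 0)); first exact: cvg_cst.
apply/funext => n; apply: bump_out => //.
have [ta|ta] := leP t a; first by left.
have [bt|bt] := leP b t; first by right.
by exfalso; apply: nt; rewrite inE/= in_itv/= ta.
Qed.

Lemma bump_bm (n a b : R) : bm (bump n a b).
Proof.
split; first by apply: continuous_measurable_fun; apply: smooth1_continuous; exact: bump_smooth.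
by exists 1 => x; rewrite ger0_norm ?bump_ge0// bump_le1.
Qed.

Lemma tensor_bm (f g : R -> R) : bm f -> bm g -> bm (tensor f g).
Proof.
move=> [mf [K Kf]] [mg [L Lg]]; apply: bmM; split.
- by apply: measurableT_comp => //; exact: measurable_fst.
- by exists K.
- by apply: measurableT_comp => //; exact: measurable_snd.
- by exists L.
Qed.

(** The indicator is a bounded limit of tensors of bumps, and for bounded continuous functions
    translation continuity is dominated convergence. *)
Let tc_rect (a b c d : R) : tc \1_(`]a, b[%classic `*` `]c, d[%classic).
Proof.
apply: (@tc_lim (fun n => tensor (bump n.+1%:R a b) (bump n.+1%:R c d)) _ 1).
- by move=> n; apply: tensor_bm; exact: bump_bm.
- move=> n x; rewrite /tensor normrM !ger0_norm ?bump_ge0//.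
  by apply: mulr_ile1; rewrite ?bump_ge0 ?bump_le1.
- by move=> x; rewrite indicX; apply: cvgM; exact: bump_cvg_indic.
move=> n M t t0 eps e0.
set f := tensor _ _.
have [mf [K Kf]] : bm f by apply: tensor_bm; exact: bump_bm.
apply: (@sqint_dct _ _ (fun n x => f (x + t n) - f x) (2 * K)) => //.
- exact: measurable_box.
- exact: leb2_box_lty.
- by move=> m; apply: measurable_funB => //; exact: measurable_comp_shift.
- move=> m x; rewrite (le_trans (ler_normB _ _))//; have := Kf x; have := Kf (x + t m); lra.
- move=> x; rewrite -[X in _ --> X](subrr (f x)); apply: cvgB; last exact: cvg_cst.
  have c1 : (fun m => (x + t m).1) @ \oo --> x.1.
    apply/cvgrPdist_le => e e0'; near=> m => /=.
    have [+ _] : box e (t m) by near: m; exact: t0.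
    by rewrite opprD addNKr normrN.
  have c2 : (fun m => (x + t m).2) @ \oo --> x.2.
    apply/cvgrPdist_le => e e0'; near=> m => /=.
    have [_ +] : box e (t m) by near: m; exact: t0.
    by rewrite opprD addNKr normrN.
  apply: cvgM.
    by apply: continuous_cvg c1; apply: smooth1_continuous; exact: bump_smooth.
  by apply: continuous_cvg c2; apply: smooth1_continuous; exact: bump_smooth.
Unshelve. all: by end_near. Qed.

Let tc_bm f : bm f -> tc f.
Proof.
apply: (@bm_plane_ind R tc tc_rect _ tc_lim).
move=> c {}f g bf bg tf tg M t t0 eps e0.
have c0 : 0 < c ^+ 2 + 1 by rewrite ltr_wpDl// sqr_ge0.
(* [c^2 + 1] is positive and dominates [c^2], so each of the two terms is at most [eps / 4] before
   the factor [2] and the sum of the two. *)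
have e1 : 0 < eps / (4 * (c ^+ 2 + 1)) by rewrite divr_gt0// mulr_gt0.
have e2 : 0 < eps / 4 by rewrite divr_gt0.
near=> n.
have mD := @measurable_box R M.
have mf : measurable_fun (box M) (fun x => f (x + t n) - f x).
  by apply: measurable_funTS; apply: measurable_funB; [apply: measurable_comp_shift|]; exact: bf.1.
have mg : measurable_fun (box M) (fun x => g (x + t n) - g x).
  by apply: measurable_funTS; apply: measurable_funB; [apply: measurable_comp_shift|]; exact: bg.1.
have H1 : (sqint (box M) (fun x => f (x + t n) - f x)%R <= (eps / (4 * (c ^+ 2 + 1)))%:E)%E.
  by near: n; exact: tf.
have H2 : (sqint (box M) (fun x => g (x + t n) - g x)%R <= (eps / 4)%:E)%E.
  by near: n; exact: tg.
have H := sqintD mD _ mg (sqintZ c mD mf H1) H2.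
rewrite (_ : (fun x => _) = (fun x => c * (f (x + t n) - f x) + (g (x + t n) - g x))); last first.
  by apply/funext => x; ring.
apply: (le_trans (H _)); first exact: measurable_funM.
rewrite lee_fin.
have : c ^+ 2 * (eps / (4 * (c ^+ 2 + 1))) <= eps / 4.
  rewrite invfM [eps * _]mulrA mulrCA -[leRHS]mulr1 ler_wpM2l ?(ltW e2)//.
  by rewrite ler_pdivrMr// mul1r lerDl.
lra.
Unshelve. all: by end_near. Qed.

Lemma translation_continuous (W : plane -> R) (M0 A : R) :
  measurable_fun setT W -> (forall x, ~ box M0 x -> W x = 0) ->
  (sqint setT W <= A%:E)%E -> forall eps : R, 0 < eps ->
  exists2 delta : R, 0 < delta & forall t, box delta t ->
    (sqint setT (fun x => W (x + t) - W x)%R <= eps%:E)%E.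
Proof.
move=> mW W0 WA eps e0.
have e10 : 0 < eps / 10 by rewrite divr_gt0.
(* Truncation at height [n]: [V n] is bounded and tends to [W] in L^2, the square of the difference
   being dominated by [W^2]. *)
pose V (n : nat) (x : plane) : R := W x * \1_([set y | `|W y| <= n%:R]) x.
have mS n : measurable [set y | `|W y| <= n%:R].
  rewrite (_ : [set _ | _] = (fun y => `|W y|) @^-1` `]-oo, n%:R]%classic).
    rewrite -[X in measurable X]setTI; apply: measurableT_comp mW _ _ _ => //.
  by apply/seteqP; split => x /=; rewrite in_itv.
have bV n : bm (V n).
  split; first by apply: measurable_funM => //; exact: measurable_indic.
  exists n%:R => x; rewrite /V indicE; case: (boolP (_ \in _)) => [/set_mem/= h|_].
    by rewrite mulr1.
  by rewrite mulr0 normr0.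
have [m _ Hm] : \forall n \near \oo, (sqint setT (fun x => W x - V n x)%R <= (eps / 10)%:E)%E.
  have [] := @dominated_convergence _ _ _ leb2 setT measurableT
     (fun n x => ((W x - V n x) ^+ 2)%:E) (fun=> 0%E) (fun x => (W x ^+ 2)%:E).
  - by move=> n; apply: measurable_sqr; apply: measurable_funB => //; exact: (bV n).1.
  - by [].
  - apply: aeW => x _; apply: cvg_EFin; first exact: nearW.
    apply: (@cvg_near_cst _ _ _ _ _ _).
    exists (Num.truncn `|W x|).+1 => // n /= xn.
    rewrite /V indicE mem_set/=; first by rewrite mulr1 subrr expr0n.
    have /andP[_ h] := truncn_itv (normr_ge0 (W x)).
    by apply: ltW; rewrite (lt_le_trans h)// ler_nat.
  - apply/integrableP; split; first exact: measurable_sqr.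
    under eq_integral do rewrite gee0_abs ?lee_fin ?sqr_ge0//.
    by rewrite (le_lt_trans WA)// ltry.
  - apply: aeW => x n _; rewrite gee0_abs ?lee_fin ?sqr_ge0//.
    rewrite /V indicE; case: (_ \in _); last by rewrite mulr0 subr0.
    by rewrite mulr1 subrr expr0n/= sqr_ge0.
  move=> _ _; rewrite integral0 => H.
  have /fine_cvgP[] := H.
  move=> fin /cvgr0Pnorm_le/(_ _ e10) He.
  near=> n.
  rewrite /sqint -[leLHS]fineK; last by near: n.
  by rewrite lee_fin; apply: le_trans (ler_norm _) _; near: n.
have {}Hm := Hm m (leqnn m).
(* Since bounded functions were treated along sequences, [delta] is obtained by contradiction:
   failure of every radius [1 / (n + 1)] produces a vanishing sequence [t]. *)
apply: contrapT => H.
have {}H (n : nat) : exists t : plane, box n.+1%:R^-1 t /\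
    ~ (sqint setT (fun x => W (x + t) - W x)%R <= eps%:E)%E.
  apply: contrapT => nt; apply: H; exists n.+1%:R^-1 => // t tn.
  by apply: contrapT => h; apply: nt; exists t.
have [t Ht] := choice H.
have t0 : vanishing t.
  move=> delta d0; near=> n.
  have [tn _] := Ht n; apply: boxW tn.
  apply: ltW; near: n; exact: (near_infty_natSinv_lt (PosNum d0)).
have [k _ Hk] := tc_bm (bV m) (M0 + 1) t0 e10.
have [tk] := Ht k; apply.
have {}Hk := Hk k (leqnn k).
have t1 : box 1 (t k).
  by apply: boxW tk; rewrite invf_le1// ler1n.
have msW := @measurable_comp_shift R _ _ W (t k) mW.
have mV := (bV m).1.
have msV := @measurable_comp_shift R _ _ (V m) (t k) mV.
have V0 x : ~ box M0 x -> V m x = 0 by move=> /W0 h; rewrite /V h mul0r.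
have H1 : (sqint setT (fun x => W (x + t k) - V m (x + t k))%R <= (eps / 10)%:E)%E.
  have := @sqint_aff2 R false (t k).1 false (t k).2 (fun x => W x - V m x).
  by move=> ->//; exact: measurable_funB.
have H2 : (sqint setT (fun x => V m (x + t k) - V m x)%R <= (eps / 10)%:E)%E.
  (* [V m] and its translate both vanish outside [box (M0 + 1)], so the local statement is a global
     one. *)
  rewrite (@sqint_setT_box R (M0 + 1)) //; first exact: measurable_funB.
  move=> x xM; rewrite !V0 ?subrr//.
    by move=> h; apply: xM; apply: boxW h; rewrite lerDl.
  move=> h; apply: xM; rewrite -(addrK (t k) x); apply: boxD => //; exact: boxN.
have HBC : (sqint setT (fun x => (V m (x + t k) - V m x) - (W x - V m x))%R <= (2 * (eps / 10 + eps / 10))%:E)%E.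
  by apply: sqintB => //; exact: measurable_funB.
have := @sqintD R setT (fun x => W (x + t k) - V m (x + t k))
  (fun x => (V m (x + t k) - V m x) - (W x - V m x)) (eps / 10) (2 * (eps / 10 + eps / 10)) measurableT.
move=> /(_ _ _ H1 HBC) HH.
rewrite (_ : (fun x => W (x + t k) - W x) = (fun x : plane => W (x + t k) - V m (x + t k) + (V m (x + t k) - V m x - (W x - V m x)))); last first.
  by apply/funext => x; ring.
apply: (le_trans (HH _ _)).
- exact: measurable_funB.
- by apply: measurable_funB => //; exact: measurable_funB.
- by rewrite lee_fin; lra.
Unshelve. all: by end_near. Qed.

End translation_continuity.

(** * Convolution with a compactly supported L^2 kernel *)

(** No integrability is assumed: the integrals of the positive and negative parts are measurable in
    the parameter by Tonelli, and [fine] sends infinite values to [0]. *)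
Lemma measurable_fine_integral d1 d2 (T1 : measurableType d1) (T2 : measurableType d2)
    (R : realType) (m : {sigma_finite_measure set T2 -> \bar R}) (f : T1 * T2 -> R) :
  measurable_fun [set: T1 * T2] f ->
  measurable_fun [set: T1] (fun x => fine (\int[m]_y (f (x, y))%:E)%E).
Proof.
move=> mf; apply: measurableT_comp; first exact: fine_measurable.
have mEf : measurable_fun [set: T1 * T2] (EFin \o f) by exact/measurable_EFinP.
under eq_fun do rewrite integralE.
apply: emeasurable_funB.
- rewrite [X in measurable_fun _ X](_ : _ = fubini_F m ((EFin \o f)^\+)%E).
    by apply: measurable_fun_fubini_tonelli_F => //; exact: measurable_funepos.
  by apply/funext => x; apply: eq_integral => z _; rewrite !funepos.unlock.
- rewrite [X in measurable_fun _ X](_ : _ = fubini_F m ((EFin \o f)^\-)%E).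
    by apply: measurable_fun_fubini_tonelli_F => //; exact: measurable_funeneg.
  by apply/funext => x; apply: eq_integral => z _; rewrite !funeneg.unlock.
Qed.

Section convolution.
Variable R : realType.
Notation plane := (R * R)%type.
Notation leb2 := (@leb2 R).
Implicit Types (W k u v : plane -> R) (e x y z t : plane).

(** Cauchy-Schwarz on a box outside which [k] vanishes, so that a local square bound on [u]
    suffices. *)
Lemma pairing_le k u (M A B : R) : 0 <= A -> 0 <= B ->
  measurable_fun setT k -> measurable_fun setT u ->
  (forall z, ~ box M z -> k z = 0) ->
  (sqint setT k <= A%:E)%E -> (sqint (box M) u <= B%:E)%E ->
  leb2.-integrable setT (EFin \o (fun z => k z * u z)) /\
  (fine (\int[leb2]_z (k z * u z)%:E)) ^+ 2 <= A * B.
Proof.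
move=> A0 B0 mk mu k0 kA uB.
have mD := @measurable_box R M.
have kA' : (sqint (box M) k <= A%:E)%E.
  by apply: le_trans kA; apply: sqintS.
have [int1 sq1] := @cauchy_schwarz _ _ R leb2 (box M) k u A B mD
  (measurable_funTS mk) (measurable_funTS mu) A0 B0 kA' uB.
have ku : EFin \o (fun z => k z * u z) = (EFin \o (fun z => k z * u z)) \_ (box M).
  apply/funext => z; rewrite /patch; case: ifPn => // /negP zM /=.
  by rewrite k0 ?mul0r// => /mem_set.
have int2 : leb2.-integrable setT (EFin \o (fun z => k z * u z)).
  by rewrite ku; apply/integrable_restrict => //; rewrite setTI.
split => //.
rewrite (le_trans _ sq1)// -[leLHS]real_normK ?num_real// lerXn2r ?nnegrE//.
  by rewrite fine_ge0// integral_ge0.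
rewrite -fine_abse; last exact: integrable_fin_num.
have -> : (\int[leb2]_z (k z * u z)%:E = \int[leb2]_(z in box M) (k z * u z)%:E)%E.
  by rewrite [RHS]integral_mkcond; congr (integral _ _ _).
apply: fine_le.
- by rewrite fin_num_abs abse_id -fin_num_abs; exact: integrable_fin_num int1.
- by have := integrable_abse int1 => /integrable_fin_num; apply.
- by apply: le_abse_integral => //; exact: measurable_int int1.
Qed.

Definition L2loc u := measurable_fun [set: plane] u /\
  forall M : R, exists2 B : R, 0 <= B & (sqint (box M) u <= B%:E)%E.

Definition L2c W := [/\ measurable_fun [set: plane] W,
  exists M : R, forall z, ~ box M z -> W z = 0 &
  exists2 A : R, 0 <= A & (sqint setT W <= A%:E)%E].

(* The substitute for having a weak derivative along [e] in [L2loc]. *)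
Definition Pdiff e u := forall M : R, exists2 C : R, 0 <= C &
  forall h : R, `|h| <= M ->
    (sqint (box M) (fun x => u (x + h *: e) - u x)%R <= (C * h ^+ 2)%:E)%E.

Lemma L2locB u v : L2loc u -> L2loc v -> L2loc (fun x => u x - v x).
Proof.
move=> [mu Hu] [mv Hv]; split; first exact: measurable_funB.
move=> M; have [B B0 uB] := Hu M; have [C C0 vC] := Hv M.
exists (2 * (B + C)); first by rewrite mulr_ge0// addr_ge0.
by apply: sqintB => //; [exact: measurable_box|exact: measurable_funTS|exact: measurable_funTS].
Qed.

Lemma L2loc_shift u t : L2loc u -> L2loc (fun x => u (x + t)).
Proof.
move=> [mu Hu]; split; first exact: measurable_comp_shift.
move=> M; have [N N0 Nt] := box_ex t.
have [B B0 uB] := Hu (M + N); exists B => //.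
by apply: le_trans uB; exact: sqint_box_shift.
Qed.

Lemma L2c_shift W t : L2c W -> L2c (fun x => W (x + t)).
Proof.
move=> [mW [M HM] [A A0 WA]]; have [N N0 Nt] := box_ex t; split.
- exact: measurable_comp_shift.
- exists (M + N) => z zMN; apply: HM => h; apply: zMN.
  by rewrite -(addrK t z); apply: boxD => //; exact: boxN.
- by exists A => //; rewrite (@sqint_aff2 R false t.1 false t.2).
Qed.

Lemma sub_aff2 x z : x - z = aff2 true x.1 true x.2 z.
Proof. by rewrite /aff2 /aff1 ![- _ + _]addrC. Qed.

(** Compared with [convF] the variable is [z = x - y] and the kernel lives on the whole plane, so
    that translating the kernel, the function or the point are interchangeable by invariance of the
    measure. *)
Definition cv W u x : R := fine (\int[leb2]_z (W (x - z) * u z)%:E)%E.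

Lemma measurable_kernel W x : measurable_fun [set: plane] W ->
  measurable_fun [set: plane] (fun z : plane => W (x - z)).
Proof.
move=> mW; under eq_fun do rewrite sub_aff2.
by apply: measurableT_comp mW _; exact: measurable_aff2.
Qed.

Lemma sqint_kernel W x : measurable_fun [set: plane] W ->
  sqint setT (fun z => W (x - z))%R = sqint setT W.
Proof.
move=> mW; rewrite -(@sqint_aff2 R true x.1 true x.2 W mW).
by congr sqint; apply/funext => z; rewrite sub_aff2.
Qed.

Lemma kernel_support W (M0 M : R) x : (forall z, ~ box M0 z -> W z = 0) -> box M x ->
  forall z, ~ box (M + M0) z -> W (x - z) = 0.
Proof.
move=> W0 Mx z zM; apply: W0 => h; apply: zM.
rewrite -(subKr x z); apply: boxD => //; exact: boxN.
Qed.

Lemma cv_sqr_le W u (M0 M A B : R) x : 0 <= A -> 0 <= B ->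
  measurable_fun [set: plane] W -> measurable_fun [set: plane] u ->
  (forall z, ~ box M0 z -> W z = 0) -> box M x ->
  (sqint setT W <= A%:E)%E -> (sqint (box (M + M0)) u <= B%:E)%E ->
  cv W u x ^+ 2 <= A * B.
Proof.
move=> A0 B0 mW mu W0 Mx WA uB.
have [] := @pairing_le (fun z => W (x - z)) u (M + M0) A B A0 B0
  (measurable_kernel x mW) mu (kernel_support W0 Mx).
- by rewrite sqint_kernel.
- exact: uB.
- by [].
Qed.

Lemma cv_integrable W u x : L2c W -> L2loc u ->
  leb2.-integrable setT (EFin \o (fun z => W (x - z) * u z)).
Proof.
move=> [mW [M0 W0] [A A0 WA]] [mu Hu].
have [M M0' Mx] := box_ex x.
have [B B0 uB] := Hu (M + M0).
have [] := @pairing_le (fun z => W (x - z)) u (M + M0) A B A0 B0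
  (measurable_kernel x mW) mu (kernel_support W0 Mx) => //.
by rewrite sqint_kernel.
Qed.

Lemma cvBr W u v x : L2c W -> L2loc u -> L2loc v ->
  cv W (fun z => u z - v z) x = cv W u x - cv W v x.
Proof.
move=> LW Lu Lv.
have := @RintegralB _ _ R leb2 setT (fun z => W (x - z) * u z) (fun z => W (x - z) * v z)
  measurableT (cv_integrable x LW Lu) (cv_integrable x LW Lv).
rewrite /Rintegral /cv => <-; congr fine; apply: eq_integral => z _.
by rewrite mulrBr.
Qed.

Lemma cvBl W k u x : L2c W -> L2c k -> L2loc u ->
  cv (fun z => W z - k z) u x = cv W u x - cv k u x.
Proof.
move=> LW Lk Lu.
have := @RintegralB _ _ R leb2 setT (fun z => W (x - z) * u z) (fun z => k (x - z) * u z)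
  measurableT (cv_integrable x LW Lu) (cv_integrable x Lk Lu).
rewrite /Rintegral /cv => <-; congr fine; apply: eq_integral => z _.
by rewrite mulrBl.
Qed.

Lemma cv_shiftl W u x t : cv (fun z => W (z + t)) u x = cv W u (x + t).
Proof. by rewrite /cv; congr fine; apply: eq_integral => z _; rewrite addrAC. Qed.

Lemma cv_shiftr W u x t : measurable_fun [set: plane] W -> measurable_fun [set: plane] u ->
  cv W (fun z => u (z + t)) x = cv W u (x + t).
Proof.
move=> mW mu; rewrite /cv; congr fine.
have := @int_aff2 R false t.1 false t.2 (fun z => (W (x + t - z) * u z)%:E).
move=> <-.
  apply: eq_integral => z _; congr ((W _ * _)%:E).
  have -> : aff2 false t.1 false t.2 z = z + t by [].
  by rewrite opprD addrA addrAC addrK.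
by apply/measurable_EFinP; apply: measurable_funM => //; exact: measurable_kernel.
Qed.

Lemma measurable_cv W u : measurable_fun [set: plane] W -> measurable_fun [set: plane] u ->
  measurable_fun [set: plane] (cv W u).
Proof.
move=> mW mu.
apply: (@measurable_fine_integral _ _ _ _ R leb2 (fun p : plane * plane => W (p.1 - p.2) * u p.2)).
apply: measurable_funM.
  apply: (measurableT_comp mW).
  apply: measurable_fun_pair => /=.
    by apply: measurable_funB; apply: measurableT_comp; [exact: measurable_fst|exact: measurable_fst|exact: measurable_fst|exact: measurable_snd].
  by apply: measurable_funB; apply: measurableT_comp; [exact: measurable_snd|exact: measurable_fst|exact: measurable_snd|exact: measurable_snd].
by apply: (measurableT_comp mu); exact: measurable_snd.
Qed.

Lemma sqint_bounded (M K : R) u : measurable_fun [set: plane] u -> 0 <= K ->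
  (forall x, box M x -> u x ^+ 2 <= K) ->
  (sqint (box M) u <= (K * fine (leb2 (box M)))%:E)%E.
Proof.
move=> mu K0 uK; have mD := @measurable_box R M.
apply: (@le_trans _ _ (\int[leb2]_(x in box M) (cst K%:E x))%E).
  apply: ge0_le_integral => //.
  - by move=> x _; rewrite lee_fin sqr_ge0.
  - by apply: measurable_sqr; exact: measurable_funTS.
by rewrite integral_cst// EFinM fineK// ge0_fin_numE//; exact: leb2_box_lty.
Qed.

Lemma cv_L2loc W u : L2c W -> L2loc u -> L2loc (cv W u).
Proof.
move=> [mW [M0 W0] [A A0 WA]] [mu Hu]; split; first exact: measurable_cv.
move=> M; have [B B0 uB] := Hu (M + M0).
exists (A * B * fine (leb2 (box M))).
  by rewrite !mulr_ge0// fine_ge0.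
apply: sqint_bounded; [exact: measurable_cv|exact: mulr_ge0|].
by move=> x Mx; exact: (cv_sqr_le A0 B0 mW mu W0 Mx).
Qed.

(** The translation is carried by [u], so that Cauchy-Schwarz turns the L^2 bound of [Pdiff] into a
    pointwise one. *)
Lemma cv_increment W u e : L2c W -> L2loc u -> Pdiff e u ->
  forall M : R, exists2 C : R, 0 <= C & forall x (h : R), box M x -> `|h| <= M ->
    (cv W u (x + h *: e) - cv W u x) ^+ 2 <= C * h ^+ 2.
Proof.
move=> LW Lu Pu M; have [mW [M0 W0] [A A0 WA]] := LW.
have [C C0 HC] := Pu (M + `|M0|).
exists (A * C); first exact: mulr_ge0.
move=> x h Mx hM.
rewrite -cv_shiftr//; last exact: Lu.1.
rewrite -cvBr//; last exact: L2loc_shift.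
rewrite -mulrA; apply: (@cv_sqr_le _ _ (`|M0|) M _ _ x) => //.
- by rewrite mulr_ge0// sqr_ge0.
- by apply: measurable_funB; [apply: measurable_comp_shift|]; exact: Lu.1.
- by move=> z zM; apply: W0 => /boxW h'; apply: zM; apply: h'; exact: ler_norm.
- by apply: HC; rewrite (le_trans hM)// lerDl.
Qed.

Lemma cv_Pdiff W u e : L2c W -> L2loc u -> Pdiff e u -> Pdiff e (cv W u).
Proof.
move=> LW Lu Pu M; have [C C0 HC] := cv_increment LW Lu Pu M.
have mcv : measurable_fun [set: plane] (cv W u).
  by apply: measurable_cv; [case: LW|case: Lu].
exists (C * fine (leb2 (box M))); first by rewrite mulr_ge0// fine_ge0.
move=> h hM; rewrite mulrAC; apply: sqint_bounded.
- by apply: measurable_funB => //; exact: measurable_comp_shift.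
- by rewrite mulr_ge0// sqr_ge0.
- by move=> x Mx; exact: HC.
Qed.

(** Here the translation is carried by the kernel, so [delta] is uniform in [u]. The radius [N]
    precedes [eps] because [cv_C1] first needs the constant of [u] on [box N] and then chooses [eps]
    from it. *)
Lemma cv_translation W (M : R) : L2c W -> exists N : R, forall eps : R, 0 < eps ->
  exists2 delta : R, 0 < delta & forall u x t (B : R),
    L2loc u -> box M x -> box delta t -> 0 <= B -> (sqint (box N) u <= B%:E)%E ->
    (cv W u (x + t) - cv W u x) ^+ 2 <= eps * B.
Proof.
move=> LW; have [mW [M0 W0] [A A0 WA]] := LW.
exists (M + (M0 + 1)) => eps eps0.
have [delta d0 Hd] := translation_continuous mW W0 WA eps0.
exists (Num.min delta 1); first by rewrite lt_min d0/=.
move=> u x t B Lu Mx td B0 uB.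
have tdelta : box delta t by apply: boxW td; rewrite ge_min lexx.
have t1 : box 1 t by apply: boxW td; rewrite ge_min lexx orbT.
rewrite -cv_shiftl -cvBl//; last exact: L2c_shift.
apply: (@cv_sqr_le _ _ (M0 + 1) M _ _ x) => //.
- exact: ltW.
- by apply: measurable_funB => //; exact: measurable_comp_shift.
- exact: Lu.1.
- move=> z zM; rewrite !W0 ?subrr//.
    by move=> h; apply: zM; apply: boxW h; rewrite lerDl.
  by move=> h; apply: zM; rewrite -(addrK t z); apply: boxD => //; exact: boxN.
- exact: Hd.
Qed.

Lemma cv_continuous W u : L2c W -> L2loc u -> continuous (cv W u).
Proof.
move=> LW Lu x; have [M M0 Mx] := box_ex x.
apply/cvgrPdist_le => eps eps0.
have e2 : 0 < eps ^+ 2 by rewrite exprn_gt0.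
have [N HN] := cv_translation M LW.
have [B B0 uB] := Lu.2 N.
have [|delta d0 Hd] := HN (eps ^+ 2 / (B + 1)); first by rewrite divr_gt0// ltr_wpDl.
near=> y.
have yx : box delta (y - x).
  have : `|y - x| < delta by rewrite distrC; near: y; exact: cvgr_dist_lt.
  by rewrite prod_normE/= gt_max => /andP[/ltW ? /ltW ?].
have := Hd u x (y - x) B Lu Mx yx B0 uB.
rewrite (addrC x) subrK => H.
rewrite distrC -[leRHS](gtr0_norm eps0) -ler_sqr ?nnegrE// !real_normK ?num_real//.
rewrite (le_trans H)// mulrAC ler_pdivrMr ?ltr_wpDl// ler_wpM2l ?(ltW e2)//.
by rewrite lerDl.
Unshelve. all: by end_near. Qed.

Lemma Pdiff_le (M : R) u e : Pdiff e u -> measurable_fun [set: plane] u ->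
  exists2 C : R, 0 <= C & forall h : R, `|h| <= 1 ->
    (sqint (box M) (fun x => u (x + h *: e) - u x)%R <= (C * h ^+ 2)%:E)%E.
Proof.
move=> Pu mu; have [C C0 HC] := Pu (`|M| + 1); exists C => // h h1.
apply: le_trans (HC h _); last by rewrite (le_trans h1)// lerDr.
apply: sqintS; try exact: measurable_box.
  by apply: measurable_funTS; apply: measurable_funB => //; exact: measurable_comp_shift.
by move=> x; apply: boxW; rewrite (le_trans (ler_norm _))// lerDl.
Qed.

(** The second difference of [cv W u] is the increment by [t] of [cv W v], where
    [v = u(. + h e) - u] has square integral at most [C h^2] on [box N]. The choice
    [eps^2 / (C + 1)] makes it at most [eps |h|]. *)
Lemma cv_C1 W u e : `|e.1| <= 1 -> `|e.2| <= 1 -> L2c W -> L2loc u -> Pdiff e u ->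
  (forall x, derivable (cv W u) x e) /\ continuous (fun x => 'D_e (cv W u) x).
Proof.
move=> e1 e2 LW Lu Pu; have mu := Lu.1; have mW : measurable_fun [set: plane] W by case: LW.
apply: C1_of_second_difference => //.
  move=> M; have [C C0 HC] := cv_increment LW Lu Pu M.
  exists (Num.sqrt C) => x h Mx hM.
  rewrite -ler_sqr ?nnegrE ?mulr_ge0 ?sqrtr_ge0//.
  by rewrite exprMn !real_normK ?num_real// sqr_sqrtr// HC.
move=> M eps eps0.
have [N HN] := cv_translation M LW.
have [C C0 HC] := Pdiff_le N Pu mu.
have e0 : 0 < eps ^+ 2 by rewrite exprn_gt0.
have [|delta d0 Hd] := HN (eps ^+ 2 / (C + 1)); first by rewrite divr_gt0// ltr_wpDl.
exists delta => // x t h Mx td h1.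
have Lv : L2loc (fun z => u (z + h *: e) - u z) by apply: L2locB => //; exact: L2loc_shift.
have := Hd _ x t _ Lv Mx td (mulr_ge0 C0 (sqr_ge0 h)) (HC h h1).
rewrite !cvBr//; try exact: L2loc_shift.
rewrite !cv_shiftr// => H.
rewrite -ler_sqr ?nnegrE ?mulr_ge0// ?(ltW eps0)//.
rewrite exprMn !real_normK ?num_real//.
have -> : cv W u (x + t + h *: e) - cv W u (x + t) - cv W u (x + h *: e) + cv W u x =
  cv W u (x + t + h *: e) - cv W u (x + t) - (cv W u (x + h *: e) - cv W u x) by ring.
rewrite (le_trans H)// mulrA ler_wpM2r ?sqr_ge0// mulrAC ler_pdivrMr ?ltr_wpDl//.
by rewrite ler_wpM2l ?(ltW e0)// lerDl.
Qed.

Lemma L2locD_cst u (c : R) : L2loc u -> L2loc (fun x => u x + c).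
Proof.
move=> [mu Hu]; split; first exact: measurable_funD.
move=> M; have [B B0 uB] := Hu M.
have mD := @measurable_box R M.
exists (2 * (B + c ^+ 2 * fine (leb2 (box M)))).
  by rewrite mulr_ge0// addr_ge0// mulr_ge0 ?sqr_ge0// fine_ge0.
apply: sqintD => //; first exact: measurable_funTS.
exact: (@sqint_bounded M (c ^+ 2) (cst c) _ (sqr_ge0 c)).
Qed.

Lemma Pdiff_lip u v (K : R) e : measurable_fun [set: plane] u -> measurable_fun [set: plane] v ->
  (forall x y, `|v x - v y| <= K * `|u x - u y|) -> Pdiff e u -> Pdiff e v.
Proof.
move=> mu mv vu Pu M; have [C C0 HC] := Pu M.
have mD := @measurable_box R M.
exists (K ^+ 2 * C); first by rewrite mulr_ge0// sqr_ge0.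
move=> h hM.
have mi (f : plane -> R) : measurable_fun [set: plane] f -> measurable_fun (box M) (fun x : plane => f (x + h *: e) - f x).
  by move=> mf; apply: measurable_funTS; apply: measurable_funB => //; exact: measurable_comp_shift.
apply: (@le_trans _ _ (sqint (box M) (fun x => K * (u (x + h *: e) - u x))%R)).
  apply: sqint_le => //; [exact: mi|by apply: measurable_funM => //; exact: mi|].
  move=> x _; rewrite normrM; apply: (le_trans (vu _ _)).
  by rewrite ler_wpM2r// ler_norm.
by rewrite -mulrA; apply: sqintZ => //; [exact: mi|exact: HC].
Qed.

Lemma L2loc_lip (sigma : R -> R) u (K : R) :
  (forall s t : R, `|sigma s - sigma t| <= K * `|s - t|) -> measurable_fun [set: R] sigma ->
  L2loc u -> L2loc (fun x => sigma (u x)).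
Proof.
move=> lip ms [mu Hu].
have msu : measurable_fun [set: plane] (fun x => sigma (u x)) by exact: measurableT_comp ms mu.
have : L2loc (fun x => (sigma (u x) - sigma 0) + sigma 0); last first.
  by under eq_fun do rewrite subrK.
apply: L2locD_cst; split; first exact: measurable_funB.
move=> M; have [B B0 uB] := Hu M; have mD := @measurable_box R M.
exists (K ^+ 2 * B); first by rewrite mulr_ge0// sqr_ge0.
apply: le_trans (sqintZ K mD _ uB); last exact: measurable_funTS.
apply: sqint_le => //.
- by apply: measurable_funTS; exact: measurable_funB.
- by apply: measurable_funTS; exact: measurable_funM.
- by move=> x _; rewrite normrM (le_trans (lip _ _))// subr0 ler_wpM2r// ler_norm.
Qed.

Lemma lip_continuous (sigma : R -> R) (K : R) :
  (forall s t : R, `|sigma s - sigma t| <= K * `|s - t|) -> continuous sigma.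
Proof.
move=> lip x; apply/cvgrPdist_le => eps eps0.
have K1 : 0 < `|K| + 1 by rewrite ltr_wpDl.
near=> y.
rewrite (le_trans (lip _ _))//.
have : `|x - y| <= eps / (`|K| + 1).
  by near: y; apply: cvgr_dist_le; [exact: cvg_id|rewrite divr_gt0].
rewrite ler_pdivlMr// => h; apply: le_trans h.
by rewrite mulrC ler_wpM2l// (le_trans (ler_norm _))// lerDl.
Unshelve. all: by end_near. Qed.

Lemma rect_openE (t : rect R) :
  rect_open t = `]rxa t, rxb t[%classic `*` `]ryc t, ryd t[%classic.
Proof. by apply/seteqP; split => x /=; rewrite /rect_open/= !in_itv. Qed.

Lemma measurable_rect_open (t : rect R) : measurable (rect_open t).
Proof. by rewrite rect_openE; exact: measurableX. Qed.

Lemma rect_open_box (t : rect R) : exists M : R, rect_open t `<=` box M.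
Proof.
exists (`|rxa t| + `|rxb t| + (`|ryc t| + `|ryd t|)) => x [/andP[h1 h2] /andP[h3 h4]].
have := ler_norm (rxb t); have := ler_norm (- rxa t); have := ler_norm (ryd t); have := ler_norm (- ryc t).
rewrite !normrN => *.
have := normr_ge0 (rxa t); have := normr_ge0 (rxb t); have := normr_ge0 (ryc t); have := normr_ge0 (ryd t) => *.
by split; rewrite ler_norml; apply/andP; split; lra.
Qed.

Lemma L2on_L2c (t : rect R) w : L2on (rect_open t) w -> L2c (w \_ (rect_open t)).
Proof.
move=> [mw wfin]; have mS := measurable_rect_open t.
split.
- exact/(measurable_restrictT _ mS).
- have [M HM] := rect_open_box t; exists M => z zM.
  by rewrite /patch memNset// => /HM.
have -> : sqint setT (w \_ (rect_open t)) = (\int[leb2]_(x in rect_open t) (w x ^+ 2)%:E)%E.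
  rewrite [RHS]integral_mkcond; apply: eq_integral => x _.
  by rewrite /patch; case: ifP => // _; rewrite expr0n.
exists (fine (\int[leb2]_(x in rect_open t) (w x ^+ 2)%:E)%E).
  by rewrite fine_ge0// integral_ge0// => x _; rewrite lee_fin sqr_ge0.
rewrite fineK// ge0_fin_numE//; apply: integral_ge0 => x _; rewrite lee_fin sqr_ge0//.
Qed.

Lemma convFE u w (t : rect R) x : L2on (rect_open t) w -> measurable_fun [set: plane] u ->
  convF u w (rect_open t) x = cv (w \_ (rect_open t)) u x.
Proof.
move=> Lw mu; have [mW _ _] := L2on_L2c Lw.
set W := w \_ _; rewrite /convF /cv; congr fine.
have := @int_aff2 R true x.1 true x.2 (fun z => (W (x - z) * u z)%:E).
move=> <-; last first.
  by apply/measurable_EFinP; apply: measurable_funM => //; exact: measurable_kernel.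
rewrite integral_mkcond; apply: eq_integral => y _.
rewrite -sub_aff2 subKr /W /patch; case: ifP => // _.
by rewrite mul0r.
Qed.

End convolution.

(** * Integration against the derivative of a BV measure *)

Section signed_integral.
Context d (T : measurableType d) (R : realType).
Variables (mp mm : {finite_measure set T -> \bar R}) (D : set T) (mD : measurable D).
Implicit Types f g : T -> R.

Definition sintegral2 f : R := \int[mp]_(x in D) f x - \int[mm]_(x in D) f x.

Let fin_lty (m : {finite_measure set T -> \bar R}) : (m D < +oo)%E.
Proof. by rewrite ltey_eq fin_num_measure. Qed.

Let bint (m : {finite_measure set T -> \bar R}) f : bm f -> m.-integrable D (EFin \o f).
Proof. by move=> bf; exact: (@bm_integrable _ _ _ m D mD (fin_lty m)). Qed.

Lemma sintegral2_lin (c : R) f g : bm f -> bm g ->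
  sintegral2 (fun x => c * f x + g x) = c * sintegral2 f + sintegral2 g.
Proof.
move=> bf bg; rewrite /sintegral2.
have bcf := bmZ c bf.
rewrite !RintegralD//; try exact: bint.
rewrite !RintegralZl//; try exact: bint.
ring.
Qed.

Lemma sintegral2D f g : bm f -> bm g ->
  sintegral2 (fun x => f x + g x) = sintegral2 f + sintegral2 g.
Proof.
move=> bf bg; rewrite -[X in _ = X + _]mul1r -sintegral2_lin//.
by congr sintegral2; apply/funext => x; rewrite mul1r.
Qed.

Lemma sintegral2Z (c : R) f : bm f -> sintegral2 (fun x => c * f x) = c * sintegral2 f.
Proof.
move=> bf; rewrite /sintegral2 !RintegralZl//; try exact: bint.
ring.
Qed.

Lemma sintegral2_dct (f_ : nat -> T -> R) f (K : R) :
  (forall n, measurable_fun [set: T] (f_ n)) -> (forall n x, `|f_ n x| <= K) ->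
  (forall x, f_ ^~ x @ \oo --> f x) ->
  (fun n => sintegral2 (f_ n)) @ \oo --> sintegral2 f.
Proof. by move=> mf fK ff; apply: cvgB;
  [exact: (@Rintegral_dct _ _ _ mp D mD (fin_lty mp) _ _ K)|exact: (@Rintegral_dct _ _ _ mm D mD (fin_lty mm) _ _ K)]. Qed.

Lemma eq_sintegral2 f g : (forall x, D x -> f x = g x) -> sintegral2 f = sintegral2 g.
Proof.
move=> fg; rewrite /sintegral2.
by congr (_ - _); apply: eq_Rintegral => x /set_mem; exact: fg.
Qed.

Lemma sintegral2_le f (K : R) : bm f -> (forall x, D x -> `|f x| <= K) ->
  `|sintegral2 f| <= K * (fine (mp D) + fine (mm D)).
Proof.
move=> bf fK; rewrite mulrDr (le_trans (ler_normB _ _))// lerD//;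
  [exact: (@Rintegral_bound _ _ _ mp D mD (fin_lty mp))|exact: (@Rintegral_bound _ _ _ mm D mD (fin_lty mm))].
Qed.

End signed_integral.

Section interval_measure.
Variable R : realType.
Notation lam := (@lebesgue_measure R).

Lemma lam_cc (u v : R) : u < v -> lam `[u, v]%classic = (v - u)%:E.
Proof. by move=> uv; rewrite lebesgue_measure_itv/= lte_fin uv EFinB. Qed.

Lemma lam_cc_lty (u v : R) : (lam `[u, v]%classic < +oo)%E.
Proof. by rewrite lebesgue_measure_itv; case: ifP => _; rewrite ?ltry// -EFinB ltry. Qed.

Lemma lam_oo_lty (u v : R) : (lam `]u, v[%classic < +oo)%E.
Proof. by rewrite lebesgue_measure_itv; case: ifP => _; rewrite ?ltry// -EFinB ltry. Qed.

End interval_measure.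

(** * Primitives in the first variable *)

Section primitive.
Variable R : realType.
Notation plane := (R * R)%type.
Notation lam := (@lebesgue_measure R).
Variables (a b : R).
Implicit Types (H G : plane -> R).

(** The upper limit is an indicator in the integrand, so that the domain stays fixed under limits
    and joint measurability in [(s, r)] follows from that of parametric integrals. At [s = b] it is
    the full integral. *)
Definition prim H (s r : R) : R :=
  \int[lam]_(s' in `]a, b[) (H (s', r) * \1_(`]-oo, s]%classic) s').

Let lam_lty : (lam `]a, b[%classic < +oo)%E.
Proof. by rewrite lebesgue_measure_itv; case: ifP => _; rewrite ?ltry// -EFinB ltry. Qed.

Let mI : measurable (`]a, b[%classic : set R) := measurable_itv _.

Lemma bm_slice H (r : R) : bm H -> bm (fun s => H (s, r)).
Proof.
move=> [mH [K HK]]; split; last by exists K.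
by apply: (measurableT_comp mH); exact: measurable_pair2.
Qed.

Lemma bm_prim_integrand H (s r : R) : bm H -> bm (fun s' => H (s', r) * \1_(`]-oo, s]%classic) s').
Proof. by move=> bH; apply: bmM; [exact: bm_slice|exact: bm_indic]. Qed.

Lemma prim_le H (K s r : R) : bm H -> (forall z, `|H z| <= K) ->
  `|prim H s r| <= K * fine (lam `]a, b[%classic).
Proof.
move=> bH HK; apply: Rintegral_bound => //; first exact: bm_prim_integrand.
move=> x _; rewrite normrM -[leRHS]mulr1 ler_pM//.
by rewrite indicE; case: (_ \in _) => /=; rewrite ?normr1 ?normr0.
Qed.

Lemma prim_lin (c : R) H G s r : bm H -> bm G ->
  prim (fun z => c * H z + G z) s r = c * prim H s r + prim G s r.
Proof.
move=> bH bG; rewrite /prim.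
have bH' := bm_prim_integrand s r bH.
have bG' := bm_prim_integrand s r bG.
rewrite -RintegralZl//; last exact: (@bm_integrable _ _ _ lam _ mI lam_lty).
rewrite -RintegralD//; last 2 first.
- exact: (@bm_integrable _ _ _ lam _ mI lam_lty _ (bmZ c bH')).
- exact: (@bm_integrable _ _ _ lam _ mI lam_lty).
by apply: eq_Rintegral => x _; rewrite mulrDl mulrA.
Qed.

Lemma prim_dct (H_ : nat -> plane -> R) H (K s r : R) :
  (forall n, bm (H_ n)) -> (forall n x, `|H_ n x| <= K) ->
  (forall x, H_ ^~ x @ \oo --> H x) ->
  (fun n => prim (H_ n) s r) @ \oo --> prim H s r.
Proof.
move=> bH HK HH.
apply: (@Rintegral_dct _ _ _ lam _ mI lam_lty (fun n s' => H_ n (s', r) * \1_(`]-oo, s]%classic) s') _ K).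
- by move=> n; have [] := bm_prim_integrand s r (bH n).
- move=> n x; rewrite normrM -[leRHS]mulr1 ler_pM//.
  by rewrite indicE; case: (_ \in _) => /=; rewrite ?normr1 ?normr0.
- by move=> x; apply: cvgMl; exact: HH.
Qed.

Lemma measurable_prim H : bm H -> measurable_fun [set: plane] (fun z => prim H z.1 z.2).
Proof.
move=> bH.
have -> : (fun z : plane => prim H z.1 z.2) = (fun z : plane => fine (\int[lam]_s'
   ((H (s', z.2) * \1_(`]-oo, z.1]%classic) s') * \1_(`]a, b[%classic) s')%:E)%E).
  apply/funext => z; rewrite /prim Rintegral_mkcond /Rintegral; congr fine.
  apply: eq_integral => s' _; congr EFin; rewrite /patch [in RHS]indicE [\1_(`]a, b[%classic) _]indicE.
  by case: ifP => _; rewrite ?mulr1 ?mulr0.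
have mH := bH.1.
apply: (@measurable_fine_integral _ _ _ _ R lam (fun p : plane * R =>
   (H (p.2, p.1.2) * \1_(`]-oo, p.1.1]%classic) p.2) * \1_(`]a, b[%classic) p.2)).
have m2 : measurable_fun [set: plane * R] (fun p : plane * R => p.2) by exact: measurable_snd.
have m11 : measurable_fun [set: plane * R] (fun p : plane * R => p.1.1).
  by apply: measurableT_comp; exact: measurable_fst.
have m12 : measurable_fun [set: plane * R] (fun p : plane * R => p.1.2).
  by apply: measurableT_comp; [exact: measurable_snd|exact: measurable_fst].
apply: measurable_funM; first apply: measurable_funM.
- by apply: (measurableT_comp mH); exact: measurable_fun_pair.
- have -> : (fun p : plane * R => \1_(`]-oo, p.1.1]%classic) p.2 : R) =
     (\1_[set p : plane * R | p.2 <= p.1.1] : plane * R -> R).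
    apply/funext => p; rewrite !indicE.
    have -> // : (p.2 \in `]-oo, p.1.1]%classic) = (p \in [set p : plane * R | p.2 <= p.1.1]).
    by apply/idP/idP => /set_mem/= h; apply: mem_set => /=; move: h; rewrite in_itv.
  apply: measurable_indic.
  rewrite -[X in measurable X]setTI (_ : [set p : plane * R | _] = (fun p : plane * R => p.2 <= p.1.1) @^-1` [set true]); last first.
    by apply/seteqP; split => p.
  by apply: measurable_fun_ler.
- by apply: (measurableT_comp _ m2); exact: measurable_indic.
Qed.

Lemma bm_prim H : bm H -> bm (fun z => prim H z.1 z.2).
Proof.
move=> bH; split; first exact: measurable_prim.
by have [K HK] := bH.2; exists (K * fine (lam `]a, b[%classic)) => z; exact: prim_le.
Qed.

Lemma prim_tensor (f g : R -> R) s r : bm f ->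
  prim (tensor f g) s r = prim (tensor f (fun=> 1)) s 0 * g r.
Proof.
move=> bf; rewrite /prim -RintegralZr//; last first.
  apply: (@bm_integrable _ _ _ lam _ mI lam_lty).
  apply: bmM; last exact: bm_indic.
  by rewrite /tensor/=; apply: bmM => //; exact: bm_cst.
by apply: eq_Rintegral => x _; rewrite /tensor/= mulr1 mulrAC.
Qed.

Lemma is_derive_prim (f : R -> R) (x : R) : bm f -> continuous f ->
  (forall t, t <= a \/ b <= t -> f t = 0) ->
  is_derive x 1 (fun s => prim (tensor f (fun=> 1)) s 0) (f x).
Proof.
move=> bf cf f0.
(* The integral is started strictly to the left of [a] and of [x]: nothing is added, as [f] vanishes
   left of [a], and [x] becomes interior, as the fundamental theorem requires. *)
pose a0 := Num.min a x - 1.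
have a0x : a0 < x by rewrite /a0 ltrBlDr (@le_lt_trans _ _ x)// ?ge_min ?lexx ?orbT// ltrDl.
have a0a : a0 < a by rewrite /a0 ltrBlDr (@le_lt_trans _ _ a)// ?ge_min ?lexx// ltrDl.
have -> : (fun s => prim (tensor f (fun=> 1)) s 0) = (fun s => \int[lam]_(t in `[a0, s]) f t).
  apply/funext => s; rewrite /prim Rintegral_mkcond [RHS]Rintegral_mkcond.
  apply: eq_Rintegral => t _; rewrite /patch /tensor/= mulr1 indicE.
  rewrite !mem_setE !in_itv/=.
  have [ta|ta] := leP t a.
    by rewrite [f t]f0 ?mul0r//=; [case: ifP|left].
  have [bt|tb] := leP b t.
    by rewrite [f t]f0 ?mul0r//=; [case: ifP|right].
  rewrite /= (ltW (lt_trans a0a ta))/=.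
  by case: (t <= s); rewrite ?mulr1 ?mulr0.
have x1 : x < x + 1 by rewrite ltrDl.
have intf : lam.-integrable `[a0, x + 1] (EFin \o f).
  apply: (@bm_integrable _ _ _ lam) => //.
  exact: lam_cc_lty.
have [dx dE] := @continuous_FTC1_closed R f a0 x (x + 1) x1 intf a0x (cf x).
by rewrite derive1E in dE; rewrite -dE; exact: derivableP.
Qed.

Lemma prim_eq H G s r : (forall s', a < s' < b -> H (s', r) = G (s', r)) -> prim H s r = prim G s r.
Proof.
move=> HG; apply: eq_Rintegral => s' /set_mem /=; rewrite in_itv/= => /HG ->//.
Qed.

Lemma prim_tensor1 (f : R -> R) s :
  prim (tensor f (fun=> 1)) s 0 = \int[lam]_(t in `]a, b[) (f t * \1_(`]-oo, s]%classic) t).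
Proof. by apply: eq_Rintegral => t _; rewrite /tensor/= mulr1. Qed.

End primitive.

Lemma flat0_mono (R : realType) (x y : R) : 0 < x -> x <= y -> flat 0 x <= flat 0 y.
Proof.
move=> x0 xy; have y0 : 0 < y := lt_le_trans x0 xy.
by rewrite /flat x0 y0 !mul1r ler_expR lerN2 lef_pV2.
Qed.

Lemma prim_bump_gt0 (R : realType) (a b : R) : a < b ->
  0 < prim a b (tensor (bump 1 ((2 * a + b) / 3) ((a + 2 * b) / 3)) (fun=> 1)) b 0.
Proof.
move=> ab; set B := bump _ _ _.
pose lam := @lebesgue_measure R.
(* [[l, r]] is the middle ninth of [[a, b]]. Its points are at distance at least [dt] from both ends
   of the middle third, which carries the bump, so the bump is at least [k] there. *)
pose l := (5 * a + 4 * b) / 9; pose r := (4 * a + 5 * b) / 9; pose dt := (b - a) / 9.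
have dt0 : 0 < dt by rewrite /dt; lra.
pose k := flat 0 dt * flat 0 dt.
have k0 : 0 < k by rewrite mulr_gt0// /flat dt0 mul1r expR_gt0.
have bk : bm (fun t => k * \1_(`[l, r]%classic) t) by apply: bmZ; exact: bm_indic.
have bs : bm (fun t => B t * \1_(`]-oo, b]%classic) t).
  by apply: bmM; [exact: bump_bm|exact: bm_indic].
have mI : measurable (`]a, b[%classic : set R) by exact: measurable_itv.
have fI := lam_oo_lty a b.
apply: (@lt_le_trans _ _ (\int[lam]_(t in `]a, b[) (k * \1_(`[l, r]%classic) t))).
  rewrite RintegralZl//; last first.
    by apply: (@bm_integrable _ _ _ lam _ mI fI); exact: bm_indic.
  rewrite mulr_gt0// /Rintegral integral_indic//.
  have lr : l < r by rewrite /l /r; lra.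
  rewrite [X in fine X](_ : _ = (r - l)%:E) ?subr_gt0//.
  rewrite -lam_cc//; congr (lam _).
  apply/seteqP; split => [t []//|t /= h]; split => //; move: h.
  by rewrite /= !in_itv/= /l /r => /andP[? ?]; apply/andP; split; lra.
rewrite prim_tensor1; apply: le_Rintegral => //.
- exact: (@bm_integrable _ _ _ lam _ mI fI _ bk).
- exact: (@bm_integrable _ _ _ lam _ mI fI _ bs).
move=> t /=; rewrite in_itv/= => /andP[_ tb].
rewrite !indicE !mem_setE !in_itv/= (ltW tb) mulr1.
have [/andP[lt tr]|_] := boolP (l <= t <= r); rewrite ?mulr1 ?mulr0 ?bump_ge0//.
rewrite /B /bump !mul1r ler_pM ?flat_ge0//; apply: flat0_mono => //.
  by move: lt; rewrite /l /dt; lra.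
by move: tr; rewrite /r /dt; lra.
Qed.

(** * Integrals against the measure controlled by primitives *)

Section bv_estimate.
Context d (T : measurableType d) (R : realType).
Notation plane := (R * R)%type.
Notation lam := (@lebesgue_measure R).
Variables (p1 p2 : T -> R).
Hypotheses (mp1 : measurable_fun [set: T] p1) (mp2 : measurable_fun [set: T] p2).
Variables (a b c e : R) (D : set T).
Hypotheses (ce : c < e) (mD : measurable D).
Hypothesis Dp : forall x, D x -> a < p1 x < b /\ c < p2 x < e.
Variables mp mm np nm : {finite_measure set T -> \bar R}.

Notation Sm := (sintegral2 mp mm D).
Notation Sn := (sintegral2 np nm D).

Hypothesis ibp : forall f f' g : R -> R, smooth1 f -> smooth1 f' ->
  (forall x : R, is_derive x 1 f (f' x)) -> smooth1 g ->
  supp_in a b f -> supp_in c e g ->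
  Sm (fun x => f' (p1 x) * g (p2 x)) = - Sn (fun x => f (p1 x) * g (p2 x)).

Notation prim1 f s := (prim a b (tensor f (fun=> 1)) s 0).

Variable B : R -> R.
Hypotheses (sB : smooth1 B) (bB : bm B) (B01 : forall t, 0 <= B t <= 1).
Hypotheses (suppB : supp_in a b B) (K_gt0 : 0 < prim1 B b).

Notation K := (prim1 B b).

Let K_ge0 : 0 <= K. Proof. exact: ltW. Qed.

Let normB t : `|B t| <= 1.
Proof. by have /andP[h1 h2] := B01 t; rewrite ger0_norm. Qed.

Let prim1_le s : 0 <= prim1 B s <= K.
Proof.
have bs s' : bm (fun t => B t * \1_(`]-oo, s']%classic) t) by apply: bmM => //; exact: bm_indic.
rewrite !prim_tensor1; apply/andP; split.
  by apply: Rintegral_ge0 => t _; rewrite mulr_ge0//; have /andP[] := B01 t.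
apply: le_Rintegral => //.
- exact: (@bm_integrable _ _ _ lam _ (measurable_itv _) (lam_oo_lty a b) _ (bs s)).
- exact: (@bm_integrable _ _ _ lam _ (measurable_itv _) (lam_oo_lty a b) _ (bs b)).
move=> t /=; rewrite in_itv/= => /andP[_ tb].
have /andP[B0 _] := B01 t.
rewrite ler_wpM2l// [leRHS]indicE mem_setE in_itv/= (ltW tb).
by rewrite indicE; case: (_ \in _).
Qed.

(** [Phi H / K] is [H] minus the multiple of [B] with the same integral over []a, b[], and
    [Psi H / K] is its primitive; multiplying by [K] avoids a division. The coordinates are
    arbitrary maps [p1], [p2], so that both axes are covered. *)
Let Phi (H : plane -> R) (x : T) : R := K * H (p1 x, p2 x) - prim a b H b (p2 x) * B (p1 x).
Let Psi (H : plane -> R) (x : T) : R :=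
  K * prim a b H (p1 x) (p2 x) - prim1 B (p1 x) * prim a b H b (p2 x).

Let bm_comp (f : R -> R) (p : T -> R) : measurable_fun [set: T] p -> bm f -> bm (fun x => f (p x)).
Proof.
by move=> mp' [mf [L Lf]]; split; [exact: measurableT_comp mf mp'|exists L].
Qed.

Let bm_comp2 (f : plane -> R) (q1 q2 : T -> R) : measurable_fun [set: T] q1 ->
  measurable_fun [set: T] q2 -> bm f -> bm (fun x => f (q1 x, q2 x)).
Proof.
move=> m1 m2 [mf [L Lf]]; split; last by exists L.
by apply: (measurableT_comp mf); exact: measurable_fun_pair.
Qed.

Let bm_Phi H : bm H -> bm (Phi H).
Proof.
move=> bH; apply: bmB; first by apply: bmZ; exact: bm_comp2.
apply: bmM; last exact: bm_comp.
by have := @bm_comp2 _ (cst b) p2 (measurable_cst _) mp2 (bm_prim a b bH).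
Qed.

Let bm_prim1 : bm (fun s => prim1 B s).
Proof.
have bt : bm (tensor B (fun=> 1)) by apply: tensor_bm => //; exact: bm_cst.
have [m _] := bm_prim a b bt.
split.
  apply: (measurableT_comp m (g := fun s : R => (s, 0 : R))).
  by apply: measurable_fun_pair => //; exact: measurable_cst.
by exists K => x; have /andP[h1 h2] := prim1_le x; rewrite ger0_norm.
Qed.

Let bm_Psi H : bm H -> bm (Psi H).
Proof.
move=> bH; apply: bmB.
  by apply: bmZ; exact: (@bm_comp2 _ p1 p2 mp1 mp2 (bm_prim a b bH)).
apply: bmM; first exact: bm_comp bm_prim1.
exact: (@bm_comp2 _ (cst b) p2 (measurable_cst _) mp2 (bm_prim a b bH)).
Qed.

(** Integration by parts for the corrected function. It is linear and stable under bounded limits,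
    hence extends from tensors by the monotone class theorem. *)
Let Pr H := Sm (Phi H) = - Sn (Psi H).

Let Pr_lin (k : R) H G : bm H -> bm G -> Pr H -> Pr G -> Pr (fun z => k * H z + G z).
Proof.
move=> bH bG PH PG; rewrite /Pr.
have -> : Phi (fun z => k * H z + G z) = (fun x => k * Phi H x + Phi G x).
  apply/funext => x; rewrite /Phi prim_lin//.
  by move: K (prim a b H b _) (prim a b G b _) => *; ring.
have -> : Psi (fun z => k * H z + G z) = (fun x => k * Psi H x + Psi G x).
  apply/funext => x; rewrite /Psi !prim_lin//.
  by move: K (prim1 B _) (prim a b H b _) (prim a b G b _) (prim a b H _ _) (prim a b G _ _) => *; ring.
have E1 := sintegral2_lin mp mm mD k (bm_Phi bH) (bm_Phi bG).
have E2 := sintegral2_lin np nm mD k (bm_Psi bH) (bm_Psi bG).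
have PH' : Sm (Phi H) = - Sn (Psi H) := PH.
have PG' : Sm (Phi G) = - Sn (Psi G) := PG.
by rewrite E1 E2 PH' PG'; move: (Sn (Psi H)) (Sn (Psi G)) => u v; ring.
Qed.

Let Pr_lim (H_ : nat -> plane -> R) H (L : R) : (forall n, bm (H_ n)) ->
  (forall n x, `|H_ n x| <= L) -> (forall x, H_ ^~ x @ \oo --> H x) ->
  (forall n, Pr (H_ n)) -> Pr H.
Proof.
move=> bH HL HH PH.
have cp s r := @prim_dct R a b H_ H L s r bH HL HH.
pose V := fine (lam `]a, b[%classic).
have V0 : 0 <= V by exact: fine_ge0.
have pL n s r : `|prim a b (H_ n) s r| <= L * V by exact: prim_le.
have c1 : (fun n => Sm (Phi (H_ n))) @ \oo --> Sm (Phi H).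
  apply: (@sintegral2_dct _ _ _ mp mm D mD _ _ (K * L + L * V)).
  - by move=> n; exact: (bm_Phi (bH n)).1.
  - move=> n x; rewrite (le_trans (ler_normB _ _))// !normrM lerD//.
      by rewrite gtr0_norm// ler_pM2l.
    by rewrite -[leRHS]mulr1 ler_pM.
  - by move=> x; apply: cvgB; [apply: cvgMr; exact: HH|apply: cvgMl; exact: cp].
have c2 : (fun n => Sn (Psi (H_ n))) @ \oo --> Sn (Psi H).
  apply: (@sintegral2_dct _ _ _ np nm D mD _ _ (K * (L * V) + K * (L * V))).
  - by move=> n; exact: (bm_Psi (bH n)).1.
  - move=> n x; rewrite (le_trans (ler_normB _ _))// !normrM lerD//.
      by rewrite gtr0_norm// ler_pM2l.
    rewrite ler_pM//.
    by have /andP[h1 h2] := prim1_le (p1 x); rewrite ger0_norm.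
  - by move=> x; apply: cvgB; apply: cvgMr; exact: cp.
apply: (cvg_unique (@Rhausdorff R) c1).
have -> : (fun n => Sm (Phi (H_ n))) = (fun n => - Sn (Psi (H_ n))).
  by apply/funext => n; exact: PH.
exact: cvgN.
Qed.

Let Pr_tensor (f g : R -> R) : smooth1 f -> smooth1 g -> bm f -> bm g ->
  supp_in a b f -> supp_in c e g -> Pr (tensor f g).
Proof.
move=> sf sg bf bg suppf suppg; rewrite /Pr.
have out h : supp_in a b h -> forall t, t <= a \/ b <= t -> h t = 0.
  move=> [a' [b' [aa' bb' h0]]] t [ta|bt]; apply: h0; [left|right].
    by rewrite (le_trans ta)// ltW.
  by rewrite (le_trans _ bt)// ltW.
have dp h : bm h -> smooth1 h -> supp_in a b h -> forall x : R, is_derive x 1 (fun s => prim1 h s) (h x).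
  by move=> bh sh supph x; apply: is_derive_prim => //; [exact: smooth1_continuous|exact: out].
set k := prim1 f b.
pose F s := K * prim1 f s - k * prim1 B s.
pose F' s := K * f s - k * B s.
have smB h1 h2 c1 c2 : smooth1 h1 -> smooth1 h2 -> smooth1 (fun s : R => c1 * h1 s - c2 * h2 s).
  move=> s1 s2.
  exists [set h | exists g1 g2, [/\ smooth1 g1, smooth1 g2 & h = (fun s : R => c1 * g1 s - c2 * g2 s)]].
    by exists h1, h2.
  move=> h [g1 [g2 [sg1 sg2 ->]]].
  have [g1' sg1' dg1] := smooth1_derive sg1.
  have [g2' sg2' dg2] := smooth1_derive sg2.
  exists (fun s => c1 * g1' s - c2 * g2' s); first by exists g1', g2'.
  move=> x; have d1 := dg1 x; have d2 := dg2 x.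
  have -> : (fun s : R => c1 * g1 s - c2 * g2 s) = (c1 *: g1) - (c2 *: g2) by apply/funext.
  exact: is_deriveB.
have dF : forall x : R, is_derive x 1 F (F' x).
  move=> x; have d1 := dp _ bf sf suppf x; have d2 := dp _ bB sB suppB x.
  have -> : F = (K *: (fun s => prim1 f s)) - (k *: (fun s => prim1 B s)) by apply/funext.
  exact: is_deriveB.
have sF' : smooth1 F' by exact: smB.
have sF : smooth1 F by exact: smooth1_primitive sF' dF.
(* Right of both supports [F] equals [K k - k K = 0]: this cancellation is the purpose of the
   correction by [B]. *)
have suppF : supp_in a b F.
  have [a1 [b1 [aa1 bb1 f0]]] := suppf.
  have [a2 [b2 [aa2 bb2 B0]]] := suppB.
  exists (Num.min a1 a2), (Num.max b1 b2); split; [by rewrite lt_min aa1|by rewrite gt_max bb1|].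
  have z1 h s a0 : (forall t, t <= a0 -> h t = 0) -> s <= a0 -> prim1 h s = 0.
    move=> h0 sa0; rewrite prim_tensor1 (_ : (fun t => _) = cst 0); last first.
      apply/funext => t; rewrite indicE mem_setE in_itv/=.
      by have [ts|] := leP t s; rewrite ?mulr0// h0 ?mul0r// (le_trans ts).
    by rewrite /Rintegral integral0.
  have z2 h s b0 : (forall t, b0 <= t -> h t = 0) -> b0 <= s -> prim1 h s = prim1 h b.
    move=> h0 sb0; rewrite !prim_tensor1; apply: eq_Rintegral => t; rewrite mem_setE in_itv/= => /andP[_ tb].
    rewrite !indicE !mem_setE !in_itv/= (ltW tb).
    by have [ts|st] := leP t s; rewrite ?mulr0// h0 ?mul0r// (le_trans sb0)// ltW.
  move=> t [|]; rewrite ?le_min ?ge_max => /andP[h1 h2]; rewrite /F.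
    rewrite (z1 f t a1)//; last by move=> t' ?; apply: f0; left.
    rewrite (z1 B t a2)//; last by move=> t' ?; apply: B0; left.
    by rewrite !mulr0 subrr.
  rewrite (z2 f t b1)//; last by move=> t' ?; apply: f0; right.
  rewrite (z2 B t b2)//; last by move=> t' ?; apply: B0; right.
  by rewrite mulrC subrr.
have := ibp sF sF' dF sg suppF suppg.
have -> : (fun x => F' (p1 x) * g (p2 x)) = Phi (tensor f g).
    apply/funext => x; rewrite /Phi.
  have -> : prim a b (tensor f g) b (p2 x) = k * g (p2 x) by exact: prim_tensor.
  by rewrite /F' /tensor/=; ring.
move=> ->; congr (- _).
have -> // : (fun x => F (p1 x) * g (p2 x)) = Psi (tensor f g).
apply/funext => x; rewrite /Psi.
have -> : prim a b (tensor f g) b (p2 x) = k * g (p2 x) by exact: prim_tensor.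
have -> : prim a b (tensor f g) (p1 x) (p2 x) = prim1 f (p1 x) * g (p2 x) by exact: prim_tensor.
by rewrite /F; ring.
Qed.

Let Om : set plane := `]a, b[%classic `*` `]c, e[%classic.

Let mOm : measurable Om. Proof. exact: measurableX. Qed.

(** The margin [1 / (n + 1)] keeps each bump compactly supported in []a0, b0[], although []a', b'[]
    is arbitrary. *)
Let bump_trunc (a0 b0 a' b' : R) (n : nat) (t : R) : R :=
  bump n.+1%:R (Num.max a' (a0 + n.+1%:R^-1)) (Num.min b' (b0 - n.+1%:R^-1)) t.

Let bump_trunc_cvg (a0 b0 a' b' t : R) :
  (fun n => bump_trunc a0 b0 a' b' n t) @ \oo -->
  (\1_(`]a', b'[%classic) t * \1_(`]a0, b0[%classic) t : R).
Proof.
rewrite !indicE !mem_setE !in_itv/=.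
have [h|h] := boolP ((a' < t < b') && (a0 < t < b0)).
  have /andP[/andP[h1 h2] /andP[h3 h4]] := h; rewrite h1 h2 h3 h4 mulr1.
  pose m := Num.min (Num.min (t - a') (b' - t)) (Num.min (t - a0) (b0 - t)).
  have m0 : 0 < m by rewrite !lt_min !subr_gt0 h1 h2 h3 h4.
  have m1 : m <= t - a' by rewrite !ge_min lexx.
  have m2 : m <= b' - t by rewrite !ge_min lexx orbT.
  have m3 : m <= t - a0 by rewrite !ge_min lexx !orbT.
  have m4 : m <= b0 - t by rewrite !ge_min lexx !orbT.
  have m20 : 0 < m / 2 by rewrite divr_gt0.
  apply: (@bump_cvg1 R (m / 2)) => //.
  near=> n.
  have n1 : n.+1%:R^-1 < m / 2 by near: n; exact: (near_infty_natSinv_lt (PosNum m20)).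
  set i := n.+1%:R^-1 in n1 *.
  have q1 : Num.max a' (a0 + i) <= t - m / 2 by rewrite ge_max; apply/andP; split; lra.
  have q2 : t + m / 2 <= Num.min b' (b0 - i) by rewrite le_min; apply/andP; split; lra.
  by apply/andP; split; lra.
rewrite -natrM mulnb (negbTE h) (_ : (fun n => _) = (fun=> 0)); first exact: cvg_cst.
apply/funext => n; apply: bump_out => //.
have i0 : 0 < n.+1%:R^-1 :> R by rewrite invr_gt0.
set i := n.+1%:R^-1 in i0 *.
rewrite le_max ge_min.
have [|h1] := leP t a'; first by left.
have [|h2] := leP b' t; first by right.
have [|h3] := leP t a0; first by move=> ?; left; apply/orP; right; lra.
have [|h4] := leP b0 t; first by move=> ?; right; apply/orP; right; lra.
by rewrite h1 h2 h3 h4 in h.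
Unshelve. all: by end_near. Qed.

Let Pr_rect (a' b' c' e' : R) :
  Pr (fun z => \1_(`]a', b'[%classic `*` `]c', e'[%classic) z * \1_Om z).
Proof.
apply: (@Pr_lim (fun n => tensor (bump_trunc a b a' b' n) (bump_trunc c e c' e' n)) _ 1).
- by move=> n; apply: tensor_bm; exact: bump_bm.
- move=> n x; rewrite /tensor normrM !ger0_norm ?bump_ge0//.
  by apply: mulr_ile1; rewrite ?bump_ge0 ?bump_le1.
- move=> x; rewrite !indicX mulrACA; apply: cvgM; exact: bump_trunc_cvg.
move=> n; apply: Pr_tensor; try exact: bump_smooth; try exact: bump_bm.
- exists (Num.max a' (a + n.+1%:R^-1)), (Num.min b' (b - n.+1%:R^-1)); split.
  + by rewrite lt_max ltrDl invr_gt0 ltr0Sn orbT.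
  + by rewrite gt_min ltrBlDr ltrDl invr_gt0 ltr0Sn orbT.
  + by move=> t; apply: bump_out.
- exists (Num.max c' (c + n.+1%:R^-1)), (Num.min e' (e - n.+1%:R^-1)); split.
  + by rewrite lt_max ltrDl invr_gt0 ltr0Sn orbT.
  + by rewrite gt_min ltrBlDr ltrDl invr_gt0 ltr0Sn orbT.
  + by move=> t; apply: bump_out.
Qed.

(** The indicator of [Om] reflects the test functions available: limits of tensors supported in [Om]
    vanish outside it. *)
Let Pr_bm H : bm H -> Pr (fun z => H z * \1_Om z).
Proof.
have bOm := bm_indic R mOm.
apply: (@bm_plane_ind R (fun H => Pr (fun z => H z * \1_Om z)) Pr_rect).
- move=> k {}H G bH bG PH PG.
  have := Pr_lin k (bmM bH bOm) (bmM bG bOm) PH PG.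
  by under eq_fun do rewrite mulrA -mulrDl.
- move=> H_ {}H L bH HL HH PH.
  apply: (@Pr_lim (fun n z => H_ n z * \1_Om z) _ L) => //.
  + by move=> n; exact: bmM.
  + move=> n x; rewrite normrM -[leRHS]mulr1 ler_pM//.
    by rewrite indicE; case: (_ \in _) => /=; rewrite ?normr1 ?normr0.
  + by move=> x; apply: cvgMl; exact: HH.
Qed.

Lemma bv_estimate_aux : exists2 C : R, 0 <= C & forall (H : plane -> R) (M : R), bm H ->
  (forall s r, c < r < e -> `|prim a b H s r| <= M) ->
  `|Sm (fun x => H (p1 x, p2 x))| <= C * M.
Proof.
pose Nm := fine (mp D) + fine (mm D); pose Nn := fine (np D) + fine (nm D).
have Nm0 : 0 <= Nm by rewrite addr_ge0// fine_ge0.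
have Nn0 : 0 <= Nn by rewrite addr_ge0// fine_ge0.
(* From [K Sm G = Sm h - Sn (Psi G)] below, where on [D] one has [|h| <= M] and
   [|Psi G| <= 2 K M]. *)
exists ((Nm + 2 * K * Nn) / K).
  by rewrite divr_ge0 ?(ltW K_gt0)// addr_ge0// !mulr_ge0// ltW// K_gt0.
move=> H M bH HM.
pose G z := H z * \1_Om z.
have bG : bm G by apply: bmM => //; exact: bm_indic.
have GH s r : c < r < e -> a < s < b -> G (s, r) = H (s, r).
  move=> cre asb; rewrite /G indicE mem_set ?mulr1//.
have GM s r : c < r < e -> `|prim a b G s r| <= M.
  move=> cre; rewrite (_ : prim a b G s r = prim a b H s r) ?HM//.
  by apply: prim_eq => s' ?; exact: GH.
have [r0 r0P] : exists r, c < r < e by exists ((c + e) / 2); move: ce => ?; apply/andP; split; lra.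
have M0 : 0 <= M := le_trans (normr_ge0 _) (GM a r0 r0P).
have -> : Sm (fun x => H (p1 x, p2 x)) = Sm (fun x => G (p1 x, p2 x)).
  by apply: eq_sintegral2 => x /Dp[? ?]; rewrite GH.
have bG' : bm (fun x => G (p1 x, p2 x)) by exact: bm_comp2.
pose h x := prim a b G b (p2 x) * B (p1 x).
have bh : bm h.
  apply: bmM; last exact: bm_comp.
  exact: (@bm_comp2 _ (cst b) p2 (measurable_cst _) mp2 (bm_prim a b bG)).
have PG : Pr G by exact: Pr_bm.
have key : K * Sm (fun x => G (p1 x, p2 x)) = - Sn (Psi G) + Sm h.
  rewrite -PG -sintegral2Z// -sintegral2D//; last exact: bm_Phi.
  by congr sintegral2; apply/funext => x; rewrite /Phi /h subrK.
have h1 : `|Sn (Psi G)| <= (K * M + K * M) * Nn.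
  apply: sintegral2_le => //; first exact: bm_Psi.
  move=> x /Dp[_ ?]; rewrite (le_trans (ler_normB _ _))// !normrM lerD//.
    by rewrite gtr0_norm// ler_pM2l// GM.
  rewrite ler_pM// ?GM//.
  by have /andP[g1 g2] := prim1_le (p1 x); rewrite ger0_norm.
have h2 : `|Sm h| <= M * Nm.
  apply: sintegral2_le => // x /Dp[_ ?]; by rewrite normrM -[leRHS]mulr1 ler_pM ?GM.
rewrite mulrAC ler_pdivlMr//.
have -> : `|Sm (fun x => G (p1 x, p2 x))| * K = `|K * Sm (fun x => G (p1 x, p2 x))|.
  by rewrite normrM gtr0_norm// mulrC.
rewrite key (le_trans (ler_normD _ _))// normrN (le_trans (lerD h1 h2))//.
by rewrite le_eqVlt; apply/orP; left; apply/eqP; ring.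
Qed.

End bv_estimate.

(* Subtracting from [H] a multiple of a fixed bump makes its primitive in the
   first variable vanish at both ends, so that the primitive is an admissible
   test function even though [H] is not compactly supported. *)
Lemma bv_estimate d (T : measurableType d) (R : realType) (p1 p2 : T -> R) (a b c e : R)
    (D : set T) (mp mm np nm : {finite_measure set T -> \bar R}) :
  measurable_fun [set: T] p1 -> measurable_fun [set: T] p2 -> a < b -> c < e -> measurable D ->
  (forall x, D x -> a < p1 x < b /\ c < p2 x < e) ->
  (forall f f' g : R -> R, smooth1 f -> smooth1 f' ->
    (forall x : R, is_derive x 1 f (f' x)) -> smooth1 g ->
    supp_in a b f -> supp_in c e g ->
    sintegral2 mp mm D (fun x => f' (p1 x) * g (p2 x)) =
      - sintegral2 np nm D (fun x => f (p1 x) * g (p2 x))) ->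
  exists2 C : R, 0 <= C & forall (H : R * R -> R) (M : R), bm H ->
    (forall s r, c < r < e -> `|prim a b H s r| <= M) ->
    `|sintegral2 mp mm D (fun x => H (p1 x, p2 x))| <= C * M.
Proof.
move=> mp1 mp2 ab ce mD Dp ibp.
apply: (@bv_estimate_aux _ _ _ p1 p2 mp1 mp2 a b c e D ce mD Dp mp mm np nm ibp
  (bump 1 ((2 * a + b) / 3) ((a + 2 * b) / 3))).
- exact: bump_smooth.
- exact: bump_bm.
- by move=> t; rewrite bump_ge0 bump_le1.
- by exists ((2 * a + b) / 3), ((a + 2 * b) / 3); split; [lra|lra|move=> t; exact: bump_out].
- exact: prim_bump_gt0.
Qed.

(** * Extension by reflection *)

Section folding.
Variables (R : realType) (a b : R).
Hypothesis ab : a < b.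
Notation h := (b - a).

Let h2_gt0 : 0 < 2 * h. Proof. by move: ab => ?; lra. Qed.

(* [fold1 a b t - a] is the distance from [t - a] to the lattice [2 h Z]. *)
Lemma fold1_le (t : R) (k : int) : fold1 a b t - a <= `|t - a - 2 * h * k%:~R|.
Proof.
rewrite /fold1; set m := Num.floor _.
have /andP[m1 m2] := real_floor_itv (num_real ((t - a) / (2 * h))).
rewrite -/m ler_pdivlMr// in m1.
rewrite -/m ltr_pdivrMr// intrD in m2.
have [km|mk] := leP k m.
  rewrite -(ler_int R) in km.
  have := ler_wpM2l (ltW h2_gt0) km.
  have := ler_norm (t - a - 2 * h * k%:~R).
  by case: ifP => + ? ?; lra.
rewrite -lezD1 -(ler_int R) intrD in mk.
have := ler_wpM2l (ltW h2_gt0) mk.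
have := lerNnormlW (lexx `|t - a - 2 * h * k%:~R|).
by case: ifP => + ? ?; lra.
Qed.

Lemma fold1_ex (t : R) : exists k : int, fold1 a b t - a = `|t - a - 2 * h * k%:~R|.
Proof.
rewrite /fold1; set m := Num.floor _.
have /andP[m1 m2] := real_floor_itv (num_real ((t - a) / (2 * h))).
rewrite -/m ler_pdivlMr// in m1.
rewrite -/m ltr_pdivrMr// intrD in m2.
case: ifP => s_h; [exists m; rewrite ger0_norm|exists (m + 1); rewrite intrD ler0_norm].
all: lra.
Qed.

Lemma fold1_itv (t : R) : a <= fold1 a b t <= b.
Proof.
have [k tk] := fold1_ex t; apply/andP; split.
  by rewrite -subr_ge0 tk.
rewrite /fold1; case: ifPn; rewrite -?ltNge => ?; lra.
Qed.

(** A distance function is 1-Lipschitz: compare both values at the lattice point nearest to one of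
    the two arguments. *)
Lemma fold1_lip (s t : R) : `|fold1 a b s - fold1 a b t| <= `|s - t|.
Proof.
have aux x y : fold1 a b x - fold1 a b y <= `|x - y|.
  have [k yk] := fold1_ex y; have xk := fold1_le x k.
  have := ler_normD (x - y) (y - a - 2 * h * k%:~R).
  rewrite (_ : x - y + _ = x - a - 2 * h * k%:~R); last by ring.
  by lra.
by rewrite ler_norml; have := aux s t; have := aux t s; rewrite (distrC t s) => ? ?; apply/andP; split; lra.
Qed.

Lemma measurable_fold1 : measurable_fun [set: R] (fold1 a b).
Proof.
apply: continuous_measurable_fun; apply: (@lip_continuous R _ 1) => s t.
by rewrite mul1r fold1_lip.
Qed.

(** The inverse branches of folding. At the fold values [a] and [b] a translation and a reflection
    both reach [t]; the translation is then chosen, so that the branch is unique. *)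
Lemma fold1_aff (t : R) : exists (s : bool) (k : int),
  t = aff1 s ((if s then 2 * a else 0) + 2 * h * k%:~R) (fold1 a b t) /\
  (s -> a < fold1 a b t < b).
Proof.
have [k tk] := fold1_ex t; have /andP[f1 f2] := fold1_itv t.
have [h0|h0] := leP 0 (t - a - 2 * h * k%:~R).
  by rewrite ger0_norm// in tk; exists false, k; split => //; rewrite /aff1; lra.
rewrite ltr0_norm// in tk.
have [fa|fa] := eqVneq (fold1 a b t) a.
  by exists false, k; split => //; rewrite /aff1; lra.
(* At the value [b], the reflection of index [k] agrees with the translation of index [k - 1]. *)
have [fb|fb] := eqVneq (fold1 a b t) b.
  by exists false, (k - 1); split => //; rewrite /aff1 intrB; lra.
exists true, k; split; first by rewrite /aff1; lra.
by rewrite !lt_neqAle f1 f2 fb eq_sym fa.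
Qed.

(** The lattice point [k] is at distance [t - a]; every other one is at distance at least
    [2 h - (t - a)], which is no smaller because [t - a <= h]. *)
Lemma fold1K (s : bool) (k : int) (t : R) : a <= t <= b ->
  fold1 a b (aff1 s ((if s then 2 * a else 0) + 2 * h * k%:~R) t) = t.
Proof.
move=> /andP[at' tb]; set y := aff1 _ _ _.
have yE : y - a - 2 * h * k%:~R = if s then - (t - a) else t - a.
  by rewrite /y /aff1; case: (s); ring.
have le1 := fold1_le y k; rewrite yE in le1.
have n1 : `|if s then - (t - a) else t - a| = t - a.
  by case: (s); rewrite ?normrN ger0_norm// subr_ge0.
rewrite n1 in le1.
have [j yj] := fold1_ex y.
suff : t - a <= `|y - a - 2 * h * j%:~R| by move: yj le1; lra.
have -> : y - a - 2 * h * j%:~R = (if s then - (t - a) else t - a) + 2 * h * (k - j)%:~R.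
  by rewrite -yE intrD intrN; ring.
have [->|kj] := eqVneq (k - j) 0; first by rewrite mulr0 addr0 n1.
have : 1 <= `|(k - j)%:~R : R|.
  by rewrite -intr_norm (ler_int R 1) -gtz0_ge1 normr_gt0.
move=> /(ler_wpM2l (ltW h2_gt0)).
have := lerB_normD (2 * h * (k - j)%:~R) (if s then - (t - a) else t - a).
rewrite n1 normrM (gtr0_norm h2_gt0) [_ + 2 * h * _]addrC.
move: (2 * h * `| _ |) (`| _ + _|) at' tb => u v *; lra.
Qed.


(* [aff1 p.1 (lat p)], for [p] ranging over all pairs as [n] grows, are the
   elements of the group generated by the reflections in the endpoints. *)
Definition lat (n : nat) (p : bool * 'I_(n.*2.+1)) : R :=
  (if p.1 then 2 * a else 0) + 2 * h * (p.2%:Z - n%:Z)%:~R.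

Lemma fold1_lat (M : R) : exists n : nat, forall t : R, `|t| <= M ->
  exists p : bool * 'I_(n.*2.+1), t = aff1 p.1 (lat p) (fold1 a b t) /\
    (p.1 -> a < fold1 a b t < b).
Proof.
(* Solving for the lattice shift [2 h k] bounds it by [|t| + 2 |a|] plus the folded value, itself at
   most [|a| + |b|]. *)
pose B := (M + 2 * `|a| + `|a| + `|b|) / (2 * h).
exists (Num.truncn B).+1 => t tM; set n := (Num.truncn B).+1.
have Bn : B < n%:R by exact: Num.Theory.truncnS_gt.
rewrite ltr_pdivrMr// in Bn.
have [s [k [tk sk]]] := fold1_aff t.
have /andP[f1 f2] := fold1_itv t.
have kn : `|k| <= n%:Z.
  rewrite -(ler_int R) intr_norm -(ler_pM2l h2_gt0) -{1}(gtr0_norm h2_gt0) -normrM.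
  have -> : 2 * h * k%:~R = (if s then t + fold1 a b t - 2 * a else t - fold1 a b t).
    by rewrite {1 3}tk /aff1; case: (s); ring.
  rewrite -pmulrn [2 * h * _]mulrC; apply: le_trans (ltW Bn).
  have := ler_norm (- a); have := ler_norm b; rewrite normrN => hb ha.
  have fa : `|fold1 a b t| <= `|a| + `|b|.
    by rewrite ler_norml; have := normr_ge0 a; have := normr_ge0 b => *; apply/andP; split; lra.
  have := normr_ge0 a; case: (s) => ?.
    have := ler_normB (t + fold1 a b t) (2 * a); have := ler_normD t (fold1 a b t).
    by rewrite normrM (ger0_norm (ler0n _ 2)); lra.
  by have := ler_normB t (fold1 a b t); lra.
have kn' : (absz (k + n%:Z)%R < n.*2.+1)%N by move: kn; clear; lia.
exists (s, Ordinal kn'); split => //; rewrite /lat/=.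
have -> // : (absz (k + n%:Z)%R)%:Z - n%:Z = k by move: kn; clear; lia.
Qed.

Lemma fold1_latK (n : nat) (p : bool * 'I_(n.*2.+1)) (t : R) : a <= t <= b ->
  fold1 a b (aff1 p.1 (lat p) t) = t.
Proof. exact: fold1K. Qed.

(** Distinct branches of equal orientation differ by a nonzero lattice shift. Branches of opposite
    orientation meet at [t] only if [2 (t - a)] is a multiple of [2 h], which is excluded for [t] in
    the open interval. *)
Lemma aff1_inj_lat (n : nat) (p q : bool * 'I_(n.*2.+1)) (t : R) :
  (if p.1 then a < t < b else a <= t <= b) -> (if q.1 then a < t < b else a <= t <= b) ->
  aff1 p.1 (lat p) t = aff1 q.1 (lat q) t -> p = q.
Proof.
have int_inj (i j : 'I_(n.*2.+1)) : 2 * h * (i%:Z - n%:Z)%:~R = 2 * h * (j%:Z - n%:Z)%:~R -> i = j.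
  move=> /(mulfI (lt0r_neq0 h2_gt0)) /intr_inj ij; apply: val_inj => /=; move: ij; clear; lia.
have neq (i j : 'I_(n.*2.+1)) (x : R) : 0 < x < 2 * h ->
    x + 2 * h * (i%:Z - n%:Z)%:~R <> 2 * h * (j%:Z - n%:Z)%:~R.
  move=> /andP[x0 x1] xij.
  have E : x = 2 * h * (j%:Z - i%:Z)%:~R by move: xij; rewrite !intrB => xij; lra.
  rewrite E pmulr_rgt0// ltr0z in x0.
  rewrite E -[ltRHS]mulr1 ltr_pM2l// (ltr_int R _ 1) in x1.
  by move: x0 x1; clear; lia.
case: p => -[] i; case: q => -[] j /=; rewrite /aff1/lat/=.
- by move=> _ _ /addrI/addrI/int_inj ->.
- move=> /andP[t1 t2] _ E; exfalso; apply: (@neq j i (2 * (t - a))); last by lra.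
  by apply/andP; split; lra.
- move=> _ /andP[t1 t2] E; exfalso; apply: (@neq i j (2 * (t - a))); last by lra.
  by apply/andP; split; lra.
- by move=> _ _ /addrI; rewrite !add0r => /int_inj ->.
Qed.

End folding.

Lemma aff1K (R : realType) (s : bool) (c : R) : cancel (aff1 s c) (aff1 s (if s then c else - c)).
Proof. by move=> t; rewrite /aff1; case: s; ring. Qed.

Section reflection.
Variables (R : realType) (t : rect R).
Notation plane := (R * R)%type.
Notation leb2 := (@leb2 R).

Let xab := rect_ab t.
Let ycd := rect_cd t.

Lemma measurable_rfold : measurable_fun [set: plane] (rfold t).
Proof.
apply: measurable_fun_pair.
  exact: measurableT_comp (measurable_fold1 xab) (@measurable_fst _ _ _ _).
exact: measurableT_comp (measurable_fold1 ycd) (@measurable_snd _ _ _ _).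
Qed.

Lemma rect_cl_box : exists M : R, rect_cl t `<=` box M.
Proof.
exists (`|rxa t| + `|rxb t| + (`|ryc t| + `|ryd t|)) => x [/andP[h1 h2] /andP[h3 h4]].
have := ler_norm (rxb t); have := ler_norm (ryd t).
have := ler_norm (- rxa t); have := ler_norm (- ryc t); rewrite !normrN => *.
have := (normr_ge0 (rxa t), normr_ge0 (ryc t), normr_ge0 (rxb t), normr_ge0 (ryd t)) => -[[[? ?] ?] ?].
by split; rewrite ler_norml; apply/andP; split; lra.
Qed.

(** At each point of [box M] folding is the inverse of one of finitely many isometries. Summing over
    all of them bounds the integral, with [N] their number; folded points stay in the closed
    rectangle, inside [box M']. *)
Lemma ge0_int_rfold (M : R) : exists N : nat, exists M' : R, forall g : plane -> \bar R,
  measurable_fun [set: plane] g -> (forall x, 0 <= g x)%E ->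
  (\int[leb2]_(x in box M) g (rfold t x) <= N%:R%:E * \int[leb2]_(x in box M') g x)%E.
Proof.
have [n1 P1] := fold1_lat xab M; have [n2 P2] := fold1_lat ycd M.
have [M' clM'] := rect_cl_box.
pose I := ((bool * 'I_(n1.*2.+1)) * (bool * 'I_(n2.*2.+1)))%type.
pose c (n : nat) (a b : R) (p : bool * 'I_(n.*2.+1)) := if p.1 then lat a b p else - lat a b p.
pose A (i : I) x := aff2 i.1.1 (c _ (rxa t) (rxb t) i.1) i.2.1 (c _ (ryc t) (ryd t) i.2) x.
exists #|{: I}|, M' => g mg g0.
pose G x := (g x * (\1_(box M') x)%:E)%E.
have mG : measurable_fun [set: plane] G.
  apply: emeasurable_funM => //; apply/measurable_EFinP.
  exact: (bm_indic R (measurable_box M')).1.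
have G0 x : (0 <= G x)%E by rewrite mule_ge0// lee_fin indicE.
have mGA i : measurable_fun [set: plane] (fun x => G (A i x)).
  by apply: measurableT_comp mG _; exact: measurable_aff2.
apply: (@le_trans _ _ (\int[leb2]_(x in box M) \sum_(i : I) G (A i x))%E).
  apply: ge0_le_integral => //.
  - exact: measurable_box.
  - have mgr := measurableT_comp mg measurable_rfold.
    exact: measurable_funTS.
  - have ms : measurable_fun [set: plane] (fun x => \sum_(i : I) G (A i x))%E.
      exact: emeasurable_sum.
    exact: measurable_funTS.
  - move=> x [x1 x2].
    have [p [p1 _]] := P1 _ x1; have [q [q1 _]] := P2 _ x2.
    have AE : A (p, q) x = rfold t x.
      rewrite /A/aff2/rfold/= /c; congr pair.
        by rewrite [in LHS]p1 aff1K.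
      by rewrite [in LHS]q1 aff1K.
    rewrite (bigD1 (p, q))//= -[leLHS]adde0 leeD//; last exact: sume_ge0.
    rewrite AE /G indicE mem_set ?mule1//; apply: clM'.
    by split; exact: fold1_itv.
apply: (@le_trans _ _ (\int[leb2]_x \sum_(i : I) G (A i x))%E).
  apply: ge0_subset_integral => //; first exact: measurable_box.
  - have ms : measurable_fun [set: plane] (fun x => \sum_(i : I) G (A i x))%E.
      exact: emeasurable_sum.
    exact: ms.
  - by move=> x _; exact: sume_ge0.
rewrite ge0_integral_sum//.
have E i : (\int[leb2]_x G (A i x) = \int[leb2]_(x in box M') g x)%E.
  rewrite [LHS](ge0_int_aff2 _ _ _ _ mG)//.
  rewrite [RHS]integral_mkcond; apply: eq_integral => x _.
  by rewrite /G patchE indicE; case: (x \in box M'); rewrite ?mule1 ?mule0.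
under eq_bigr do rewrite E.
have := integral_ge0 leb2 (fun x (_ : box M' x) => g0 x).
move: (\int[leb2]_(x in box M') g x)%E => y y0.
rewrite big_const; elim: #|_| => [|k IH] /=; first by rewrite mul0e.
by rewrite -natr1 EFinD ge0_muleDl ?lee_fin// mul1e addeC leeD.
Qed.

Lemma L2loc_reflF f : L2loc f -> L2loc (reflF t f).
Proof.
move=> [mf Lf]; split; first exact: measurableT_comp mf measurable_rfold.
move=> M; have [N [M' le]] := ge0_int_rfold M.
have [B B0 fB] := Lf M'.
exists (N%:R * B); first by rewrite mulr_ge0.
apply: le_trans (le (fun x => (f x ^+ 2)%:E) _ _) _.
- exact: measurable_sqr.
- by move=> x; rewrite lee_fin sqr_ge0.
- by rewrite EFinM lee_wpmul2l// lee_fin.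
Qed.


Lemma measurable_along e : measurable_fun [set: plane * R] (fun q => q.1 + q.2 *: e : plane).
Proof.
apply: measurable_fun_pair => /=.
  apply: measurable_funD.
    exact: measurableT_comp (@measurable_fst _ _ _ _) (@measurable_fst _ _ _ _).
  by apply: measurable_funM => //; exact: measurable_snd.
apply: measurable_funD.
  exact: measurableT_comp (@measurable_snd _ _ _ _) (@measurable_fst _ _ _ _).
by apply: measurable_funM => //; exact: measurable_snd.
Qed.

(* A fixed increment of [f] is compared with its increments averaged over the
   segment, which reduces the nonlinear folding to the change of variables above. *)
Lemma Pdiff_reflF (e : plane) f : `|e.1| <= 1 -> `|e.2| <= 1 ->
  (forall x (h : R), exists2 s : R, `|s| <= `|h| & rfold t (x + h *: e) = rfold t x + s *: e) ->
  L2loc f -> Pdiff e f -> Pdiff e (reflF t f).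
Proof.
move=> n1 n2 He [mf Lf] Df M.
have [N [M' le]] := ge0_int_rfold (M + M).
(* One radius for the domain, [M'], and for the steps, which reach [2 |h|]. *)
pose M2 := Num.max M' (2 * M).
have [C C0 fC] := Df M2.
(* The factor [4 N] comes from comparison with the average, and [16 C |h| h^2] from an interval of
   length [4 |h|] of steps of size at most [2 |h|]. *)
exists (64 * N%:R * C); first by rewrite !mulr_ge0.
move=> h hM.
have [->|h0] := eqVneq h 0.
  rewrite (_ : (fun x => _) = cst 0); last by apply/funext => x; rewrite scale0r addr0 subrr.
  by rewrite /sqint integral0_eq ?expr0n ?mulr0// => x _ /=; rewrite expr0n.
have nh0 : 0 < `|h| by rewrite normr_gt0.
pose J : set R := `[- (2 * `|h|), 2 * `|h|]%classic.
have mJ : measurable J by exact: measurable_itv.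
pose F (q : plane * R) := ((f (q.1 + q.2 *: e) - f q.1) ^+ 2)%R.
have mF : measurable_fun [set: plane * R] F.
  apply: measurable_funX; apply: measurable_funB.
    exact: measurableT_comp mf (measurable_along e).
  exact: measurableT_comp mf (@measurable_fst _ _ _ _).
pose Fi (q : plane * R) : \bar R := (F q * \1_J q.2)%:E.
have mFi : measurable_fun [set: plane * R] Fi.
  apply/measurable_EFinP; apply: measurable_funM => //.
  exact: measurableT_comp (bm_indic R mJ).1 (@measurable_snd _ _ _ _).
have Fi0 q : (0 <= Fi q)%E by rewrite lee_fin mulr_ge0 ?sqr_ge0// indicE.
pose Phi p := (\int[@lebesgue_measure R]_s Fi (p, s))%E.
have mPhi : measurable_fun [set: plane] Phi.
  exact: (@measurable_fun_fubini_tonelli_F _ _ _ _ _ (@lebesgue_measure R) Fi mFi Fi0).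
have Phi0 p : (0 <= Phi p)%E by exact: integral_ge0.
pose u := reflF t f.
have mu : measurable_fun [set: plane] u by exact: measurableT_comp mf measurable_rfold.
have mshift (g : plane -> R) : measurable_fun [set: plane] g ->
    measurable_fun [set: plane] (fun x => g (x + h *: e)) by exact: measurable_comp_shift.
pose d x := u (x + h *: e) - u x.
have md : measurable_fun [set: plane] d by apply: measurable_funB; [exact: mshift|].
pose Q x := Phi (rfold t x).
have mQ : measurable_fun [set: plane] Q by exact: measurableT_comp mPhi measurable_rfold.
have Q0 x : (0 <= Q x)%E by exact: Phi0.
have mQh : measurable_fun [set: plane] (fun x => Q (x + h *: e)) by exact: measurable_comp_shift.
pose J0 : set R := `[0, `|h|]%classic.
have mJ0 : measurable J0 by exact: measurable_itv.
(* With [q = p + s e] and [0 <= r <= |h|], both [f q] and [f p] are compared with [f (p + r e)];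
   seen from [q] this is the step [r - s], of size at most [2 |h|], whence the interval [J]. *)
have pw x : ((`|h| * d x ^+ 2)%:E <= 2%:E * (Q (x + h *: e)%R + Q x))%E.
  have [s sh rs] := He x h.
  rewrite /d /u /reflF /Q rs; set p := rfold t x; set q := p + s *: e.
  pose v (r : R) := (2%:E * (Fi (q, aff1 false (- s) r) + Fi (p, r)))%E.
  have mFip p0 : measurable_fun [set: R] (fun r => Fi (p0, r)) by exact: measurableT_comp mFi _.
  have mq : measurable_fun [set: R] (fun r => Fi (q, aff1 false (- s) r)).
    by apply: measurableT_comp (mFip q) _; exact: measurable_aff1.
  have mqp : measurable_fun [set: R] (fun r => (Fi (q, aff1 false (- s) r) + Fi (p, r))%E).
    by apply: emeasurable_funD; [exact: mq|exact: mFip].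
  have mv : measurable_fun [set: R] v by apply: emeasurable_funM.
  have -> : (2%:E * (Phi q + Phi p) = \int[@lebesgue_measure R]_r v r)%E.
    rewrite /v (@ge0_integralZl _ _ _ (@lebesgue_measure R) setT measurableT _ mqp 2%:E)//; last first.
      by move=> r _; exact: adde_ge0.
    rewrite (@ge0_integralD _ _ _ (@lebesgue_measure R) setT measurableT _ _
      (fun r _ => Fi0 (q, aff1 false (- s) r)) mq (fun r _ => Fi0 (p, r)) (mFip p)).
    by rewrite (ge0_int_aff1 false (- s) (mFip q)).
  have -> : ((`|h| * (f q - f p) ^+ 2)%:E =
      \int[@lebesgue_measure R]_(r in J0) ((f q - f p) ^+ 2)%:E)%E.
    transitivity (((f q - f p) ^+ 2)%:E * @lebesgue_measure R J0)%E; last exact/esym/integral_cst.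
    by rewrite /J0 lam_cc// subr0 -EFinM mulrC.
  apply: (@le_trans _ _ (\int[@lebesgue_measure R]_(r in J0) v r)%E); last first.
    by apply: ge0_subset_integral => // r _; rewrite /v mule_ge0// adde_ge0.
  apply: ge0_le_integral => //.
  - by move=> r _; rewrite lee_fin sqr_ge0.
  - exact: measurable_funTS.
  move=> r; rewrite /J0/= in_itv/= => /andP[r0 rh].
  have r1 : J r by rewrite /J/= in_itv/=; apply/andP; split; lra.
  have r2 : J (r - s).
    have := ler_norm s; have := ler_norm (- s); rewrite normrN => *.
    by rewrite /J/= in_itv/=; apply/andP; split; lra.
  rewrite /v /Fi /= !indicE !mem_set// !mulr1 -EFinD -EFinM lee_fin /F/=.
  have -> : q + aff1 false (- s) r *: e = p + r *: e.
    by rewrite /q /aff1 scalerDl scaleNr [r *: e + _]addrC addrA addrK.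
  have := sqr_ge0 ((f (p + r *: e) - f q) + (f (p + r *: e) - f p)).
  by move: (f _) (f q) (f p) => A B D; nra.
have step : (`|h|%:E * sqint (box M) d <= (4 * N%:R)%:E * \int[leb2]_(x in box M') Phi x)%E.
  apply: (@le_trans _ _ (\int[leb2]_(x in box M) (2%:E * (Q (x + h *: e)%R + Q x)))%E).
    have mdd : measurable_fun (box M) (fun x => (d x ^+ 2)%:E) by apply: measurable_sqr; exact: measurable_funTS.
    rewrite /sqint -(@ge0_integralZl _ _ _ leb2 _ (measurable_box M) _ mdd `|h|%:E)//; last first.
      by move=> x _; rewrite lee_fin sqr_ge0.
    apply: ge0_le_integral => //.
    - exact: measurable_box.
    - by move=> x _; rewrite mule_ge0// lee_fin sqr_ge0.
    - have mm : measurable_fun (box M) (fun x => `|h|%:E * (d x ^+ 2)%:E)%E by exact: emeasurable_funM.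
      exact: mm.
    - have mm : measurable_fun [set: plane] (fun x => 2%:E * (Q (x + h *: e)%R + Q x))%E.
        by apply: emeasurable_funM => //; exact: emeasurable_funD.
      exact: measurable_funTS.
    - by move=> x _; rewrite -EFinM; exact: pw.
  have mQ1 : measurable_fun (box M) Q by exact: measurable_funTS.
  have mQ2 : measurable_fun (box M) (fun x => Q (x + h *: e)) by exact: measurable_funTS.
  have mQ3 : measurable_fun (box M) (fun x => (Q (x + h *: e)%R + Q x)%E) by exact: emeasurable_funD.
  rewrite (@ge0_integralZl _ _ _ leb2 _ (measurable_box M) _ mQ3 2%:E)//; last first.
    by move=> x _; exact: adde_ge0.
  rewrite (@ge0_integralD _ _ _ leb2 _ (measurable_box M) _ _
    (fun x _ => Q0 (x + h *: e)) mQ2 (fun x _ => Q0 x) mQ1).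
  have boxh : box M (h *: e).
    by split; rewrite /= normrM; rewrite (le_trans _ hM)// ler_piMr.
  have le1 := ge0_int_box_shift M boxh mQ Q0.
  have le2 : (\int[leb2]_(x in box M) Q x <= \int[leb2]_(x in box (M + M)) Q x)%E.
    apply: ge0_subset_integral => //; try exact: measurable_box.
      exact: measurable_funTS.
    by move=> x; apply: boxW; have := le_trans (normr_ge0 _) hM => ?; lra.
  have le3 := le Phi mPhi Phi0.
  have le4 := le_trans le1 le3; have le5 := le_trans le2 le3.
  rewrite (_ : (4 * N%:R = 2 * (N%:R + N%:R) :> R)%R); last by ring.
  rewrite EFinM -muleA lee_wpmul2l// EFinD ge0_muleDl ?lee_fin//.
  exact: (leeD le4 le5).
have fub : (\int[leb2]_(x in box M') Phi x <= (16 * C * `|h| * h ^+ 2)%:E)%E.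
  pose G (q : plane * R) : \bar R := (Fi q * (\1_(box M') q.1)%:E)%E.
  have mG : measurable_fun [set: plane * R] G.
    apply: emeasurable_funM => //; apply/measurable_EFinP.
    exact: measurableT_comp (bm_indic R (measurable_box M')).1 (@measurable_fst _ _ _ _).
  have G0 q : (0 <= G q)%E by rewrite mule_ge0// lee_fin indicE.
  have -> : (\int[leb2]_(x in box M') Phi x = \int[leb2]_x \int[@lebesgue_measure R]_s G (x, s))%E.
    rewrite integral_mkcond; apply: eq_integral => x _.
    rewrite patchE /G/= indicE; case: ifPn => xb; last first.
      by rewrite integral0_eq// => s _; rewrite mule0.
    by rewrite /Phi; apply: eq_integral => s _; rewrite mule1.
  rewrite (@fubini_tonelli _ _ _ _ _ leb2 (@lebesgue_measure R) G mG G0).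
  apply: (@le_trans _ _ (\int[@lebesgue_measure R]_(s in J) (C * (2 * h) ^+ 2)%:E)%E); last first.
    apply: (@le_trans _ _ ((C * (2 * h) ^+ 2)%:E * @lebesgue_measure R J)%E); first by rewrite -integral_cst.
    rewrite /J lam_cc; last by move: nh0 => ?; lra.
    rewrite -EFinM lee_fin; move: (`|h|) => r.
    by rewrite le_eqVlt; apply/orP; left; apply/eqP; ring.
  rewrite [leRHS]integral_mkcond; apply: ge0_le_integral => //.
  - by move=> s _; exact: integral_ge0.
  - exact: (@measurable_fun_fubini_tonelli_G _ _ _ _ _ leb2 G mG G0).
  - have mc : measurable_fun J (fun=> (C * (2 * h) ^+ 2)%:E : \bar R) by exact: measurable_cst.
    by apply/(measurable_restrictT _ mJ).
  move=> s _; rewrite patchE /G /Fi/=; case: ifPn => sJ; last first.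
    by rewrite indicE (negbTE sJ) integral0_eq// => x _; rewrite mulr0 mul0e.
  have sh : `|s| <= 2 * `|h| by move: sJ; rewrite mem_setE in_itv/= -ler_norml.
  have sM : `|s| <= M2 by rewrite (le_trans sh)// le_max ler_pM2l// hM orbT.
  rewrite indicE sJ.
  have -> : (\int[leb2]_x ((F (x, s) * true%:R)%:E * (\1_(box M') x)%:E) =
      sqint (box M') (fun x => f (x + s *: e) - f x)%R)%E.
    rewrite /sqint [RHS]integral_mkcond; apply: eq_integral => x _.
    by rewrite patchE indicE mulr1; case: (x \in box M'); rewrite ?mule1 ?mule0.
  apply: (@le_trans _ _ (C * s ^+ 2)%:E).
    apply: le_trans (fC s sM); apply: sqintS; try exact: measurable_box.
      apply: measurable_funTS; apply: measurable_funB => //.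
      exact: measurable_comp_shift.
    by move=> x; apply: boxW; rewrite le_max lexx.
  rewrite lee_fin ler_wpM2l// -(real_normK (num_real s)) exprMn -(real_normK (num_real h)) -exprMn.
  by rewrite lerXn2r ?nnegrE ?mulr_ge0.
have N4 : 0 <= 4 * N%:R :> R by rewrite mulr_ge0.
have N4E : (0 <= (4 * N%:R)%:E :> \bar R)%E by rewrite lee_fin.
have := le_trans step (lee_wpmul2l N4E fub).
rewrite -EFinM (_ : 4 * N%:R * (16 * C * `|h| * h ^+ 2) = `|h| * (64 * N%:R * C * h ^+ 2)); last by ring.
by rewrite EFinM lee_pmul2l// lte_fin.
Qed.

Lemma Pdiff_reflF1 f : L2loc f -> Pdiff (e1 R) f -> Pdiff (e1 R) (reflF t f).
Proof.
apply: Pdiff_reflF; rewrite ?normr1 ?normr0//.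
move=> [x y] h; exists (fold1 (rxa t) (rxb t) (x + h) - fold1 (rxa t) (rxb t) x).
  by rewrite (le_trans (fold1_lip xab _ _))// addrC addKr.
rewrite /rfold; congr pair => /=.
  have A1 (r : R) : r%:A = r :> R by exact: mulr1.
  by rewrite !A1 [RHS]addrC subrK.
have A0 (r : R) : r *: 0 = 0 :> R by exact: mulr0.
  by rewrite !A0 !addr0.
Qed.

Lemma Pdiff_reflF2 f : L2loc f -> Pdiff (e2 R) f -> Pdiff (e2 R) (reflF t f).
Proof.
apply: Pdiff_reflF; rewrite ?normr1 ?normr0//.
move=> [x y] h; exists (fold1 (ryc t) (ryd t) (y + h) - fold1 (ryc t) (ryd t) y).
  by rewrite (le_trans (fold1_lip ycd _ _))// addrC addKr.
rewrite /rfold; congr pair => /=.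
  have A0 (r : R) : r *: 0 = 0 :> R by exact: mulr0.
  by rewrite !A0 !addr0.
have A1 (r : R) : r%:A = r :> R by exact: mulr1.
  by rewrite !A1 [RHS]addrC subrK.
Qed.

End reflection.

(** * The first layer *)

Section parametric_mean.
Variable R : realType.
Notation plane := (R * R)%type.
Notation leb2 := (@leb2 R).
Variables (m : {finite_measure set plane -> \bar R}) (G : plane * plane -> R) (B : R).
Hypothesis mG : measurable_fun [set: plane * plane] G.
Hypothesis B0 : 0 <= B.
Hypothesis GB : forall z, (sqint setT (fun x => G (x, z)) <= B%:E)%E.

Definition mean x : R := fine (\int[m]_z (G (x, z))%:E)%E.

Let V := fine (m setT).
Let V0 : 0 <= V. Proof. exact: fine_ge0. Qed.
Let mV : m setT = V%:E. Proof. by rewrite fineK// fin_num_measure. Qed.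

Let int_cstm (c : R) : (\int[m]_z (cst c%:E z) = (c * V)%:E)%E.
Proof. by rewrite integral_cst// EFinM; congr (_ * _)%E; exact: mV. Qed.

Let mGr x : measurable_fun [set: plane] (fun z => G (x, z)).
Proof. exact: measurableT_comp mG _. Qed.

Let mGl z : measurable_fun [set: plane] (fun x => G (x, z)).
Proof. by apply: (measurableT_comp mG); exact: measurable_pair2. Qed.

Let mG2 : measurable_fun [set: plane * plane] (fun q => (G q ^+ 2)%:E : \bar R).
Proof. by apply/measurable_EFinP; exact: measurable_funX. Qed.

Lemma measurable_mean : measurable_fun [set: plane] mean.
Proof. exact: (@measurable_fine_integral _ _ _ _ R m G mG). Qed.

Lemma mean_sqr_le x : ((mean x ^+ 2)%:E <= (V + 1)%:E * \int[m]_z (G (x, z) ^+ 2)%:E)%E.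
Proof.
have I0 : (0 <= \int[m]_z (G (x, z) ^+ 2)%:E)%E.
  by apply: integral_ge0 => z _; rewrite lee_fin sqr_ge0.
(* [V + 1] instead of the mass [V], which is [0] for the zero measure. *)
have V1 : 0 < V + 1 by rewrite ltr_wpDl.
have [Ify|Ify] := eqVneq (\int[m]_z (G (x, z) ^+ 2)%:E)%E +oo%E.
  by rewrite Ify gt0_muley ?lte_fin// leey.
have If : (\int[m]_z (G (x, z) ^+ 2)%:E)%E \is a fin_num by rewrite ge0_fin_numE// ltey.
rewrite -(fineK If) -EFinM lee_fin.
set A := fine _; have A0 : 0 <= A by exact: fine_ge0.
have m1 : (\int[m]_z ((cst 1 z : R) ^+ 2)%:E <= (V + 1)%:E)%E.
  rewrite (_ : (fun z => _) = cst 1%:E); last by apply/funext => z; rewrite /= expr1n.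
  by rewrite integral_cst// mul1e [leLHS]mV lee_fin lerDl.
have [int1 sq1] := @cauchy_schwarz _ _ R m setT (fun z => G (x, z)) (cst 1) A (V + 1) measurableT
  (mGr x) (measurable_cst _) A0 (ltW V1) (eq_ind_r (fun v => (v <= A%:E)%E) (lexx _) (esym (fineK If))) m1.
have E : (EFin \o (fun z => G (x, z) * cst 1 z)) = (EFin \o (fun z => G (x, z))).
  by apply/funext => z /=; rewrite mulr1.
rewrite E in int1.
rewrite mulrC (le_trans _ sq1)// -[leLHS]real_normK ?num_real// lerXn2r ?nnegrE//.
  by rewrite fine_ge0// integral_ge0.
rewrite /mean -fine_abse; last exact: integrable_fin_num int1.
have -> : (\int[m]_z `|G (x, z) * cst 1 z|%:E = \int[m]_z `| (G (x, z))%:E |)%E.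
  by apply: eq_integral => z _; rewrite /= mulr1.
apply: fine_le.
- by rewrite fin_num_abs abse_id -fin_num_abs; exact: integrable_fin_num int1.
- by have := integrable_abse int1 => /integrable_fin_num; apply.
- by apply: le_abse_integral => //; exact: measurable_int int1.
Qed.

Lemma L2loc_mean : L2loc mean.
Proof.
split; first exact: measurable_mean.
move=> M; exists ((V + 1) * (V * B)); first by rewrite !mulr_ge0// addr_ge0.
have mI : measurable_fun [set: plane] (fun x => \int[m]_z (G (x, z) ^+ 2)%:E)%E.
  apply: (@measurable_fun_fubini_tonelli_F _ _ _ _ R m (fun q => (G q ^+ 2)%:E) mG2).
  by move=> q; rewrite lee_fin sqr_ge0.
have I0 x : (0 <= \int[m]_z (G (x, z) ^+ 2)%:E)%E.
  by apply: integral_ge0 => z _; rewrite lee_fin sqr_ge0.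
have V1 : (0 <= (V + 1)%:E :> \bar R)%E by rewrite lee_fin addr_ge0.
apply: (@le_trans _ _ (sqint setT mean)).
  by apply: sqintS => //; [exact: measurable_box|exact: measurable_mean].
apply: (@le_trans _ _ (\int[leb2]_x ((V + 1)%:E * \int[m]_z (G (x, z) ^+ 2)%:E))%E).
  apply: ge0_le_integral => //.
  - by move=> x _; rewrite lee_fin sqr_ge0.
  - by have := measurable_sqr measurable_mean; apply.
  - have mm : measurable_fun [set: plane] (fun x => (V + 1)%:E * \int[m]_z (G (x, z) ^+ 2)%:E)%E.
      exact: emeasurable_funM.
    exact: mm.
  - by move=> x _; exact: mean_sqr_le.
rewrite (@ge0_integralZl _ _ _ leb2 _ measurableT _ mI (V + 1)%:E)//.
rewrite EFinM lee_wpmul2l//.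
rewrite (@fubini_tonelli _ _ _ _ R leb2 m (fun q => (G q ^+ 2)%:E) mG2); last first.
  by move=> q; rewrite lee_fin sqr_ge0.
apply: (@le_trans _ _ (\int[m]_z (cst B%:E z))%E).
  apply: ge0_le_integral => //.
  - by move=> z _; apply: integral_ge0 => x _; rewrite lee_fin sqr_ge0.
  - apply: (@measurable_fun_fubini_tonelli_G _ _ _ _ R leb2 (fun q => (G q ^+ 2)%:E) mG2).
    by move=> q; rewrite lee_fin sqr_ge0.
  - by move=> z _; exact: GB.
by rewrite int_cstm mulrC.
Qed.

Variables (theta : plane -> R) (M A : R).
Hypothesis mtheta : measurable_fun [set: plane] theta.
Hypothesis theta_out : forall x, ~ box M x -> theta x = 0.
Hypothesis A0 : 0 <= A.
Hypothesis thetaA : (sqint setT theta <= A%:E)%E.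

Let f (q : plane * plane) : \bar R := (theta q.1 * G q)%:E.

Let mf : measurable_fun [set: plane * plane] f.
Proof.
apply/measurable_EFinP; apply: measurable_funM => //.
exact: measurableT_comp mtheta (@measurable_fst _ _ _ _).
Qed.

Let pair z : leb2.-integrable setT (fun x => f (x, z)) /\
  (\int[leb2]_x `|f (x, z)| <= (A * B + 1)%:E)%E.
Proof.
have GB' : (sqint (box M) (fun x => G (x, z)) <= B%:E)%E.
  by apply: le_trans (GB z); apply: sqintS => //; exact: measurable_box.
have [int1 _] := pairing_le A0 B0 mtheta (mGl z) theta_out thetaA GB'.
split => //.
have aout x : ~ box M x -> `|theta x| = 0 by move=> /theta_out ->; rewrite normr0.
have ta : (sqint setT (fun x => `|theta x|)%R <= A%:E)%E.
  by rewrite /sqint; under eq_integral do rewrite real_normK ?num_real//.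
have Ga : (sqint (box M) (fun x => `|G (x, z)|)%R <= B%:E)%E.
  by rewrite /sqint; under eq_integral do rewrite real_normK ?num_real//.
have [int2 sq2] := pairing_le A0 B0 (measurableT_comp (@normr_measurable _ _) mtheta)
  (measurableT_comp (@normr_measurable _ _) (mGl z)) aout ta Ga.
have -> : (\int[leb2]_x `|f (x, z)| = \int[leb2]_x (`|theta x| * `|G (x, z)|)%:E)%E.
  by apply: eq_integral => x _; rewrite /f /= normrM.
have If := integrable_fin_num measurableT int2.
(* [I^2 <= A B] gives [I <= A B + 1] without a square root. *)
rewrite -(fineK If) lee_fin; move: sq2; set I := fine _ => sq2.
rewrite leNgt; apply/negP => AI.
have AB0 : 0 <= A * B by exact: mulr_ge0.
by move: (A * B) AB0 AI sq2 => C; nra.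
Qed.

Let intf : (leb2 \x m)%E.-integrable setT f.
Proof.
apply/(integrable21ltyP leb2 m mf).
apply: (@le_lt_trans _ _ (\int[m]_z (cst (A * B + 1)%:E z))%E).
  apply: ge0_le_integral => //.
  - by move=> z _; apply: integral_ge0.
  - apply: (@measurable_fun_fubini_tonelli_G _ _ _ _ R leb2 (fun q => `|f q|)%E _).
      exact: measurableT_comp.
    by move=> q; exact: abse_ge0.
  - by move=> z _; have [_] := pair z.
by rewrite int_cstm ltry.
Qed.

Lemma mean_duality :
  fine (\int[leb2]_x (theta x * mean x)%:E)%E =
  \int[m]_z fine (\int[leb2]_x (theta x * G (x, z))%:E)%E.
Proof.
have E1 : (\int[leb2]_x (theta x * mean x)%:E = \int[leb2]_x \int[m]_z f (x, z))%E.
  apply: ae_eq_integral => //.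
  - apply/measurable_EFinP; apply: measurable_funM => //; exact: measurable_mean.
  - exact: measurable_fubini_F intf.
  (* Where [theta x] is nonzero, dividing by it turns the integrability of [f (x, .)], known for
     almost every [x], into that of [G (x, .)], so [mean x] is a genuine integral; elsewhere both
     sides vanish. *)
  - have := ae_integrable1 intf; apply: filterS => x ix _.
    have [t0|t0] := eqVneq (theta x) 0.
      by rewrite /f t0 mul0r integral0_eq// => z _; rewrite mul0r.
    have ig : m.-integrable setT (fun z => (G (x, z))%:E).
      have := integrableZl measurableT (theta x)^-1 ix.
      by apply: eq_integrable => // z _; rewrite /f -EFinM mulKf.
    rewrite EFinM fineK; last exact: integrable_fin_num ig.
    by rewrite -integralZl.
rewrite E1 (@Fubini _ _ _ _ R leb2 m f intf) /Rintegral; congr fine.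
apply: eq_integral => z _; rewrite fineK//.
by have [iz _] := pair z; exact: integrable_fin_num iz.
Qed.

End parametric_mean.

(** * Increments integrated over an interval *)

Section interval_shift.
Variable R : realType.
Notation lam := (@lebesgue_measure R).

Lemma int_aff1 s c (f : R -> \bar R) : measurable_fun [set: R] f ->
  (\int[lam]_x f (aff1 s c x) = \int[lam]_x f x)%E.
Proof.
move=> mf; rewrite integralE [RHS]integralE.
rewrite -(@ge0_int_aff1 _ s c (f^\+)%E)//; last exact: measurable_funepos.
rewrite -(@ge0_int_aff1 _ s c (f^\-)%E)//; last exact: measurable_funeneg.
congr (_ - _)%E; apply: eq_integral => x _.
  by rewrite funepos.unlock.
by rewrite funeneg.unlock.
Qed.

Variables (J : set R).
Hypothesis convJ : forall x y z : R, J x -> J z -> x <= y <= z -> J y.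

(* Two points [y < x - h] of [J] that both leave [J] under the shift by [-h]
   contradict convexity: [x - h] lies between them. *)
Lemma exit_bounded (h : R) : exists x0, forall s, J s -> ~ J (s - h) ->
  `[x0 - `|h|, x0 + `|h|]%classic s.
Proof.
have [[x0 [J0 N0]]|none] := pselect (exists x0, J x0 /\ ~ J (x0 - h)); last first.
  by exists 0 => s Js Ns; exfalso; apply: none; exists s.
exists x0 => s Js Ns; rewrite /= in_itv/=.
have aux x y : J x -> ~ J (x - h) -> J y -> ~ J (y - h) -> x - `|h| <= y.
  move=> Jx Nx Jy Ny; rewrite leNgt; apply/negP => yx.
  have [h0|h0] := leP 0 h.
    by rewrite ger0_norm// in yx; apply/Nx/(convJ Jy Jx); apply/andP; split; lra.
  by rewrite ltr0_norm// in yx; apply/Ny/(convJ Jy Jx); apply/andP; split; lra.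
by have := aux _ _ J0 N0 Js Ns; have := aux _ _ Js Ns J0 N0 => *; apply/andP; split; lra.
Qed.

(** A point of [J] leaving it under the shift by [- h] is an exit; a point entering [J] is, after
    the shift, an exit for [- h]. Exits of each kind fill a window of length [2 |h|]. *)
Lemma indic_shift_le (h : R) : exists A B : R, forall s,
  `|\1_J (s - h) - \1_J s| <=
    \1_(`[A, A + 2 * `|h|]%classic) s + \1_(`[B, B + 2 * `|h|]%classic) s :> R.
Proof.
have [x0 P0] := exit_bounded h; have [x1 P1] := exit_bounded (- h).
exists (x0 - `|h|), (x1 + h - `|h|) => s.
have i0 (X : set R) x : 0 <= \1_X x :> R by rewrite indicE.
rewrite [X in `|X - _|]indicE [X in `|_ - X|]indicE.
have [/set_mem Js|/negP Js] := boolP (s \in J); have [/set_mem Jh|/negP Jh] := boolP (s - h \in J).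
- by rewrite subrr normr0 addr_ge0.
- rewrite sub0r normrN normr1 indicE mem_set ?lerDl//.
  have := P0 _ Js (fun x => Jh (mem_set x)); rewrite /= !in_itv/= => /andP[? ?].
  by apply/andP; split; lra.
- rewrite subr0 normr1 [X in _ <= _ + X]indicE mem_set ?lerDr//.
  have NJ : ~ J (s - h - - h) by rewrite opprK subrK => /mem_set.
  have := P1 _ Jh NJ; rewrite /= !in_itv/= normrN => /andP[? ?].
  by apply/andP; split; lra.
- by rewrite subrr normr0 addr_ge0.
Qed.

Hypothesis mJ : measurable J.

(** A change of variables moves the shift from [phi] to the indicator, and [J] differs from its
    translate by a set of measure at most [4 |h|]. *)
Lemma interval_shift (N h K : R) (phi : R -> R) : (forall s, J s -> `|s| <= N) ->
  bm phi -> (forall s, `|phi s| <= K) ->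
  `|\int[lam]_s (\1_J s * (phi (s + h) - phi s))| <= 4 * `|h| * K.
Proof.
move=> JN bphi phiK.
have K0 : 0 <= K := le_trans (normr_ge0 _) (phiK 0).
pose L : set R := `[- (N + `|h|), N + `|h|]%classic.
have mL : measurable L by exact: measurable_itv.
have L1 s : J s -> L s.
  by move=> /JN sN; rewrite /L/= in_itv/= -ler_norml (le_trans sN)// lerDl.
have L2 s : J (s - h) -> L s.
  move=> /JN sN; rewrite /L/= in_itv/= -ler_norml -[s](subrK h).
  by rewrite (le_trans (ler_normD _ _))// lerD2r.
have Lfin : (lam L < +oo)%E by exact: lam_cc_lty.
have bint (f : R -> R) : bm f -> lam.-integrable L (EFin \o f).
  by move=> bf; exact: (@bm_integrable _ _ _ lam L mL Lfin).
have bsh (c : R) : bm (fun s : R => phi (s + c)).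
  case: bphi => mphi [K' HK']; split; last by exists K'.
  by apply: measurableT_comp mphi _; exact: (@measurable_aff1 R false c).
have bJ : bm (\1_J : R -> R) := bm_indic R mJ.
have bJh : bm (fun s : R => \1_J (s - h) : R).
  case: bJ => m1 [K1 HK1]; split; last by exists K1.
  by apply: (measurableT_comp m1); exact: (@measurable_aff1 R false (- h)).
have out (f : R -> R) : (forall s, ~ L s -> f s = 0) -> \int[lam]_s f s = \int[lam]_(s in L) f s.
  move=> f0; rewrite /Rintegral [in RHS]integral_mkcond; congr (fine _).
  by apply: eq_integral => s _; rewrite patchE; case: ifPn => // /negP sL; rewrite f0// => /mem_set.
have J0 s : ~ J s -> \1_J s = 0 :> R by move=> Js; rewrite indicE memNset.
have E : \int[lam]_s (\1_J s * phi (s + h)) = \int[lam]_s (\1_J (s - h) * phi s).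
  rewrite /Rintegral; congr fine.
  rewrite -[RHS](int_aff1 false h); last first.
    by apply/measurable_EFinP; have [] := bmM bJh bphi.
  by apply: eq_integral => s _; rewrite /aff1 addrK.
have -> : \int[lam]_s (\1_J s * (phi (s + h) - phi s)) =
    \int[lam]_(s in L) ((\1_J (s - h) - \1_J s) * phi s).
  rewrite out; last by move=> s Ls; rewrite J0 ?mul0r// => /L1.
  rewrite out in E; last by move=> s Ls; rewrite J0 ?mul0r// => /L1.
  rewrite [RHS]out in E; last by move=> s Ls; rewrite J0 ?mul0r// => /L2.
  transitivity (\int[lam]_(s in L) (\1_J s * phi (s + h)) - \int[lam]_(s in L) (\1_J s * phi s)).
    rewrite -RintegralB//; [|exact: bint (bmM bJ (bsh h))|exact: bint (bmM bJ bphi)].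
    by apply: eq_Rintegral => s _; rewrite mulrBr.
  rewrite E -RintegralB//; [|exact: bint (bmM bJh bphi)|exact: bint (bmM bJ bphi)].
  by apply: eq_Rintegral => s _; rewrite mulrBl.
have [A [B AB]] := indic_shift_le h.
pose UA : set R := `[A, A + 2 * `|h|]%classic.
pose UB : set R := `[B, B + 2 * `|h|]%classic.
have bUA : bm (\1_UA : R -> R) by apply: bm_indic; exact: measurable_itv.
have bUB : bm (\1_UB : R -> R) by apply: bm_indic; exact: measurable_itv.
have mU C : \int[lam]_(s in L) \1_(`[C, C + 2 * `|h|]%classic) s <= 2 * `|h|.
  rewrite /Rintegral integral_indic//.
  have le1 : (lam (`[C, (C + 2 * `|h|)%R]%classic `&` L) <= (2 * `|h|)%:E)%E.
    apply: (@le_trans _ _ (lam `[C, (C + 2 * `|h|)%R]%classic)).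
      by apply: le_measure; rewrite ?inE//; apply: measurableI; exact: measurable_itv.
    rewrite lebesgue_measure_itv/= lte_fin ltrDl; case: ifP => _; last by rewrite lee_fin mulr_ge0.
    by rewrite -EFinB lee_fin addrAC subrr add0r.
  rewrite -[leRHS]/(fine (2 * `|h|)%:E); apply: fine_le => //.
  by rewrite ge0_fin_numE// (le_lt_trans le1)// ltry.
rewrite (le_trans (le_normr_Rintegral _ _))//; first exact: bint (bmM (bmB bJh bJ) bphi).
apply: (@le_trans _ _ (\int[lam]_(s in L) (K * (\1_UA s + \1_UB s)))).
  apply: le_Rintegral => //.
  - apply: bint; have [m1 [K1 HK1]] := bmM (bmB bJh bJ) bphi; split; first exact: measurableT_comp.
    by exists K1 => s; rewrite normr_id.
  - exact: bint (bmZ K (bmD bUA bUB)).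
  - by move=> s _; rewrite normrM mulrC ler_pM.
rewrite RintegralZl//; last exact: bint (bmD bUA bUB).
rewrite RintegralD//; [|exact: bint bUA|exact: bint bUB].
have := mU A; have := mU B; rewrite -/UA -/UB; move: (\int[lam]_(s in L) _) (\int[lam]_(s in L) _) => u v.
by move: (`|h|) => e *; nra.
Qed.

End interval_shift.

(** Cutting the convex set [X] by []a, b[] and by the upper limit [s] leaves a bounded convex set,
    so the primitive is itself an increment integrated over an interval. *)
Lemma prim_shift_le (R : realType) (a b s r h K : R) (X : set R) (H : R * R -> R) (phi : R -> R) :
  (forall x y z : R, X x -> X z -> x <= y <= z -> X y) -> measurable X ->
  bm phi -> (forall u, `|phi u| <= K) ->
  (forall u, H (u, r) = \1_X u * (phi (u + h) - phi u)) ->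
  `|prim a b H s r| <= 4 * `|h| * K.
Proof.
move=> convX mX bphi phiK HE.
pose J := X `&` (`]a, b[%classic `&` `]-oo, s]%classic).
have mJ : measurable J by apply: measurableI => //; apply: measurableI; exact: measurable_itv.
have convJ x y z : J x -> J z -> x <= y <= z -> J y.
  rewrite /J /= !in_itv/= => -[Xx [/andP[ax _] _]] [Xz [/andP[_ zb] zs]] /andP[xy yz]; split.
    by apply: (convX x y z) => //; rewrite xy yz.
  by split; [apply/andP; split; lra|lra].
have JN u : J u -> `|u| <= `|a| + `|b|.
  rewrite /J /= !in_itv/= => -[_ [/andP[au ub] _]].
  have := ler_norm b; have := ler_norm (- a); rewrite normrN => ? ?.
  by have := normr_ge0 a; have := normr_ge0 b => *; rewrite ler_norml; apply/andP; split; lra.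
have := interval_shift convJ mJ h JN bphi phiK.
congr (`|_| <= _); rewrite /prim /Rintegral [in RHS]integral_mkcond; congr fine.
apply: eq_integral => u _; rewrite patchE HE /J !indicI /= .
rewrite [\1_`]a, b[ u]indicE; case: (u \in _); last by rewrite mul0r mulr0 mul0r.
by rewrite mul1r mulrAC.
Qed.

(** * Signed measures with a density *)

Section duality.
Variable R : realType.
Notation plane := (R * R)%type.
Notation leb2 := (@leb2 R).
Variables (mp mm : {finite_measure set plane -> \bar R}) (t : rect R) (u : plane -> R).
Notation S := (rect_open t).
Hypothesis intu : leb2.-integrable S (EFin \o u).
Hypothesis dens : forall A : set plane, measurable A ->
  fine (mp A) - fine (mm A) = RintL (A `&` S) u.

Let mS : measurable S := @measurable_rect_open R t.

Let mu : measurable_fun S u.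
Proof. by apply/measurable_EFinP; exact: measurable_int intu. Qed.

Let integ f : bm f -> leb2.-integrable S (EFin \o (fun x => f x * u x)).
Proof.
move=> [mf [K fK]].
apply: (@le_integrable _ _ _ leb2 S mS _ (fun x => K%:E * (u x)%:E)%E).
- by apply/measurable_EFinP; apply: measurable_funM => //; exact: measurable_funTS.
- move=> x _; rewrite /= lee_fin !normrM ler_wpM2r// (le_trans (fK x))// ler_norm//.
- exact: integrableZl.
Qed.

Lemma sintegral2_density H : bm H ->
  sintegral2 mp mm setT H = \int[leb2]_(x in S) (H x * u x).
Proof.
apply: (@bm_plane_ind R (fun H => sintegral2 mp mm setT H = \int[leb2]_(x in S) (H x * u x))).
- move=> a b c e; set A := _ `*` _.
  have mA : measurable A by apply: measurableX; exact: measurable_itv.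
  rewrite /sintegral2 /Rintegral !integral_indic// !setIT dens// /RintL; congr fine.
  rewrite [RHS]integral_mkcond [LHS]integral_mkcond; apply: eq_integral => x _.
  rewrite !patchE in_setI indicE; case: (x \in A) => //=; first by rewrite mul1r.
  by rewrite mul0r if_same.
- move=> c f g bf bg Pf Pg; rewrite sintegral2_lin// Pf Pg.
  rewrite -RintegralZl//; last exact: integ.
  transitivity (\int[leb2]_(x in S) (c * f x * u x) + \int[leb2]_(x in S) (g x * u x)).
    by congr (_ + _); apply: eq_Rintegral => x _; rewrite mulrA.
  rewrite -RintegralD//; [|exact: (integ (bmZ c bf))|exact: integ].
  by apply: eq_Rintegral => x _; rewrite mulrDl.
- move=> f_ f K bf fK ff Pf.
  have c1 := @sintegral2_dct _ _ _ mp mm setT measurableT _ _ _ (fun n => (bf n).1) fK ff.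
  apply: (cvg_unique (@Rhausdorff R) c1).
  rewrite (_ : (fun n => _) = (fun n => \int[leb2]_(x in S) (f_ n x * u x))); last exact/funext.
  have mf : measurable_fun [set: plane] f.
    by apply: (measurable_fun_cvg (fun n => (bf n).1)) => x _; exact: ff.
  have K0 : 0 <= K := le_trans (normr_ge0 _) (fK 0%N 0).
  have [] := @dominated_convergence _ _ _ leb2 S mS (fun n x => (f_ n x * u x)%:E)
    (fun x => (f x * u x)%:E) (fun x => K%:E * `|(u x)%:E|)%E.
  + by move=> n; have := measurable_int _ (integ (bf n)).
  + by apply/measurable_EFinP; apply: measurable_funM => //; exact: measurable_funTS.
  + apply: aeW => x _ /=; apply: cvg_EFin; first exact: nearW.
    by apply: cvgMl; exact: ff.
  + by apply: integrableZl => //; exact: integrable_abse.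
  + by apply: aeW => x n _ /=; rewrite lee_fin normrM ler_wpM2r.
  move=> intf _ h; apply: fine_cvg; rewrite fineK//.
  exact: integrable_fin_num intf.
Qed.

(** [mp] and [mm] may both charge the complement of the open rectangle; only their difference is
    known to vanish there. *)
Lemma sintegral2_open H : bm H -> sintegral2 mp mm setT H = sintegral2 mp mm S H.
Proof.
move=> bH; have bHS : bm (fun x => H x * \1_S x) by apply: bmM => //; exact: bm_indic.
transitivity (sintegral2 mp mm setT (fun x => H x * \1_S x)).
  rewrite !sintegral2_density//; apply: eq_Rintegral => x xS.
  by rewrite indicE xS mulr1.
rewrite /sintegral2 /Rintegral; congr (fine _ - fine _).
all: rewrite [RHS]integral_mkcond; apply: eq_integral => x _.
all: by rewrite patchE indicE; case: (x \in S); rewrite ?mulr1 ?mulr0.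
Qed.

End duality.

(** * Convolution with a reflected measure, and its adjoint *)

Section reflected_kernel.
Variable R : realType.
Notation plane := (R * R)%type.
Notation leb2 := (@leb2 R).
Implicit Types (W : plane -> R) (x y z t : plane).

Lemma L2c_opp W : L2c W -> L2c (fun v => W (- v)).
Proof.
move=> [mW [M W0] [A A0 WA]].
have E : (fun v => W (- v)) = (fun v => W (0 - v)) by apply/funext => v; rewrite sub0r.
split.
- by rewrite E; exact: measurable_kernel.
- by exists M => z zM; apply: W0 => /boxN; rewrite opprK.
- by exists A => //; rewrite E sqint_kernel.
Qed.

Variables (I : finType) (s1 s2 : I -> bool) (c1 c2 : I -> R) (X Y : I -> set R).
Hypothesis mX : forall i, measurable (X i).
Hypothesis mY : forall i, measurable (Y i).

Definition chi i z : R := \1_(X i) z.1 * \1_(Y i) z.2.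
Definition rho i z := aff2 (s1 i) (c1 i) (s2 i) (c2 i) z.
(** The reflected measure is the sum over [i] of the images under [rho i] of the restrictions to
    [X i x Y i]; [kern] is the integrand of the convolution, pulled back to the original measure. *)
Definition kern W (q : plane * plane) : R := \sum_i chi i q.2 * W (q.1 - rho i q.2).

Lemma bm_chi i : bm (chi i).
Proof. by have := tensor_bm (bm_indic R (mX i)) (bm_indic R (mY i)). Qed.

Lemma chi_le1 i z : `|chi i z| <= 1.
Proof.
by rewrite /chi normrM !indicE; do 2 case: (_ \in _); rewrite ?normr1 ?normr0 ?mulr1 ?mulr0.
Qed.

Lemma measurable_sub : measurable_fun [set: plane * plane] (fun q => q.1 - q.2 : plane).
Proof.
apply: measurable_fun_pair => /=.
  by apply: measurable_funB; apply: measurableT_comp; [exact: measurable_fst|exact: measurable_fst|exact: measurable_fst|exact: measurable_snd].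
by apply: measurable_funB; apply: measurableT_comp; [exact: measurable_snd|exact: measurable_fst|exact: measurable_snd|exact: measurable_snd].
Qed.

Lemma measurable_kern W : measurable_fun [set: plane] W ->
  measurable_fun [set: plane * plane] (kern W).
Proof.
move=> mW.
have mi i : measurable_fun [set: plane * plane] (fun q => chi i q.2 * W (q.1 - rho i q.2)).
  apply: measurable_funM.
    exact: measurableT_comp (bm_chi i).1 (@measurable_snd _ _ _ _).
  have mr : measurable_fun [set: plane * plane] (fun q => (q.1, rho i q.2)).
    apply: measurable_fun_pair; first exact: measurable_fst.
    by apply: (measurableT_comp (measurable_aff2 (s1 i) (c1 i) (s2 i) (c2 i))); exact: measurable_snd.
  exact: measurableT_comp mW (measurableT_comp measurable_sub mr).
exact: measurable_sum.
Qed.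

(** Uniform in [z], since [x -> W (x - rho i z)] is a translate of [W] and the cut-offs, at most
    [1], depend on [z] only. *)
Lemma kern_bound W : L2c W -> exists2 B : R, 0 <= B &
  forall z, (sqint setT (fun x => kern W (x, z)) <= B%:E)%E.
Proof.
move=> [mW _ [A A0 WA]]; rewrite /kern.
have mi i z : measurable_fun [set: plane] (fun x => chi i z * W (x - rho i z)).
  by apply: measurable_funM => //; exact: measurable_comp_shift.
elim: (index_enum I) => [|i r [B B0 IH]].
  exists 0 => // z; rewrite /sqint integral0_eq// => x _.
  by rewrite big_nil expr0n.
exists (2 * (A + B)); first by rewrite mulr_ge0// addr_ge0.
move=> z; rewrite (_ : (fun x => _) = (fun x => chi i z * W (x - rho i z) +
   \sum_(j <- r) chi j z * W (x - rho j z))); last first.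
  by apply/funext => x; rewrite big_cons.
apply: sqintD => //; first by apply: measurable_sum => j; exact: mi.
apply: (@le_trans _ _ (sqint setT (fun x => W (x - rho i z)))).
  apply: sqint_le => //; first exact: measurable_comp_shift.
  by move=> x _; rewrite normrM ler_piMl// chi_le1.
by rewrite /sqint (@ge0_int_shift R (- rho i z) (fun x => (W x ^+ 2)%:E))//;
  [exact: measurable_sqr|move=> x; rewrite lee_fin sqr_ge0].
exact: IH.
Qed.

Lemma mean_shift (m : {finite_measure set plane -> \bar R}) W t x :
  mean m (kern (fun y => W (y + t))) x = mean m (kern W) (x + t).
Proof.
rewrite /mean; congr fine; apply: eq_integral => z _; congr EFin.
by apply: eq_bigr => i _; rewrite /= addrAC.
Qed.

Section pairing.
Variables (W theta : plane -> R) (M A : R).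
Hypothesis LW : L2c W.
Hypothesis mtheta : measurable_fun [set: plane] theta.
Hypothesis theta_out : forall x, ~ box M x -> theta x = 0.
Hypothesis A0 : 0 <= A.
Hypothesis thetaA : (sqint setT theta <= A%:E)%E.

(** The adjoint of convolution with [W], that is the integral of [theta x * W (x - y)] in [x].
    Unlike the first layer, it is bounded everywhere. *)
Definition dual y := cv (fun v => W (- v)) theta y.

Let Ltheta : L2loc theta.
Proof.
split=> // N; exists A => //; apply: le_trans thetaA.
by apply: sqintS => //; exact: measurable_box.
Qed.

Lemma measurable_dual : measurable_fun [set: plane] dual.
Proof. by apply: measurable_cv => //; have [] := L2c_opp LW. Qed.

Lemma dual_sqr_le (B : R) y : 0 <= B -> (sqint setT W <= B%:E)%E -> dual y ^+ 2 <= B * A.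
Proof.
move=> B0 WB; have [mW' [M0 W0] _] := L2c_opp LW.
have [N _ yN] := box_ex y.
apply: (cv_sqr_le B0 A0 mW' mtheta W0 yN).
  have E : (fun v => W (- v)) = (fun v => W (0 - v)) by apply/funext => v; rewrite sub0r.
  by rewrite E sqint_kernel//; have [] := LW.
by apply: le_trans thetaA; apply: sqintS => //; exact: measurable_box.
Qed.

Lemma bm_dual : bm dual.
Proof.
split; first exact: measurable_dual.
have [_ _ [B B0 WB]] := LW.
exists (Num.sqrt (B * A)) => y.
by rewrite -sqrtr_sqr ler_wsqrtr// dual_sqr_le.
Qed.

Lemma kern_dual z :
  fine (\int[leb2]_x (theta x * kern W (x, z))%:E)%E = \sum_i chi i z * dual (rho i z).
Proof.
have ii i : leb2.-integrable setT (EFin \o (fun x => chi i z * (W (x - rho i z) * theta x))).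
  have := cv_integrable (rho i z) (L2c_opp LW) Ltheta.
  move=> /(integrableZl measurableT (chi i z)); apply: eq_integrable => // x _ /=.
  by rewrite opprB.
pose P (r : seq I) := leb2.-integrable setT (EFin \o (fun x => \sum_(i <- r) chi i z * (W (x - rho i z) * theta x))) /\
  \int[leb2]_x (\sum_(i <- r) chi i z * (W (x - rho i z) * theta x)) =
  \sum_(i <- r) chi i z * dual (rho i z).
have : P (index_enum I).
  elim: (index_enum I) => [|i r [IH1 IH2]].
    split; first by apply: eq_integrable (integrable0 _ _) => // x _; rewrite /= big_nil.
    rewrite big_nil; under eq_Rintegral do rewrite big_nil.
    by rewrite /Rintegral integral0.
  split.
    have := integrableD measurableT (ii i) IH1; apply: eq_integrable => // x _.
    by rewrite /= big_cons EFinD.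
  rewrite big_cons -IH2; under eq_Rintegral do rewrite big_cons.
  rewrite RintegralD//; congr (_ + _).
  rewrite /dual /cv -/(Rintegral _ _ _).
  have := cv_integrable (rho i z) (L2c_opp LW) Ltheta => iw.
  rewrite -RintegralZl//; apply: eq_Rintegral => x _; by rewrite opprB.
move=> [_ <-]; congr fine; apply: eq_integral => x _; congr EFin.
by rewrite /kern mulr_sumr; apply: eq_bigr => i _ /=; ring.
Qed.

Variables (mp mm : {finite_measure set plane -> \bar R}).

Definition smean V x := mean mp (kern V) x - mean mm (kern V) x.

Lemma L2loc_smean V : L2c V -> L2loc (smean V).
Proof.
move=> LV; have [B B0 HB] := kern_bound LV; have [mV _ _] := LV.
by apply: L2locB; exact: (L2loc_mean _ (measurable_kern mV) B0 HB).
Qed.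

(** Fubini turns the pairing of [theta] with the convolved measure into the integral of a bounded
    function against the signed measure, where the BV condition can act. *)
Lemma smean_dual :
  leb2.-integrable setT (EFin \o (fun x => theta x * smean W x)) /\
  \int[leb2]_x (theta x * smean W x) =
    sintegral2 mp mm setT (fun z => \sum_i chi i z * dual (rho i z)).
Proof.
have [mW _ _] := LW; have [B B0 HB] := kern_bound LW; have mk := measurable_kern mW.
have int m : leb2.-integrable setT (EFin \o (fun x => theta x * mean m (kern W) x)).
  have [ml Hl] := L2loc_mean m mk B0 HB; have [D D0 HD] := Hl M.
  by have [] := pairing_le A0 D0 mtheta ml theta_out thetaA HD.
split.
  have := integrableB measurableT (int mp) (int mm); apply: eq_integrable => // x _.
  by rewrite /= /smean mulrBr EFinB.
rewrite /smean; under eq_Rintegral do rewrite mulrBr.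
rewrite RintegralB//.
have dl m := mean_duality m mk B0 HB mtheta theta_out A0 thetaA.
rewrite /sintegral2; congr (_ - _).
all: by rewrite [LHS]dl; apply: eq_Rintegral => z _; rewrite kern_dual.
Qed.

End pairing.

End reflected_kernel.

Lemma prim_bigsum_le (R : realType) (a b s r m : R) (J : Type) (l : seq J) (H : J -> R * R -> R) :
  (forall i, bm (H i)) -> (forall i, `|prim a b (H i) s r| <= m) ->
  `|prim a b (fun z => \sum_(i <- l) H i z) s r| <= (size l)%:R * m.
Proof.
move=> bH Hm; elim: l => [|i l IH].
  have -> : (fun z : R * R => \sum_(i <- [::]) H i z) = (fun=> 0).
    by apply/funext => z; rewrite big_nil.
  have := @prim_le R a b (fun=> 0) 0 s r (bm_cst _ 0); rewrite !mul0r; apply.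
  by move=> z; rewrite normr0.
have -> : (fun z => \sum_(j <- i :: l) H j z) = (fun z => 1 * H i z + \sum_(j <- l) H j z).
  by apply/funext => z; rewrite big_cons mul1r.
rewrite prim_lin//; last exact: bm_sum.
rewrite mul1r (le_trans (ler_normD _ _))// /= -natr1 mulrDl mul1r addrC.
exact: lerD.
Qed.

(** Exchanging coordinates makes the direction of differentiation the first variable, so that one
    argument serves both axes. *)
Definition swap (R : realType) (q : bool) (z : R * R) : R * R := if q then (z.2, z.1) else z.

Lemma measurable_swap (R : realType) (q : bool) : measurable_fun [set: R * R] (@swap R q).
Proof.
case: q; last exact: measurable_id.
have m : measurable_fun [set: R * R] (fun z => (z.2, z.1)).
  by apply: measurable_fun_pair; [exact: measurable_snd|exact: measurable_fst].
exact: m.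
Qed.

(** * Increments of the first layer *)

Section mean_Pdiff.
Variable R : realType.
Notation plane := (R * R)%type.
Notation leb2 := (@leb2 R).
Variables (I : finType) (s1 s2 : I -> bool) (c1 c2 : I -> R) (X Y : I -> set R).
Hypothesis convX : forall i (x y z : R), X i x -> X i z -> x <= y <= z -> X i y.
Hypothesis convY : forall i (x y z : R), Y i x -> Y i z -> x <= y <= z -> Y i y.
Hypothesis mX : forall i, measurable (X i).
Hypothesis mY : forall i, measurable (Y i).
Notation chi := (chi X Y).
Notation rho := (rho s1 s2 c1 c2).
Notation kern := (kern s1 s2 c1 c2 X Y).
Variables (mp mm : {finite_measure set plane -> \bar R}) (q : bool) (a b c e C : R).
Hypothesis C0 : 0 <= C.
Hypothesis est : forall (H : plane -> R) (M : R), bm H ->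
  (forall s r, c < r < e -> `|prim a b (fun z => H (swap q z)) s r| <= M) ->
  `|sintegral2 mp mm setT H| <= C * M.
Notation dir := (if q then e2 R else e1 R).

(** On a line along [dir] the cut-off is the indicator of an interval times a constant, and [rho i]
    acts as an isometry of the line, so the increment is that of a function of one variable. *)
Lemma increment_prim_le (k : plane -> R) (K h s r : R) i : bm k -> (forall y, `|k y| <= K) ->
  `|prim a b (fun z => let z' := swap q z in chi i z' * (k (rho i z' - h *: dir) - k (rho i z'))) s r|
    <= 4 * `|h| * K.
Proof.
move=> bk kK; have K0 : 0 <= K := le_trans (normr_ge0 _) (kK 0).
have A1 (x : R) : x *: (1 : R) = x :> R by exact: mulr1.
have A0 (x : R) : x *: (0 : R) = 0 :> R by exact: mulr0.
case: q => /=.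
- pose phi u : R := \1_(X i) r * k (aff1 (s1 i) (c1 i) r, aff1 (s2 i) (c2 i) u).
  (* The sign makes the branch at [u + h'] equal to its value at [u] minus [h]. *)
  pose h' := if s2 i then h else - h.
  have -> : `|h| = `|h'| by rewrite /h'; case: (s2 i); rewrite ?normrN.
  apply: (@prim_shift_le R a b s r h' K (Y i) _ phi) => //.
  + exact: convY.
  + apply: bmM; first exact: bm_cst.
    have [mk [L HL]] := bk; split; last by exists L.
    apply: (measurableT_comp mk); apply: measurable_fun_pair; first exact: measurable_cst.
    exact: measurable_aff1.
  + by move=> u; rewrite normrM indicE -[leRHS]mul1r ler_pM//; case: (_ \in _); rewrite ?normr1 ?normr0.
  + move=> u; rewrite /chi /phi /rho /aff2/= -mulrBr mulrA [\1_(Y i) u * _]mulrC.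
    congr (_ * (k _ - _)); congr pair => /=; first by rewrite A0 subr0.
    by rewrite A1 /h' /aff1; case: (s2 i); ring.
- pose phi u : R := \1_(Y i) r * k (aff1 (s1 i) (c1 i) u, aff1 (s2 i) (c2 i) r).
  pose h' := if s1 i then h else - h.
  have -> : `|h| = `|h'| by rewrite /h'; case: (s1 i); rewrite ?normrN.
  apply: (@prim_shift_le R a b s r h' K (X i) _ phi) => //.
  + exact: convX.
  + apply: bmM; first exact: bm_cst.
    have [mk [L HL]] := bk; split; last by exists L.
    apply: (measurableT_comp mk); apply: measurable_fun_pair; last exact: measurable_cst.
    exact: measurable_aff1.
  + by move=> u; rewrite normrM indicE -[leRHS]mul1r ler_pM//; case: (_ \in _); rewrite ?normr1 ?normr0.
  + move=> u; rewrite /chi /phi /rho /aff2/= -mulrBr mulrA.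
    congr (_ * (k _ - _)); congr pair => /=; last by rewrite A0 subr0.
    by rewrite A1 /h' /aff1; case: (s1 i); ring.
Qed.

(* With [D] the increment and [theta = D] on the box, [Q = |D|^2] equals the
   pairing of the measure with increments of [dual W theta], which is bounded by
   [sqrt (A Q)]; hence [Q <= c |h| sqrt (A Q)]. *)
Lemma smean_Pdiff W : L2c W ->
  Pdiff dir (smean s1 s2 c1 c2 X Y mp mm W).
Proof.
move=> LW M; have [mW _ [A A0 WA]] := LW.
pose n : R := #|I|%:R.
(* From [Q <= 4 C n |h| K] and [K^2 = A Q]: square, then cancel one factor [Q]. *)
exists ((C * (n * 4)) ^+ 2 * A); first by rewrite mulr_ge0// sqr_ge0.
move=> h hM; set F := smean _ _ _ _ _ _ _ _ _; set t := h *: dir.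
have LF : L2loc F by exact: L2loc_smean.
have LD : L2loc (fun x => F (x + t) - F x) := (L2locB (L2loc_shift t LF) LF).
set Dl := fun x => _ in LD *.
have [mDl HDl] := LD; have [B B0 DB] := HDl M.
(* Local square integrability of the first layer makes [Q] finite, which permits cancelling it at
   the end. *)
have Qfin : sqint (box M) Dl \is a fin_num.
  by rewrite ge0_fin_numE ?sqint_ge0// (le_lt_trans DB)// ltry.
rewrite -(fineK Qfin) lee_fin; set Q := fine _.
have Q0 : 0 <= Q by rewrite fine_ge0// sqint_ge0.
pose theta x := Dl x * \1_(box M) x.
have mtheta : measurable_fun [set: plane] theta.
  by apply: measurable_funM => //; exact: (bm_indic R (measurable_box M)).1.
have tout x : ~ box M x -> theta x = 0 by move=> ?; rewrite /theta indicE memNset ?mulr0.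
have tD x : box M x -> theta x = Dl x by move=> ?; rewrite /theta indicE mem_set ?mulr1.
have thetaQ : sqint setT theta = Q%:E.
  rewrite fineK// (sqint_setT_box mtheta tout).
  by apply: eq_integral => x /set_mem ?; rewrite tD.
have thetaA : (sqint setT theta <= Q%:E)%E by rewrite thetaQ.
have LWt : L2c (fun y => W (y + t)) by exact: L2c_shift.
have [i1 d1] := smean_dual s1 s2 c1 c2 mX mY LW mtheta tout Q0 thetaA mp mm.
have [i2 d2] := smean_dual s1 s2 c1 c2 mX mY LWt mtheta tout Q0 thetaA mp mm.
set k := dual W theta in d1; set kt := dual _ theta in d2.
(* Shifting the kernel shifts its adjoint backwards, so the increment of the layer becomes an
   increment of the single bounded function [k]. *)
have ktE y : kt y = k (y - t).
  rewrite /kt /k /dual -cv_shiftl; congr (cv _ _ _); apply/funext => v.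
  by rewrite opprB addrC.
have bk : bm k by exact: (bm_dual LW mtheta Q0 thetaA).
pose K := Num.sqrt (A * Q).
have kK y : `|k y| <= K.
  by rewrite -sqrtr_sqr ler_wsqrtr// (dual_sqr_le LW mtheta Q0 thetaA).
pose H z := \sum_i chi i z * (k (rho i z - t) - k (rho i z)).
have bk2 i u : bm (fun z => chi i z * k (rho i z - u)).
  apply: bmM; first exact: bm_chi.
  have [mk [L HL]] := bk; split; last by exists L.
  by apply: (measurableT_comp (measurable_comp_shift (- u) mk)); exact: measurable_aff2.
have bH1 i : bm (fun z => chi i z * (k (rho i z - t) - k (rho i z))).
  under eq_fun do rewrite mulrBr; apply: bmB; first exact: bk2.
  by have := bk2 i 0; under eq_fun do rewrite subr0.
have bH : bm H by exact: bm_sum.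
have QE : Q = sintegral2 mp mm setT H.
  have Q1 : Q = \int[leb2]_x (theta x * smean s1 s2 c1 c2 X Y mp mm (fun y => W (y + t)) x - theta x * F x).
    rewrite -[LHS]/(fine Q%:E) -thetaQ /sqint /Rintegral; congr fine; apply: eq_integral => x _.
    rewrite /smean !mean_shift -[mean mp _ _ - mean mm _ _]/(F (x + t)) -mulrBr -/(Dl x).
    have [xM|xM] := pselect (box M x); first by rewrite tD.
    by rewrite tout// mul0r expr0n.
  rewrite Q1 RintegralB// d1 d2.
  have b1 : bm (fun z => \sum_i chi i z * k (rho i z)).
    by apply: bm_sum => i; have := bk2 i 0; under eq_fun do rewrite subr0.
  have b2 : bm (fun z => \sum_i chi i z * kt (rho i z)).
    by apply: bm_sum => i; have := bk2 i t; under eq_fun do rewrite -ktE.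
  have := sintegral2_lin mp mm measurableT (- 1) b1 b2.
  rewrite mulN1r addrC => <-; congr sintegral2; apply/funext => z.
  rewrite mulN1r addrC -sumrB; apply: eq_bigr => i _.
  by rewrite ktE mulrBr.
have main : Q <= C * (n * (4 * `|h| * K)).
  rewrite QE (le_trans (ler_norm _))//; apply: est => // s r _.
  have -> : n = (size (index_enum I))%:R by rewrite /n cardT enumT.
  apply: (@prim_bigsum_le R a b s r _ I (index_enum I)
    (fun i z => let z' := swap q z in chi i z' * (k (rho i z' - t) - k (rho i z')))).
    move=> i; have [m1 [L HL]] := bH1 i; split; last by exists L => x; exact: HL.
    exact: measurableT_comp m1 (@measurable_swap R q).
  by move=> i; exact: increment_prim_le.
have K2 : K ^+ 2 = A * Q by rewrite sqr_sqrtr// mulr_ge0.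
have K0 : 0 <= K by exact: sqrtr_ge0.
have [Q00|Qn0] := eqVneq Q 0; first by rewrite Q00 mulr_ge0 ?sqr_ge0// mulr_ge0 ?sqr_ge0.
have Qp : 0 < Q by rewrite lt_neqAle eq_sym Qn0.
rewrite -(ler_pM2r Qp).
have -> : (C * (n * 4)) ^+ 2 * A * h ^+ 2 * Q = (C * (n * (4 * `|h| * K))) ^+ 2.
  by rewrite -(real_normK (num_real h)) !exprMn K2; ring.
rewrite -expr2 lerXn2r ?nnegrE// !mulr_ge0//.
Qed.

End mean_Pdiff.

(** * Closures and difference sets of rectangles *)

Section closure_rectangle.
Variable R : realType.
Notation plane := (R * R)%type.

Lemma closed_rect_cl (t : rect R) : closed (rect_cl t).
Proof.
have -> : rect_cl t = (fst @^-1` `[rxa t, rxb t]%classic) `&` (snd @^-1` `[ryc t, ryd t]%classic).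
  by apply/seteqP; split => x /=; rewrite !in_itv.
apply: closedI; apply: closed_comp; try exact: itv_closed.
  by move=> x _; exact: cvg_fst.
by move=> x _; exact: cvg_snd.
Qed.

Lemma closure_rect_open (t : rect R) : closure (rect_open t) = rect_cl t.
Proof.
apply/seteqP; split.
  have -> : rect_cl t = closure (rect_cl t) by apply/closure_id; exact: closed_rect_cl.
  apply: closureS => x [/andP[h1 h2] /andP[h3 h4]].
  by split; apply/andP; split; exact: ltW.
move=> x [/andP[h1 h2] /andP[h3 h4]] B nB.
have ab := rect_ab t; have cd := rect_cd t.
pose c : plane := ((rxa t + rxb t) / 2, (ryc t + ryd t) / 2).
(* The segment towards the centre: [f s] is in the open rectangle for [0 < s <= 1] and tends to
   [x]. *)
pose f (s : R) : plane := x + s *: (c - x).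
have cf : {for 0, continuous f}.
  by apply: cvgD; [exact: cvg_cst|apply: cvgZl; exact: cvg_id].
have : nbhs (f 0) B by rewrite /f scale0r addr0.
move=> /cf /nbhs_ballP[r /= r0 rB].
pose s := Num.min (r / 2) 1.
have s0 : 0 < s by rewrite lt_min ltr01 divr_gt0.
have s1 : s <= 1 by rewrite ge_min lexx orbT.
have sr : s < r.
  have : s <= r / 2 by rewrite ge_min lexx.
  by move: r0 => ?; lra.
exists (f s); split; last first.
  by apply: rB; rewrite /ball/= sub0r normrN gtr0_norm.
have H : rxa t < x.1 + s * ((rxa t + rxb t) / 2 - x.1) < rxb t /\
    ryc t < x.2 + s * ((ryc t + ryd t) / 2 - x.2) < ryd t.
  by move: h1 h2 h3 h4 ab cd s0 s1; clear; move=> *; split; apply/andP; split; nra.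
exact: H.
Qed.

Lemma diffset_rect (T S : rect R) : exists t : rect R,
  diffset (rect_open T) (rect_open S) = rect_open t.
Proof.
have T1 := rect_ab T; have T2 := rect_cd T; have S1 := rect_ab S; have S2 := rect_cd S.
have h1 : rxa T - rxb S < rxb T - rxa S by lra.
have h2 : ryc T - ryd S < ryd T - ryc S by lra.
exists (Rect h1 h2); apply/seteqP; split.
  move=> _ [x [y [[/andP[? ?] /andP[? ?]] [[/andP[? ?] /andP[? ?]] ->]]]].
  by split => /=; apply/andP; split; lra.
have aux (a b c d z : R) : a < b -> c < d -> a - d < z < b - c ->
    exists2 y, c < y < d & a < z + y < b.
  move=> ab cd /andP[z1 z2].
  (* The conditions on [y] say that it lies in []c, d[] and in []a - z, b - z[]; these intervals
     overlap, and the midpoint of the overlap is taken. *)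
  have u1 : Num.max c (a - z) < Num.min d (b - z).
    by rewrite gt_max !lt_min; apply/andP; split; apply/andP; split; lra.
  have := midf_lt u1; set y := _ / 2 => -[].
  rewrite gt_max lt_min => /andP[? ?] /andP[? ?].
  by exists y; apply/andP; split; lra.
move=> [z1 z2] [/= k1 k2].
have [y1 a1 b1] := aux _ _ _ _ _ T1 S1 k1; have [y2 a2 b2] := aux _ _ _ _ _ T2 S2 k2.
exists (z1 + y1, z2 + y2), (y1, y2); split => //; split => //.
by congr pair; rewrite /= addrK.
Qed.

End closure_rectangle.

(** * The reflected measure as a finite sum over branches *)

Section unfolding.
Variable R : realType.
Notation plane := (R * R)%type.

(* The endpoints are excluded from the reversing branches because there the
   value is already produced by a translation, and [conv_meas] sums over a set. *)
Definition cell (a b a' b' : R) (n : nat) (p : bool * 'I_(n.*2.+1)) : set R :=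
  [set s | (if p.1 then a < s < b else a <= s <= b) /\ a' <= aff1 p.1 (lat a b p) s <= b'].

Lemma cell_itv (a b a' b' : R) (n : nat) (p : bool * 'I_(n.*2.+1)) s :
  cell a b a' b' p s -> a <= s <= b.
Proof. by case; case: p.1 => // /andP[h1 h2] _; rewrite !ltW. Qed.

Lemma measurable_cell (a b a' b' : R) (n : nat) (p : bool * 'I_(n.*2.+1)) :
  measurable (cell a b a' b' p).
Proof.
have -> : cell a b a' b' p = (if p.1 then `]a, b[%classic else `[a, b]%classic) `&`
    (aff1 p.1 (lat a b p) @^-1` `[a', b']%classic).
  by apply/seteqP; split => s; rewrite /cell/= in_itv; case: p.1; rewrite /= in_itv.
apply: measurableI; first by case: p.1; exact: measurable_itv.
rewrite -[X in measurable X]setTI; apply: measurable_aff1 => //; exact: measurable_itv.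
Qed.

Lemma convex_cell (a b a' b' : R) (n : nat) (p : bool * 'I_(n.*2.+1)) (x y z : R) :
  cell a b a' b' p x -> cell a b a' b' p z -> x <= y <= z -> cell a b a' b' p y.
Proof.
rewrite /cell /= /aff1; case: p.1; move=> [/andP[? ?] /andP[? ?]] [/andP[? ?] /andP[? ?]] /andP[? ?].
all: by split; apply/andP; split; lra.
Qed.

Variables (t t' : rect R) (n1 n2 : nat).
Notation I := ((bool * 'I_(n1.*2.+1)) * (bool * 'I_(n2.*2.+1)))%type.
Hypothesis P1 : forall x : plane, rect_cl t' x ->
  exists p : bool * 'I_(n1.*2.+1), x.1 = aff1 p.1 (lat (rxa t) (rxb t) p) (fold1 (rxa t) (rxb t) x.1) /\
    (p.1 -> rxa t < fold1 (rxa t) (rxb t) x.1 < rxb t).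
Hypothesis P2 : forall x : plane, rect_cl t' x ->
  exists p : bool * 'I_(n2.*2.+1), x.2 = aff1 p.1 (lat (ryc t) (ryd t) p) (fold1 (ryc t) (ryd t) x.2) /\
    (p.1 -> ryc t < fold1 (ryc t) (ryd t) x.2 < ryd t).

Let X (i : I) := cell (rxa t) (rxb t) (rxa t') (rxb t') i.1.
Let Y (i : I) := cell (ryc t) (ryd t) (ryc t') (ryd t') i.2.
Let s1 (i : I) := i.1.1.
Let s2 (i : I) := i.2.1.
Let c1 (i : I) := lat (rxa t) (rxb t) i.1.
Let c2 (i : I) := lat (ryc t) (ryd t) i.2.

(** The admissible branches correspond bijectively to the reflected copies of [z] in [rect_cl t']:
    injective because the cells exclude coincident branches, surjective by the covering hypotheses
    [P1] and [P2]. *)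
Lemma sum_reflections (g : plane -> R) (z : plane) : rect_cl t z ->
  \sum_(z' \in [set z' | rfold t z' = z /\ rect_cl t' z']) g z' =
  \sum_(i : I) chi X Y i z * g (rho s1 s2 c1 c2 i z).
Proof.
move=> [zx zy].
pose P : set I := [set i | X i z.1 /\ Y i z.2].
have bij : set_bij P [set z' | rfold t z' = z /\ rect_cl t' z'] (fun i => rho s1 s2 c1 c2 i z).
  split.
  - move=> i [[_ i1] [_ i2]]; split => //.
    by rewrite /rfold /= !fold1_latK//; [case: (z)|exact: rect_cd|exact: rect_ab].
  - move=> i j /set_mem[[i1 _] [i2 _]] /set_mem[[j1 _] [j2 _]] [E1 E2].
    have := aff1_inj_lat (rect_ab t) i1 j1 E1; have := aff1_inj_lat (rect_cd t) i2 j2 E2.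
    by case: (i) (j) => [i' i''] [j' j''] /= -> ->.
  - move=> x [fx tx]; have [p [p1 p2]] := P1 tx; have [q [q1 q2]] := P2 tx.
    have f1 : fold1 (rxa t) (rxb t) x.1 = z.1 by rewrite -fx.
    have f2 : fold1 (ryc t) (ryd t) x.2 = z.2 by rewrite -fx.
    rewrite f1 in p1 p2; rewrite f2 in q1 q2.
    exists (p, q); last by rewrite /rho /aff2 /= [RHS]surjective_pairing p1 q1.
    move: tx => [t1 t2]; rewrite p1 in t1; rewrite q1 in t2.
    split; split => //=; first by case: p.1 p2 => // ->.
    by case: q.1 q2 => // ->.
rewrite (reindex_fsbig _ P _ _ bij) fsbig_mkcond.
rewrite (@fsbig_fwiden _ _ _ _ (index_enum I)) ?index_enum_uniq//; last 2 first.
- by move=> i _ /=; rewrite mem_index_enum.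
- by move=> i [_ ]; case.
apply: eq_bigr => i _; rewrite patchE /chi !indicE.
have [/set_mem[Xi Yi]|/negP NP] := boolP (i \in P).
  by rewrite !mem_set// !mul1r.
have [/set_mem Xi|_] := boolP (z.1 \in X i); last by rewrite !mul0r.
have [/set_mem Yi|_] := boolP (z.2 \in Y i); last by rewrite mulr0 mul0r.
by exfalso; apply: NP; apply/mem_set.
Qed.

Lemma conv_meas_smean (mp mm : {finite_measure set plane -> \bar R}) (Op S : set plane)
    (w : plane -> R) (x : plane) : closure Op = rect_cl t' ->
  conv_meas mp mm t Op w S x = smean s1 s2 c1 c2 X Y mp mm (w \_ S) x.
Proof.
move=> clOp.
have E (m : {finite_measure set plane -> \bar R}) :
    fine (\int[m]_(z in rect_cl t)
      (\sum_(z' \in [set z' | rfold t z' = z /\ closure Op z']) (w \_ S) (x - z'))%:E)%E =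
    mean m (kern s1 s2 c1 c2 X Y (w \_ S)) x.
  rewrite /mean; congr fine; rewrite integral_mkcond; apply: eq_integral => z _.
  rewrite patchE; case: ifPn => [/set_mem zt|/negP zt].
    by rewrite clOp (sum_reflections (fun z' => (w \_ S) (x - z')) zt).
  (* Off the closed rectangle every cut-off vanishes, so the integral extends to the whole plane. *)
  rewrite /kern big1// => i _ /=; rewrite /chi !indicE.
  have [/set_mem /cell_itv zx|_] := boolP (z.1 \in X i); last by rewrite !mul0r.
  have [/set_mem /cell_itv zy|_] := boolP (z.2 \in Y i); last by rewrite mulr0 mul0r.
  by exfalso; apply: zt; apply/mem_set.
by rewrite /conv_meas /smean !E.
Qed.

End unfolding.

Lemma swapK (R : realType) (q : bool) : involutive (@swap R q).
Proof. by case: q; case. Qed.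

Lemma bm_restrict_itv (R : realType) (a b : R) (f : R -> R) : a < b -> continuous f ->
  bm (fun t => f t * \1_(`[a, b]%classic) t).
Proof.
move=> ab cf; split.
  apply: measurable_funM; first exact: continuous_measurable_fun.
  by have [] := bm_indic R (measurable_itv `[a, b] : measurable (`[a, b]%classic : set R)).
have cnf : {within `[a, b], continuous (fun t => `|f t|)}.
  apply: continuous_subspaceT => t.
  by apply: continuous_comp; [exact: cf|exact: norm_continuous].
have [c _ fc] := EVT_max (ltW ab) cnf.
exists `|f c| => t; rewrite normrM indicE mem_setE.
have [tab|tab] := boolP (t \in `[a, b]); last by rewrite normr0 mulr0.
by rewrite normr1 mulr1 fc.
Qed.

(** * The estimate for a BV measure along either axis *)

Section bv_measure.
Variable R : realType.
Notation plane := (R * R)%type.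
Notation leb2 := (@leb2 R).
Variables (t : rect R) (mp mm : {finite_measure set plane -> \bar R}) (q : bool).
Hypothesis bv : meas_is_BV t mp mm.
Notation a := (if q then ryc t else rxa t).
Notation b := (if q then ryd t else rxb t).
Notation c := (if q then rxa t else ryc t).
Notation e := (if q then rxb t else ryd t).

Lemma bv_measure_estimate : exists2 C : R, 0 <= C &
  forall (H : plane -> R) (M : R), bm H ->
  (forall s r, c < r < e -> `|prim a b (fun z => H (swap q z)) s r| <= M) ->
  `|sintegral2 mp mm setT H| <= C * M.
Proof.
have [u [[mu [intu [n1p [n1m [n2p [n2m [_ _ _ _ ibp]]]]]]] dens]] := bv.
pose S := rect_open t; have mS : measurable S := @measurable_rect_open R t.
have ab : a < b by case: q; [exact: rect_cd|exact: rect_ab].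
have ce : c < e by case: q; [exact: rect_ab|exact: rect_cd].
pose p1 (z : plane) := (swap q z).1; pose p2 (z : plane) := (swap q z).2.
have mp1 : measurable_fun [set: plane] p1.
  by apply: measurableT_comp (@measurable_swap R q); exact: measurable_fst.
have mp2 : measurable_fun [set: plane] p2.
  by apply: measurableT_comp (@measurable_swap R q); exact: measurable_snd.
have Sp x : S x -> a < p1 x < b /\ c < p2 x < e.
  by rewrite /p1 /p2; case: q; case.
have [C C0 HC] : exists2 C : R, 0 <= C & forall (H : plane -> R) (M : R), bm H ->
    (forall s r, c < r < e -> `|prim a b H s r| <= M) ->
    `|sintegral2 mp mm S (fun x => H (p1 x, p2 x))| <= C * M.
  apply: (@bv_estimate _ _ R p1 p2 a b c e S mp mm (if q then n2p else n1p) (if q then n2m else n1m)) => //.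
  move=> f f' g sf sf' df sg suppf suppg.
  (* [f'] and [g] are only known to be continuous here; cutting them off at the closed rectangle
     makes them bounded without changing them on [S]. *)
  pose H x := (f' (p1 x) * \1_(`[a, b]%classic) (p1 x)) * (g (p2 x) * \1_(`[c, e]%classic) (p2 x)).
  have bH : bm H.
    have bc (h p : plane -> R) (k : R -> R) : measurable_fun [set: plane] p -> bm k -> bm (fun x => k (p x)).
      by move=> mpp [mk [K HK]]; split; [exact: measurableT_comp mk mpp|exists K].
    apply: bmM.
      exact: (bc p1 p1 _ mp1 (bm_restrict_itv ab (smooth1_continuous sf'))).
    exact: (bc p2 p2 _ mp2 (bm_restrict_itv ce (smooth1_continuous sg))).
  have HE x : S x -> H x = f' (p1 x) * g (p2 x).
    move=> /Sp[/andP[h1 h2] /andP[h3 h4]].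
    have i1 : p1 x \in `[a, b] by rewrite in_itv/= !ltW.
    have i2 : p2 x \in `[c, e] by rewrite in_itv/= !ltW.
    by rewrite /H !indicE !mem_setE i1 i2 !mulr1.
  transitivity (sintegral2 mp mm S H).
    by apply: eq_sintegral2 => x Sx; rewrite HE.
  rewrite -(sintegral2_open intu dens bH) (sintegral2_density intu dens bH).
  (* For the second axis the variable to be differentiated is the second coordinate, so the factors
     of the tensor are exchanged. *)
  pose phi : plane -> R := if q then tensor g f else tensor f g.
  have Cphi : Ccinf S phi.
    by rewrite /phi; move: suppf suppg; case: q => *; exact: Ccinf_tensor.
  have Dphi x : 'D_(if q then e2 R else e1 R) phi x = f' (p1 x) * g (p2 x).
    rewrite /phi /p1 /p2 /swap; case: q => /=.
      by have D := is_derive_tensor2 g (df x.2); rewrite derive_val mulrC.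
    by have D := is_derive_tensor1 g (df x.1); rewrite derive_val.
  have phiE : (fun x => f (p1 x) * g (p2 x)) = phi.
    by apply/funext => x; rewrite /phi /p1 /p2 /swap /tensor; case: q => //=; rewrite mulrC.
  rewrite phiE.
  have -> : \int[leb2]_(x in S) (H x * u x) =
      RintL S (fun x => u x * 'D_(if q then e2 R else e1 R) phi x).
    by apply: eq_Rintegral => x /set_mem Sx; rewrite HE// Dphi mulrC.
  have [I1 I2] := ibp phi Cphi.
  by clear - I1 I2; case: q.
exists C => // H M bH HM.
rewrite (sintegral2_open intu dens bH).
have bHs : bm (fun z => H (swap q z)).
  have [mH [K HK]] := bH; split; last by exists K => x; exact: HK.
  exact: measurableT_comp mH (@measurable_swap R q).
have := HC _ _ bHs HM; congr (`|_| <= _); apply: eq_sintegral2 => x _.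
by rewrite /p1 /p2 -surjective_pairing swapK.
Qed.

End bv_measure.

(** * Propagation through the layers *)

Section layers.
Variable R : realType.
Notation plane := (R * R)%type.
Variables (L : nat) (sigma : R -> R) (Om Sg : nat -> rect R) (w : nat -> plane -> R) (b : nat -> R).
Variables (mp mm : {finite_measure set plane -> \bar R}) (K : R).
Hypothesis sigma_lip : forall s t : R, `|sigma s - sigma t| <= K * `|s - t|.
Hypothesis w_L2 : forall l, (l < L)%N -> L2on (rect_open (Sg l)) (w l).
Notation pre := (preact sigma Om Sg w b mp mm).
Notation kernel l := (w l \_ (rect_open (Sg l))).
Notation layer l := (reflF (Om l.+1) (fun y => sigma (pre l y))).

Lemma first_layer (q : bool) : (0 < L)%N ->
  L2loc (pre 0%N) /\ (meas_is_BV (Om 0%N) mp mm -> Pdiff (if q then e2 R else e1 R) (pre 0%N)).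
Proof.
move=> L0; have LW := L2on_L2c (w_L2 L0).
(* The domain of the reflected measure is again a rectangle, and its bounded closure meets only
   finitely many reflected copies. *)
have [t' tE] := diffset_rect (Om 1%N) (Sg 0%N).
have clE : closure (Omp Om Sg 0%N) = rect_cl t' by rewrite /Omp tE closure_rect_open.
have [M HM] := rect_cl_box t'.
have [n1 P1] := fold1_lat (rect_ab (Om 0%N)) M.
have [n2 P2] := fold1_lat (rect_cd (Om 0%N)) M.
have Q1 (x : plane) := fun h : rect_cl t' x => P1 x.1 (HM x h).1.
have Q2 (x : plane) := fun h : rect_cl t' x => P2 x.2 (HM x h).2.
have E : pre 0%N = _ := funext (fun x => congr1 (+%R^~ (b 0%N))
  (conv_meas_smean Q1 Q2 mp mm (rect_open (Sg 0%N)) (w 0%N) x clE)).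
rewrite E; set F := smean _ _ _ _ _ _ _ _ _.
have LF : L2loc F.
  by apply: L2loc_smean => // i; exact: measurable_cell.
split; first exact: L2locD_cst.
move=> bv; have [C C0 HC] := bv_measure_estimate q bv.
have DF : Pdiff (if q then e2 R else e1 R) F.
  apply: (smean_Pdiff _ _ _ _ _ _ _ _ C0 HC LW); try by move=> i; exact: measurable_cell.
    by move=> i; exact: convex_cell.
  by move=> i; exact: convex_cell.
apply: (Pdiff_lip (u := F) (K := 1)) => //.
- by have [] := LF.
- by have [] := L2locD_cst (b 0%N) LF.
- by move=> x y; rewrite mul1r opprD addrACA subrr addr0.
Qed.

Lemma next_layer l : (l.+1 < L)%N -> L2loc (pre l) ->
  pre l.+1 = (fun x => cv (kernel l.+1) (layer l) x + b l.+1).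
Proof.
move=> lL Lp; apply/funext => x /=.
rewrite convFE//; first exact: w_L2.
have [] := L2loc_reflF (Om l.+1) (L2loc_lip sigma_lip (continuous_measurable_fun (lip_continuous sigma_lip)) Lp).
by [].
Qed.

Lemma L2loc_layer l : L2loc (pre l) -> L2loc (layer l).
Proof.
by move=> Lp; apply: L2loc_reflF; apply: (L2loc_lip sigma_lip) => //;
  exact: continuous_measurable_fun (lip_continuous sigma_lip).
Qed.

Lemma L2loc_pre l : (l < L)%N -> L2loc (pre l).
Proof.
elim: l => [|l IH] lL; first by have [] := first_layer true lL.
have Lp := IH (ltnW lL); rewrite next_layer//; apply: L2locD_cst.
by apply: cv_L2loc; [exact: L2on_L2c (w_L2 lL)|exact: L2loc_layer].
Qed.

Lemma Pdiff_layer (q : bool) l : (l < L)%N ->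
  Pdiff (if q then e2 R else e1 R) (pre l) -> Pdiff (if q then e2 R else e1 R) (layer l).
Proof.
move=> lL Dp; have Lp := L2loc_pre lL.
have ms : measurable_fun [set: R] sigma by exact: continuous_measurable_fun (lip_continuous sigma_lip).
have Ls := L2loc_lip sigma_lip ms Lp.
have Ds : Pdiff (if q then e2 R else e1 R) (fun y => sigma (pre l y)).
  by apply: (Pdiff_lip (u := pre l) (K := K)) => //; [have [] := Lp|have [] := Ls].
by case: q Ds {Dp}; [exact: Pdiff_reflF2|exact: Pdiff_reflF1].
Qed.

Lemma Pdiff_pre (q : bool) l : (l < L)%N -> meas_is_BV (Om 0%N) mp mm ->
  Pdiff (if q then e2 R else e1 R) (pre l).
Proof.
move=> + bv; elim: l => [|l IH] lL; first by have [_] := first_layer q lL; apply.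
have Lp := L2loc_pre (ltnW lL).
have LW := L2on_L2c (w_L2 lL); have Lu := L2loc_layer Lp.
have [mc _] := cv_L2loc LW Lu.
apply: (Pdiff_lip (u := cv (kernel l.+1) (layer l)) (K := 1)) => //.
- by have [] := L2loc_pre lL.
- by move=> x y; rewrite next_layer// mul1r opprD addrACA subrr addr0.
- by apply: cv_Pdiff => //; apply: Pdiff_layer; [exact: ltnW|exact: IH (ltnW lL)].
Qed.

End layers.

Theorem theorem2p1 (R : realType) (L : nat) (sigma : R -> R)
  (Om Sg : nat -> rect R) (w : nat -> R * R -> R) (b : nat -> R)
  (mp mm : {finite_measure set (R * R)%type -> \bar R}) :
  (2 <= L)%N ->
  (exists K : R, forall s t : R, `|sigma s - sigma t| <= K * `|s - t|) ->
  (forall l, (l < L)%N -> rect_open (Sg l) 0) ->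
  (forall l, (l < L)%N -> rect_open (Om l) `<=` Omp Om Sg l) ->
  (forall l, (l < L)%N -> L2on (rect_open (Sg l)) (w l)) ->
  supported_on mp (rect_cl (Om 0%N)) ->
  supported_on mm (rect_cl (Om 0%N)) ->
  (exists g : R * R -> R,
     {within rect_cl (Om L), continuous g} /\
     {ae @leb2 R, forall x, rect_open (Om L) x -> g x = NN L sigma Om Sg w b mp mm x})
  /\
  (meas_is_BV (Om 0%N) mp mm ->
   exists g : R * R -> R,
     C1_cl (Om L) g /\
     {ae @leb2 R, forall x, rect_open (Om L) x -> g x = NN L sigma Om Sg w b mp mm x}).
Proof.
case: L => [|[|l]]// _ [K sigma_lip] _ _ w_L2 _ _.
have Lp := L2loc_pre Om b mp mm sigma_lip w_L2 (ltnW (ltnSn l.+1)).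
have LW := L2on_L2c (w_L2 l.+1 (ltnSn _)).
have Lu := L2loc_layer sigma_lip Lp.
(* With two layers at least, the output is, up to a constant, an L^2 kernel convolved with a locally
   L^2 function; the regular representative is the network itself. *)
have E : NN l.+2 sigma Om Sg w b mp mm = _ := next_layer sigma_lip w_L2 (ltnSn l.+1) Lp.
set u := reflF _ _ in Lu E; set W := _ \_ _ in LW E.
have ccst (g : R * R -> R) (k : R) : continuous g -> continuous (fun x => g x + k).
  by move=> cg x; apply: cvgD; [exact: cg|exact: cvg_cst].
have cN : continuous (NN l.+2 sigma Om Sg w b mp mm).
  by rewrite E; apply: ccst; exact: cv_continuous.
have ae_refl : {ae @leb2 R, forall x, rect_open (Om l.+2) x ->
    NN l.+2 sigma Om Sg w b mp mm x = NN l.+2 sigma Om Sg w b mp mm x} by exact: aeW.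
split; first by exists (NN l.+2 sigma Om Sg w b mp mm); split => //; exact: (continuous_subspaceT cN).
move=> bv; exists (NN l.+2 sigma Om Sg w b mp mm); split => //.
split; first exact: (continuous_subspaceT cN).
have Du q : Pdiff (if q then e2 R else e1 R) u.
  apply: (Pdiff_layer sigma_lip w_L2 (ltnW (ltnSn l.+1))).
  exact: (Pdiff_pre b sigma_lip w_L2 q (ltnW (ltnSn l.+1)) bv).
have [d1 c1] := cv_C1 (e := e1 R) (eq_ind_r (fun r => r <= 1) (lexx 1) (normr1 R))
  (eq_ind_r (fun r => r <= 1) ler01 (normr0 R)) LW Lu (Du false).
have [d2 c2] := cv_C1 (e := e2 R) (eq_ind_r (fun r => r <= 1) ler01 (normr0 R))
  (eq_ind_r (fun r => r <= 1) (lexx 1) (normr1 R)) LW Lu (Du true).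
exists (fun x => 'D_(e1 R) (cv W u) x), (fun x => 'D_(e2 R) (cv W u) x).
split; first exact: (continuous_subspaceT c1).
split; first exact: (continuous_subspaceT c2).
have dD e x : derivable (cv W u) x e ->
    derivable (fun x => cv W u x + b l.+1) x e /\ 'D_e (fun x => cv W u x + b l.+1) x = 'D_e (cv W u) x.
  move=> d; have dc := derivable_cst (b l.+1) x e; split; first exact: (derivableD d dc).
  have -> := deriveD d dc; by rewrite derive_cst addr0.
move=> x _; rewrite E.
have [a1 b1] := dD (e1 R) x (d1 x).
have [a2 b2] := dD (e2 R) x (d2 x).
exact (And4 a1 b1 a2 b2).
Qed.
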